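(* Let $p,r,n$ be integers with $1\le r\le p-2$, $n\ge 1$ and $n\ge \frac{4-r}{p-r-1}$, and let $\Omega$ be a planar multi-patch domain with an analysis-suitable $G^1$ multi-patch spline parametrization, with patch, edge and vertex index sets $\mathcal I_\Omega,\mathcal I_\Sigma,\mathcal I_{\mathcal X}$. With the notation of the context, the functions - $\mathrm B^{(i)}_{\mathbf j}$, $\mathbf j\in\{2,\dots,N-3\}^2$, $i\in\mathcal I_\Omega$, - $\overline{\mathrm B}^{(i)}_{\mathbf j}$, $\mathbf j\in\mathbb I^\circ_{\Sigma^{(i)}}$, $i\in\mathcal I_\Sigma$, - $\mathring{\mathrm B}^{(i)}_{\mathbf j}$, $\mathbf j=(j_1,j_2)$ with $j_1,j_2\ge0$, $j_1+j_2\le2$, $i\in\mathcal I_{\mathcal X}$, (all extended by zero to $\overline\Omega$) form a basis of the Argyris isogeometric space $\mathcal A=\sum_{i\in\mathcal I_\Omega}\mathcal A^\circ_{\Omega^{(i)}}+\sum_{i\in\mathcal I_\Sigma}\mathcal A^\circ_{\Sigma^{(i)}}+\sum_{i\in\mathcal I_{\mathcal X}}\mathcal A_{\mathbf x^{(i)}}$ (so that this sum is direct).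
   Context: **Splines.** For integers $p,r,n$, $h=1/n$, $\mathcal S^{p,r}_h$ is the space of $C^r$ piecewise polynomials of degree $p$ on $[0,1]$ with $n$ uniform elements (open knot vector, interior knots of multiplicity $p-r$), with standard B-spline basis $b_0,\dots,b_{N-1}$, $N=(p-r)(n-1)+p+1$. $\mathcal S^{\mathbf p,\mathbf r}_h=\mathcal S^{p,r}_h\otimes\mathcal S^{p,r}_h$ on $[0,1]^2$ has the basis $b_{\mathbf j}(\xi_1,\xi_2)=b_{j_1}(\xi_1)b_{j_2}(\xi_2)$. Also $\{b^+_j\}_{j=0}^{N^+-1}$ and $\{b^-_j\}_{j=0}^{N^--1}$ are the B-spline bases of $\mathcal S^{p,r+1}_h$ and $\mathcal S^{p-1,r}_h$ (same mesh), $N^-=(p-r-1)(n-1)+p$, $N^+=N^-+1$. Put $c_0=b_0+b_1$, $c_1=\frac hp b_1$. **Domain.** $\Omega\subset\mathbb R^2$ is open, connected, regular, $\Gamma=\partial\Omega$, $\overline\Omega=\bigcup_{i\in\mathcal I_\Omega}\overline{\Omega^{(i)}}$ (finite), where the $\Omega^{(i)}$ are disjoint open patches, $\overline{\Omega^{(i)}}$ is parametrized one-to-one by $\mathbf F^{(i)}:[0,1]^2\to\overline{\Omega^{(i)}}$, $\mathbf F^{(i)}\in\mathcal S^{\mathbf p,\mathbf r}_h\times\mathcal S^{\mathbf p,\mathbf r}_h$, $\det[\partial_1\mathbf F^{(i)},\partial_2\mathbf F^{(i)}]>0$ on $[0,1]^2$. Edges (open) and vertices are the images of the sides and corners of $[0,1]^2$.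 No hanging nodes: distinct closed patches are disjoint, or share exactly one vertex, or exactly one closed edge, along which the two parametrizations agree up to orientation. $\mathcal I_\Sigma=\mathcal I^\circ_\Sigma\,\dot\cup\,\mathcal I^\Gamma_\Sigma$ indexes edges $\Sigma^{(i)}$ (interfaces, i.e. edges inside $\Omega$ shared by two patches; boundary edges); $\mathcal I_{\mathcal X}$ indexes all vertices $\mathbf x^{(i)}$, interior and boundary. **Standard form.** Patches may be reparametrized by rotations of $[0,1]^2$ by multiples of $\pi/2$, separately for each edge or vertex considered. An interface $\Sigma^{(i)}$ between $\Omega^{(\imath_1)},\Omega^{(\imath_2)}$ is in standard form if $\mathbf F^{(\imath_1)}(0,\xi)=\mathbf F^{(\imath_2)}(\xi,0)$ for $\xi\in[0,1]$, this being the parametrization of $\overline{\Sigma^{(i)}}$. A boundary edge of $\Omega^{(\imath_1)}$ is in standard form if it is $\{\mathbf F^{(\imath_1)}(0,\xi):0<\xi<1\}$. **Analysis-suitable $G^1$.** For each interface in standard form there are polynomials $\alpha^{(i,\imath_1)},\alpha^{(i,\imath_2)},\beta^{(i,\imath_1)},\beta^{(i,\imath_2)}$ of degree at most $1$ (gluing data, fixed once and for all), with $\alpha^{(i,\imath_1)},\alpha^{(i,\imath_2)}$ relatively prime, such that on $[0,1]$: $\alpha^{(i,\imath_1)}\alpha^{(i,\imath_2)}>0$ and, with $\beta^{(i)}=\alpha^{(i,\imath_1)}\beta^{(i,\imath_2)}+\alpha^{(i,\imath_2)}\beta^{(i,\imath_1)}$, $$\alpha^{(i,\imath_1)}(\xi)\,\partial_2\mathbf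 F^{(\imath_2)}(\xi,0)+\alpha^{(i,\imath_2)}(\xi)\,\partial_1\mathbf F^{(\imath_1)}(0,\xi)+\beta^{(i)}(\xi)\,\partial_2\mathbf F^{(\imath_1)}(0,\xi)=\mathbf 0.$$ If the roles of the two patches are swapped (opposite orientation of the interface), the data are transported by $\alpha(\xi)\mapsto\alpha(1-\xi)$, $\beta(\xi)\mapsto-\beta(1-\xi)$. **Patch-interior space.** $\mathrm B^{(i)}_{\mathbf j}:\overline{\Omega^{(i)}}\to\mathbb R$ is defined by $\mathrm B^{(i)}_{\mathbf j}\circ\mathbf F^{(i)}=b_{\mathbf j}$; $\mathcal A^\circ_{\Omega^{(i)}}=\mathrm{span}\{\mathrm B^{(i)}_{\mathbf j}:\mathbf j\in\{2,\dots,N-3\}^2\}$. **Edge space.** For an interface in standard form, $\overline{\mathrm B}^{(i)}_{\mathbf j}:\overline{\Omega^{(\imath_1)}}\cup\overline{\Omega^{(\imath_2)}}\to\mathbb R$ is defined, for $0\le j\le N^+-1$, by $$\overline{\mathrm B}^{(i)}_{(j,0)}\circ\mathbf F^{(\imath_1)}=b^+_j(\xi_2)c_0(\xi_1)-\beta^{(i,\imath_1)}(\xi_2)(b^+_j)'(\xi_2)c_1(\xi_1),\quad \overline{\mathrm B}^{(i)}_{(j,0)}\circ\mathbf F^{(\imath_2)}=b^+_j(\xi_1)c_0(\xi_2)-\beta^{(i,\imath_2)}(\xi_1)(b^+_j)'(\xi_1)c_1(\xi_2),$$ and, for $0\le j\le N^--1$, by $$\overline{\mathrm B}^{(i)}_{(j,1)}\circ\mathbf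 F^{(\imath_1)}=\alpha^{(i,\imath_1)}(\xi_2)b^-_j(\xi_2)b_1(\xi_1),\quad \overline{\mathrm B}^{(i)}_{(j,1)}\circ\mathbf F^{(\imath_2)}=-\alpha^{(i,\imath_2)}(\xi_1)b^-_j(\xi_1)b_1(\xi_2).$$ For a boundary edge in standard form: $\overline{\mathrm B}^{(i)}_{(j,0)}\circ\mathbf F^{(\imath_1)}=b^+_j(\xi_2)c_0(\xi_1)$, $\overline{\mathrm B}^{(i)}_{(j,1)}\circ\mathbf F^{(\imath_1)}=b^-_j(\xi_2)b_1(\xi_1)$ (with $\xi_1,\xi_2$ exchanged if the edge is at $\xi_2=0$). $\mathbb I^\circ_{\Sigma^{(i)}}$ is the set of $(j_1,j_2)$, $j_1\ge 0$, $j_2\in\{0,1\}$, with $j_1+j_2\ge3$ and $j_1\le N^--3$, and $\mathcal A^\circ_{\Sigma^{(i)}}=\mathrm{span}\{\overline{\mathrm B}^{(i)}_{\mathbf j}:\mathbf j\in\mathbb I^\circ_{\Sigma^{(i)}}\}$. **Vertex space.** Let $\mathbf x^{(i)}$ be a vertex contained in $\nu$ patches $\Omega^{(\imath_2)},\Omega^{(\imath_4)},\dots,\Omega^{(\imath_{2\nu})}$, in counterclockwise order, in standard form: $\mathbf F^{(\imath_{2\ell})}(0,0)=\mathbf x^{(i)}$ and $\mathbf F^{(\imath_{2\ell})}(0,\xi)=\mathbf F^{(\imath_{2\ell+2})}(\xi,0)$ for $\ell=1,\dots,\nu$ (interior vertex, sub-indices modulo $2\nu$) or $\ell=1,\dots,\nu-1$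 (boundary vertex). $\Sigma^{(\imath_{2\ell+1})}$ is the interface between $\Omega^{(\imath_{2\ell})}$ (first patch) and $\Omega^{(\imath_{2\ell+2})}$ (second patch); at a boundary vertex, $\Sigma^{(\imath_1)}$ and $\Sigma^{(\imath_{2\nu+1})}$ are the boundary edges $\{\mathbf F^{(\imath_2)}(\xi,0)\}$ and $\{\mathbf F^{(\imath_{2\nu})}(0,\xi)\}$. $C^2(\mathbf x^{(i)})$ is the set of piecewise smooth functions whose derivatives up to order 2 are continuous at $\mathbf x^{(i)}$. For even $k$, $\Pi_k\varphi$ is the unique element of $\mathrm{span}\{\mathrm B^{(\imath_k)}_{\mathbf j}:\mathbf j\in\{0,1\}^2\}$ with $\partial_1^{m_1}\partial_2^{m_2}(\Pi_k\varphi\circ\mathbf F^{(\imath_k)})(0,0)=\partial_1^{m_1}\partial_2^{m_2}(\varphi\circ\mathbf F^{(\imath_k)})(0,0)$ for $0\le m_1,m_2\le1$. For odd $k$, $\Pi_k\varphi$ is the unique element of $\mathrm{span}\{\overline{\mathrm B}^{(\imath_k)}_{\mathbf j}:0\le j_1,\,0\le j_2\le1,\,j_1+j_2\le2\}$ such that $\partial_1^{m_1}\partial_2^{m_2}$ of $\Pi_k\varphi\circ\mathbf F^{(\imath_{k\pm1})}$ and $\varphi\circ\mathbf F^{(\imath_{k\pm1})}$ agree at $(0,0)$ for $m_1+m_2\le2$, with $m_1\le1$ on the patch $\imath_{k-1}$ and $m_2\le1$ on the patch $\imath_{k+1}$ (for those of the two patches that exist). All functions are extended by zero outside their patches. Then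 $\Pi_{\mathcal A_{\mathbf x^{(i)}}}=\sum_k(-1)^{k+1}\Pi_k$, with $k=1,\dots,2\nu$ (interior vertex) or $k=1,\dots,2\nu+1$ (boundary vertex), and $\mathcal A_{\mathbf x^{(i)}}$ is the image of $C^2(\mathbf x^{(i)})$ under $\Pi_{\mathcal A_{\mathbf x^{(i)}}}$. With $\sigma=\big(\frac{h}{p\,\nu}\sum_{\ell=1}^\nu\|\nabla\mathbf F^{(\imath_{2\ell})}(0,0)\|\big)^{-1}$, the vertex functions are $$\mathring{\mathrm B}^{(i)}_{\mathbf j}=\Pi_{\mathcal A_{\mathbf x^{(i)}}}\Big(\sigma^{j_1+j_2}\tfrac{(x_1-x^{(i)}_1)^{j_1}}{j_1!}\tfrac{(x_2-x^{(i)}_2)^{j_2}}{j_2!}\Big).$$ *)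

(* Defs.v *)
From mathcomp Require Import all_boot all_order all_algebra.
From mathcomp Require Import all_classical all_reals all_analysis.
Import Order.TTheory GRing.Theory Num.Theory.
Import numFieldNormedType.Exports.

Set Implicit Arguments.
Unset Strict Implicit.
Unset Printing Implicit Defensive.

Local Open Scope classical_set_scope.
Local Open Scope ring_scope.

Section LinearAlgebra.
Context {R : realType} {V : lmodType R}.

Definition lspan {J : finType} (e : J -> V) : set V :=
  [set u | exists c : J -> R, u = \sum_j c j *: e j].

Definition lin_indep {J : finType} (e : J -> V) : Prop :=
  forall c : J -> R, \sum_j c j *: e j = 0 -> forall j, c j = 0.

Definition is_basis {J : finType} (e : J -> V) (A : set V) : Prop :=
  lin_indep e /\ lspan e = A.

Definition sum_space {K : finType} (A : K -> set V) : set V :=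
  [set u | exists2 w : K -> V, forall k, A k (w k) & u = \sum_k w k].

Definition direct_sum {K : finType} (A : K -> set V) : Prop :=
  forall w : K -> V, (forall k, A k (w k)) -> \sum_k w k = 0 ->
  forall k, w k = 0.

Definition is_norm (nrm : V -> R) : Prop :=
  [/\ forall u, nrm u = 0 -> u = 0,
      forall c u, nrm (c *: u) = `|c| * nrm u
    & forall u v, nrm (u + v) <= nrm u + nrm v].

End LinearAlgebra.

Section Calculus.
Context {R : realType}.

Definition d1 (f : R * R -> R) : R * R -> R :=
  fun z => derive1 (fun t : R => f (t, z.2)) z.1.
Definition d2 (f : R * R -> R) : R * R -> R :=
  fun z => derive1 (fun t : R => f (z.1, t)) z.2.
Definition dmix (m1 m2 : nat) (f : R * R -> R) : R * R -> R :=
  iter m1 d1 (iter m2 d2 f).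

Definition coord (k : 'I_2) (z : R * R) : R := if k == ord0 then z.1 else z.2.

Definition jac (F : R * R -> R * R) (z : R * R) : 'M[R]_2 :=
  \matrix_(k < 2, l < 2)
    (if l == ord0 then d1 (coord k \o F) z else d2 (coord k \o F) z).

Fixpoint Ck (k : nat) (f : R * R -> R) : Prop :=
  continuous f /\
  if k is k'.+1 then
    [/\ forall z : R * R, derivable (fun t : R => f (t, z.2)) z.1 1,
        forall z : R * R, derivable (fun t : R => f (z.1, t)) z.2 1,
        Ck k' (d1 f) & Ck k' (d2 f)]
  else True.

Definition smooth (f : R * R -> R) : Prop := forall k, Ck k f.

Definition unit_itv : set R := [set t | 0 <= t <= 1].
Definition unit_sq : set (R * R) := [set z | unit_itv z.1 /\ unit_itv z.2].
Definition open_sq : set (R * R) := [set z | 0 < z.1 < 1 /\ 0 < z.2 < 1].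

(* The rotation of the unit square by pi/2 about its centre. *)
Definition rot (z : R * R) : R * R := (1 - z.2, z.1).

End Calculus.

(* Splines on [0,1] are represented by functions on the whole line, the first
   and the last polynomial pieces being prolonged to -oo and +oo. Thus the
   derivatives at 0 and 1 below are the one-sided derivatives on [0,1]. *)

Section Splines.
Context {R : realType}.

(* x lies in the closed k-th element [k/n, (k+1)/n], prolonged as above *)
Definition in_element (n k : nat) (x : R) : Prop :=
  (k = 0%N \/ k%:R / n%:R <= x) /\ (k.+1 = n \/ x <= k.+1%:R / n%:R).

Definition Cr (r : nat) (f : R -> R) : Prop :=
  (forall k x, (k < r)%N -> derivable (derive1n k f) x 1) /\
  (forall k, (k <= r)%N -> continuous (derive1n k f)).

Definition spline_space (p r n : nat) : set (R -> R) :=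
  [set f | Cr r f /\
     forall k, (k < n)%N -> exists2 q : {poly R}, (size q <= p.+1)%N &
       forall x, in_element n k x -> f x = q.[x]].

Definition tensor_spline_space (p r n : nat) : set (R * R -> R) :=
  [set g | exists m (f1 f2 : 'I_m -> R -> R),
     (forall k, spline_space p r n (f1 k) /\ spline_space p r n (f2 k)) /\
     g = fun z => \sum_k f1 k z.1 * f2 k z.2].

Definition knots (p r n : nat) : seq R :=
  nseq p.+1 0
  ++ flatten [seq nseq (p - r) (k%:R / n%:R) | k <- iota 1 n.-1]
  ++ nseq p.+1 1.

(* Cox-de Boor recursion; 0^-1 = 0 gives the usual convention for vanishing
   denominators. *)
Fixpoint bspline (t : nat -> R) (d i : nat) (x : R) : R :=
  if d is d'.+1 then
    (x - t i) / (t (i + d)%N - t i) * bspline t d' i x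
    + (t (i + d).+1 - x) / (t (i + d).+1 - t i.+1) * bspline t d' i.+1 x
  else
    ([&& t i < t i.+1, (t i == 0) || (t i <= x)
       & (t i.+1 == 1) || (x < t i.+1)])%:R.

Definition Bs (p r n j : nat) : R -> R := bspline (nth 1 (knots p r n)) p j.

Definition NB (p r n : nat) : nat := ((p - r) * (n - 1) + p + 1)%N.

Definition Bplus (p r n j : nat) : R -> R := Bs p r.+1 n j.
Definition Bminus (p r n j : nat) : R -> R := Bs p.-1 r n j.
Definition Nminus (p r n : nat) : nat := NB p.-1 r n.

Definition c0 (p r n : nat) (x : R) : R := Bs p r n 0 x + Bs p r n 1 x.
Definition c1 (p r n : nat) (x : R) : R := n%:R^-1 / p%:R * Bs p r n 1 x.

End Splines.

(* al1, be1 belong to the first patch (edge at xi_1 = 0) and al2, be2 to the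
   second one (edge at xi_2 = 0). *)
Record gluing (R : realType) := Gluing {
  al1 : {poly R};
  al2 : {poly R};
  be1 : {poly R};
  be2 : {poly R} }.

Definition gluing_swap (R : realType) (g : gluing R) : gluing R :=
  Gluing (al2 g \Po (1 - 'X)) (al1 g \Po (1 - 'X))
         (- (be2 g \Po (1 - 'X))) (- (be1 g \Po (1 - 'X))).

(* A frame (i, k) is the patch i reparametrized by the k-th power of rot; each
   side of each patch is the left side {0} x [0,1] of exactly one frame, and the
   bottom side [0,1] x {0} of exactly one frame.
   gdata a b is the gluing data of the interface that is the left side of the
   frame a and the bottom side of the frame b; it is only meaningful when the
   pair a, b is in standard form. *)
Record multipatch (R : realType) := Multipatch {
  patch : finType;
  param : patch -> R * R -> R * R;
  dom : set (R * R);
  inter : finType;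
  inter_std : inter -> (patch * 'I_4) * (patch * 'I_4);
  bdry : finType;
  bdry_std : bdry -> patch * 'I_4;
  vert : finType;
  vpos : vert -> R * R;
  valence : vert -> nat;
  fan : forall v : vert, 'I_(valence v) -> patch * 'I_4;
  gdata : patch * 'I_4 -> patch * 'I_4 -> gluing R }.

Section Geometry.
Context {R : realType} (D : multipatch R).

Definition frame : Type := (patch D * 'I_4)%type.

Definition fparam (a : frame) : R * R -> R * R :=
  fun z => param a.1 (iter a.2 rot z).

Definition closed_patch (i : patch D) : set (R * R) := param i @` unit_sq.
Definition open_patch (i : patch D) : set (R * R) := param i @` open_sq.

Definition left_edge (a : frame) : set (R * R) :=
  [set fparam a (0, t) | t in [set t | 0 < t < 1]].
Definition bottom_edge (a : frame) : set (R * R) :=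
  [set fparam a (t, 0) | t in [set t | 0 < t < 1]].
Definition closed_left_edge (a : frame) : set (R * R) :=
  [set fparam a (0, t) | t in unit_itv].
Definition corner (a : frame) : R * R := fparam a (0, 0).

Definition Gamma : set (R * R) := closure (dom D) `\` dom D.

Definition conforming (i j : patch D) : Prop :=
  [\/ closed_patch i `&` closed_patch j = set0,
      exists a b : frame,
        [/\ a.1 = i, b.1 = j, corner a = corner b
          & closed_patch i `&` closed_patch j = [set corner a]]
    | exists a b : frame,
        [/\ a.1 = i, b.1 = j,
            closed_patch i `&` closed_patch j = closed_left_edge a
          & (forall t, unit_itv t -> fparam a (0, t) = fparam b (0, t)) \/
            (forall t, unit_itv t -> fparam a (0, t) = fparam b (0, 1 - t))]].

Record multipatch_domain (p r n : nat) : Prop := MultipatchDomain {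
  dom_open : open (dom D);
  dom_connected : connected (dom D);
  dom_regular : interior (closure (dom D)) = dom D;
  dom_cover : closure (dom D) = \bigcup_(i in setT) closed_patch i;
  patch_disjoint : forall i j : patch D,
    i != j -> open_patch i `&` open_patch j = set0;
  param_spline : forall (i : patch D) (k : 'I_2),
    tensor_spline_space p r n (coord k \o param i);
  param_inj : forall (i : patch D) (z z' : R * R), unit_sq z -> unit_sq z' ->
    param i z = param i z' -> z = z';
  param_det : forall (i : patch D) (z : R * R), unit_sq z ->
    0 < \det (jac (param i) z);
  no_hanging_nodes : forall i j : patch D, i != j -> conforming i j }.

Definition std_interface (a b : frame) : Prop :=
  a.1 != b.1 /\ forall t, unit_itv t -> fparam a (0, t) = fparam b (t, 0).

(* If (a, b) is in standard form, so is (turn b, unturn a): this is the same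
   interface with the two patches swapped and the opposite orientation. *)
Definition turn (a : frame) : frame := (a.1, ordS a.2).
Definition unturn (a : frame) : frame := (a.1, ord_pred a.2).

Record standard_forms : Prop := StandardForms {
  inter_is_std : forall e : inter D,
    std_interface (inter_std e).1 (inter_std e).2;
  inter_bij : set_bij setT
    [set X | (exists a : frame, X = left_edge a) /\ X `<=` dom D]
    (fun e : inter D => left_edge (inter_std e).1);
  bdry_bij : set_bij setT
    [set X | (exists a : frame, X = left_edge a) /\ X `<=` Gamma]
    (fun e : bdry D => left_edge (bdry_std e));
  vert_bij : set_bij setT [set x | exists a : frame, x = corner a] (@vpos R D);
  fan_corner : forall (v : vert D) (l : 'I_(valence v)),
    corner (fan l) = vpos v;
  fan_patches : forall v : vert D,
    set_bij setT [set i | closed_patch i (vpos v)]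
      (fun l : 'I_(valence v) => (fan l).1);
  (* ordS is the cyclic successor *)
  fan_inter : forall (v : vert D) (l : 'I_(valence v)),
    dom D (vpos v) \/ (l.+1 < valence v)%N ->
    std_interface (fan l) (fan (ordS l));
  fan_first : forall (v : vert D) (l : 'I_(valence v)),
    ~ dom D (vpos v) -> l = 0%N :> nat -> bottom_edge (fan l) `<=` Gamma;
  fan_last : forall (v : vert D) (l : 'I_(valence v)),
    ~ dom D (vpos v) -> l.+1 = valence v -> left_edge (fan l) `<=` Gamma }.

Definition is_gluing (a b : frame) (g : gluing R) : Prop :=
  [/\ [/\ (size (al1 g) <= 2)%N, (size (al2 g) <= 2)%N,
          (size (be1 g) <= 2)%N & (size (be2 g) <= 2)%N],
      coprimep (al1 g) (al2 g),
      forall t, unit_itv t -> 0 < (al1 g).[t] * (al2 g).[t]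
    & forall t, unit_itv t -> forall k : 'I_2,
        (al1 g).[t] * d2 (coord k \o fparam b) (t, 0)
        + (al2 g).[t] * d1 (coord k \o fparam a) (0, t)
        + (al1 g * be2 g + al2 g * be1 g).[t] * d2 (coord k \o fparam a) (0, t)
        = 0].

Definition analysis_suitable : Prop :=
  forall a b : frame, std_interface a b ->
    is_gluing a b (gdata a b) /\
    gdata (turn b) (unturn a) = gluing_swap (gdata a b).

(* u : mfun stands for a function on the patches that may be discontinuous
   across interfaces: u i is its pullback by param i, relevant on the unit
   square only. glue turns it into a function on the plane, vanishing outside
   the closure of the domain; if the restrictions of u to the closed patches
   agree on their intersections, the choice of the patch i is immaterial. *)

Definition mfun : Type := patch D -> R * R -> R.

Definition glue (u : mfun) : R * R -> R := fun x =>
  if [pick i : patch D | `[< closed_patch i x >]] is Some i then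
    u i (xget (0, 0) [set z | unit_sq z /\ param i z = x])
  else 0.

(* the function u on the closed patch a.1, extended by zero to the other
   patches, such that u composed with fparam a is g *)
Definition on_patch (a : frame) (g : R * R -> R) : mfun :=
  fun i z => if i == a.1 then g (iter (4 - a.2) rot z) else 0.

(* u composed with fparam a *)
Definition pull (u : mfun) (a : frame) : R * R -> R :=
  fun z => u a.1 (iter a.2 rot z).

Section ArgyrisSpace.
Variables p r n : nat.

Definition patch_fun (a : frame) (j1 j2 : nat) : mfun :=
  on_patch a (fun z => Bs p r n j1 z.1 * Bs p r n j2 z.2).

(* Edge functions are used for j2 = 0 and j2 = 1 only. *)
Definition inter_fun (a b : frame) (j1 j2 : nat) : mfun :=
  let g := gdata a b in
  if j2 == 0%N then
    on_patch a (fun z => Bplus p r n j1 z.2 * c0 p r n z.1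
      - (be1 g).[z.2] * derive1 (Bplus p r n j1) z.2 * c1 p r n z.1)
    + on_patch b (fun z => Bplus p r n j1 z.1 * c0 p r n z.2
      - (be2 g).[z.1] * derive1 (Bplus p r n j1) z.1 * c1 p r n z.2)
  else
    on_patch a (fun z => (al1 g).[z.2] * Bminus p r n j1 z.2 * Bs p r n 1 z.1)
    + on_patch b
        (fun z => - (al2 g).[z.1] * Bminus p r n j1 z.1 * Bs p r n 1 z.2).

Definition left_fun (a : frame) (j1 j2 : nat) : mfun :=
  on_patch a (fun z =>
    if j2 == 0%N then Bplus p r n j1 z.2 * c0 p r n z.1
    else Bminus p r n j1 z.2 * Bs p r n 1 z.1).

Definition bottom_fun (a : frame) (j1 j2 : nat) : mfun :=
  on_patch a (fun z =>
    if j2 == 0%N then Bplus p r n j1 z.1 * c0 p r n z.2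
    else Bminus p r n j1 z.1 * Bs p r n 1 z.2).

(* The element of S with the same derivatives as phi at the corners of the
   frames, for the frames and the orders of derivatives singled out by C. *)
Definition hermite_proj (S : set mfun) (C : frame -> nat -> nat -> Prop)
    (phi : patch D -> R * R -> R) : mfun :=
  xget 0 [set u | S u /\ forall a m1 m2, C a m1 m2 ->
    dmix m1 m2 (pull u a) (0, 0) = dmix m1 m2 (phi a.1 \o fparam a) (0, 0)].

Definition low_ix : finType := {j : 'I_3 * 'I_2 | (j.1 + j.2 <= 2)%N}.
Definition low_span (e : nat -> nat -> mfun) : set mfun :=
  lspan (fun j : low_ix => e (val j).1 (val j).2).

Definition patch_proj (a : frame) :=
  hermite_proj
    (lspan (fun j : 'I_2 * 'I_2 => patch_fun a j.1 j.2))
    (fun a' m1 m2 => a' = a /\ (m1 <= 1)%N /\ (m2 <= 1)%N).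

Definition inter_proj (a b : frame) :=
  hermite_proj (low_span (inter_fun a b))
    (fun a' m1 m2 => (m1 + m2 <= 2)%N /\
       (a' = a /\ (m1 <= 1)%N \/ a' = b /\ (m2 <= 1)%N)).

Definition left_proj (a : frame) :=
  hermite_proj (low_span (left_fun a))
    (fun a' m1 m2 => a' = a /\ (m1 + m2 <= 2)%N /\ (m1 <= 1)%N).

Definition bottom_proj (a : frame) :=
  hermite_proj (low_span (bottom_fun a))
    (fun a' m1 m2 => a' = a /\ (m1 + m2 <= 2)%N /\ (m2 <= 1)%N).

(* Piecewise smooth functions, phi i being a smooth extension to the plane of
   the restriction of the function to the closed patch i, with derivatives up to
   order 2 continuous at the vertex v. *)
Definition C2_at (v : vert D) : set (patch D -> R * R -> R) :=
  [set phi | (forall i, smooth (phi i)) /\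
     forall i j, closed_patch i (vpos v) -> closed_patch j (vpos v) ->
     forall m1 m2, (m1 + m2 <= 2)%N ->
       dmix m1 m2 (phi i) (vpos v) = dmix m1 m2 (phi j) (vpos v)].

Definition vert_proj (v : vert D) (phi : patch D -> R * R -> R) : mfun :=
  (if `[< dom D (vpos v) >] then
     \sum_(l < valence v) inter_proj (fan l) (fan (ordS l)) phi
   else
     \sum_(l < valence v | l == 0%N :> nat) bottom_proj (fan l) phi
     + \sum_(l < valence v | (l.+1 < valence v)%N)
         inter_proj (fan l) (fan (ordS l)) phi
     + \sum_(l < valence v | l.+1 == valence v) left_proj (fan l) phi)
  - \sum_(l < valence v) patch_proj (fan l) phi.

Definition vert_scale (nrm : 'M[R]_2 -> R) (v : vert D) : R :=
  (n%:R^-1 / (p%:R * (valence v)%:R)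
   * \sum_(l < valence v) nrm (jac (fparam (fan l)) (0, 0)))^-1.

Definition vert_fun (nrm : 'M[R]_2 -> R) (v : vert D) (j1 j2 : nat) : mfun :=
  vert_proj v (fun _ x => vert_scale nrm v ^+ (j1 + j2)
    * ((x.1 - (vpos v).1) ^+ j1 / j1`!%:R)
    * ((x.2 - (vpos v).2) ^+ j2 / j2`!%:R)).

Definition patch_ix : finType :=
  {j : 'I_(NB p r n) * 'I_(NB p r n) |
     [&& 2 <= j.1, j.1 + 3 <= NB p r n, 2 <= j.2 & j.2 + 3 <= NB p r n]%N}.
Definition edge_ix : finType :=
  {j : 'I_(Nminus p r n) * 'I_2 |
     (3 <= j.1 + j.2)%N && (j.1 + 3 <= Nminus p r n)%N}.
Definition vert_ix : finType := {j : 'I_3 * 'I_3 | (j.1 + j.2 <= 2)%N}.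

Definition edge : finType := (inter D + bdry D)%type.

Definition patch_basis (i : patch D) (j : patch_ix) : R * R -> R :=
  glue (patch_fun (i, ord0) (val j).1 (val j).2).

Definition edge_basis (e : edge) (j : edge_ix) : R * R -> R :=
  match e with
  | inl s => glue (inter_fun (inter_std s).1 (inter_std s).2 (val j).1 (val j).2)
  | inr s => glue (left_fun (bdry_std s) (val j).1 (val j).2)
  end.

Definition vert_basis (nrm : 'M[R]_2 -> R) (v : vert D) (j : vert_ix) :
    R * R -> R :=
  glue (vert_fun nrm v (val j).1 (val j).2).

Definition patch_space (i : patch D) : set (R * R -> R) :=
  lspan (patch_basis i).
Definition edge_space (e : edge) : set (R * R -> R) := lspan (edge_basis e).
Definition vert_space (v : vert D) : set (R * R -> R) :=
  [set glue (vert_proj v phi) | phi in C2_at v].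

Definition argyris_ix : finType :=
  (patch D * patch_ix + edge * edge_ix + vert D * vert_ix)%type.

Definition argyris_basis (nrm : 'M[R]_2 -> R) (k : argyris_ix) : R * R -> R :=
  match k with
  | inl (inl (i, j)) => patch_basis i j
  | inl (inr (e, j)) => edge_basis e j
  | inr (v, j) => vert_basis nrm v j
  end.

Definition argyris_summand (k : patch D + edge + vert D) : set (R * R -> R) :=
  match k with
  | inl (inl i) => patch_space i
  | inl (inr e) => edge_space e
  | inr v => vert_space v
  end.

Definition argyris_space : set (R * R -> R) := sum_space argyris_summand.

End ArgyrisSpace.
End Geometry.

(* Main.v *)
(* Every function is pulled back to the frames of the patches, where near a
   corner it is a polynomial and its derivatives there are coefficients.

   The 2-jet of a function at a corner separates the vertex functions from all
   others: patch and edge functions have zero 2-jets at all corners, a vertex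
   function has zero 2-jets at all corners but those at its own vertex, and there
   the alternating sum of the Hermite projections reproduces the 2-jet of the
   function it interpolates. Indeed, on each patch of the fan the two adjacent
   edge projections match that jet, up to the second normal derivatives, while
   the patch projection removes what they have in common; that the edge
   projections exist is due to the gluing condition at the vertex, differentiated
   up to first order. Since the parametrizations are regular, this 2-jet in turn
   determines the 2-jet of the function at the vertex, hence the coefficients of
   its Taylor polynomial, and it shows that the vertex space is spanned by the six
   vertex functions. Once the vertex coefficients vanish, the traces of order 0
   and 1 on an edge separate the functions of this edge from the other edge
   functions and from the patch functions, which vanish to order 2 there, and the
   independence of univariate B-splines finishes the proof. That independence
   follows from Marsden's identity: the d+1 B-splines of degree d alive on an
   element span all polynomials of degree at most d. *)

From mathcomp Require Import all_boot all_order all_algebra.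
From mathcomp Require Import all_classical all_reals all_analysis.
From mathcomp Require Import ring lra polyXY zify.
Require Import Defs.
Import Order.TTheory GRing.Theory Num.Theory.
Import numFieldNormedType.Exports.

Set Implicit Arguments.
Unset Strict Implicit.
Unset Printing Implicit Defensive.

Local Open Scope classical_set_scope.
Local Open Scope ring_scope.

(** * Jets of composite functions *)

(** The projections are picked by [xget], so even their linearity has to come from unique
    solvability. For an interface this is delicate: ten derivative conditions, five on each patch,
    are imposed on five coefficients. Those on the first patch already determine the coefficients,
    through a triangular system. Those on the second patch then hold because the pullbacks of a
    function with a single 2-jet at the vertex inherit, by the chain rule, the linear relation that
    the gluing data impose on the parametrizations. The lower bound on [n] is the inequality
    [5 <= Nminus p r n] in disguise: it gives the edge functions with [j1 + j2 <= 2] a zero 2-jet at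
    the far end of the edge. Since [glue] makes an arbitrary choice on common edges, only values in
    open patches are used; pullbacks being polynomial near a corner, these values determine all
    derivatives there. What has to be known of a pullback is recorded as orders of vanishing of
    univariate factors at the four sides, which a rotation of the square merely permutes. *)

Section ChainRule.
Context {R : realType}.
Implicit Types f : R * R -> R.

Lemma is_derive_d1 f z : derivable (fun t => f (t, z.2)) z.1 1 ->
  is_derive z.1 1 (fun t => f (t, z.2)) (d1 f z).
Proof. by move=> df; rewrite /d1 derive1E; exact: derivableP. Qed.

Lemma is_derive_d2 f z : derivable (fun t => f (z.1, t)) z.2 1 ->
  is_derive z.2 1 (fun t => f (z.1, t)) (d2 f z).
Proof. by move=> df; rewrite /d2 derive1E; exact: derivableP. Qed.

(** Stated with absolute values so that it applies whatever the sign of [b - a], zero included: the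
    increments it is used for have no known sign. *)
Lemma mean_value (f df : R -> R) (a b : R) :
  (forall x : R, is_derive x 1 f (df x)) ->
  exists2 c, `|c - a| <= `|b - a| & f b - f a = df c * (b - a).
Proof.
move=> fd.
have cf : continuous f.
  by move=> x; apply/differentiable_continuous/derivable1_diffP; case: (fd x).
have [ab|ba] := leP a b.
  have [|c] := @MVT_segment R f df a b ab (fun x _ => fd x).
    exact: continuous_subspaceT.
  rewrite in_itv /= => /andP[ac cb] E; exists c => //.
  by rewrite !ger0_norm; lra.
have [|c] := @MVT_segment R f df b a (ltW ba) (fun x _ => fd x).
  exact: continuous_subspaceT.
rewrite in_itv /= => /andP[ac cb] E; exists c.
  by rewrite !ler0_norm; lra.
by rewrite -opprB E; ring.
Qed.

Lemma cvg_pair_continuous f (T : Type) (F : set_system T) (FF : Filter F)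
    (u v : T -> R) (a b : R) : {for (a, b), continuous f} ->
  u x @[x --> F] --> a -> v x @[x --> F] --> b ->
  f (u x, v x) @[x --> F] --> f (a, b).
Proof.
move=> cf ua vb; apply: (@cvg_comp _ _ _ (fun x => (u x, v x)) f).
  exact: cvg_pair ua vb.
exact: cf.
Qed.

(** Only partial derivatives are available, so the increment is split into one step along each axis.
    The mean value theorem turns each step into a partial derivative at an intermediate point, and
    continuity of the partials gives the limit. *)
Lemma is_derive_chain f (x y : R -> R) (t dx dy : R) : Ck 1 f ->
  is_derive t 1 x dx -> is_derive t 1 y dy ->
  is_derive t 1 (fun s => f (x s, y s))
    (d1 f (x t, y t) * dx + d2 f (x t, y t) * dy).
Proof.
move=> [cf [f1 f2 [cf1 _] [cf2 _]]] dxt dyt.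
have fd1 (c u : R) : is_derive u 1 (fun s => f (s, c)) (d1 f (u, c)).
  exact: (@is_derive_d1 f (u, c)).
have fd2 (c u : R) : is_derive u 1 (fun s => f (c, s)) (d2 f (c, u)).
  exact: (@is_derive_d2 f (c, u)).
have M1 h : exists c, `|c - x t| <= `|x (h + t) - x t| /\
    f (x (h + t), y (h + t)) - f (x t, y (h + t)) =
    d1 f (c, y (h + t)) * (x (h + t) - x t).
  have [c c1 c2] := mean_value (x t) (x (h + t)) (fd1 (y (h + t))).
  by exists c.
have M2 h : exists c, `|c - y t| <= `|y (h + t) - y t| /\
    f (x t, y (h + t)) - f (x t, y t) =
    d2 f (x t, c) * (y (h + t) - y t).
  have [c c1 c2] := mean_value (y t) (y (h + t)) (fd2 (x t)).
  by exists c.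
have [u Hu] := choice M1; have [v Hv] := choice M2.
have sh (g : R -> R) dg : is_derive t 1 g dg -> g (h + t) @[h --> (0 : R)^'] --> g t.
  move=> [gd _]; have cg : {for t, continuous g}.
    exact/differentiable_continuous/derivable1_diffP.
  apply: cvg_within_filter.
  apply: (@cvg_comp _ _ _ (fun h => h + t) g); last exact: cg.
  suff: (h + t) @[h --> (0 : R)] --> 0 + t by rewrite add0r.
  by apply: cvgD; [exact: cvg_id|exact: cvg_cst].
(* The intermediate points converge, being no further from the limit than the curve itself. *)
have sq (g w : R -> R) : (forall h, `|w h - g t| <= `|g (h + t) - g t|) ->
    g (h + t) @[h --> (0 : R)^'] --> g t -> w h @[h --> (0 : R)^'] --> g t.
  move=> wg /cvgrPdist_le gt; apply/cvgrPdist_le => e e0.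
  near=> h; rewrite distrC (le_trans (wg h))// distrC; near: h; exact: gt.
have quo (g : R -> R) dg : is_derive t 1 g dg ->
    h^-1 * (g (h + t) - g t) @[h --> (0 : R)^'] --> dg.
  move=> [gd <-]; have := gd; rewrite /derivable => /cvg_ex[l gl].
  have -> : 'D_1 g t = l by apply/cvg_lim.
  apply: cvg_trans gl; apply: near_eq_cvg; near=> h => /=.
  by rewrite /GRing.scale /= mulr1.
have key : h^-1 * (f (x (h + t), y (h + t)) - f (x t, y t))
    @[h --> (0 : R)^'] --> d1 f (x t, y t) * dx + d2 f (x t, y t) * dy.
  have -> : (fun h => h^-1 * (f (x (h + t), y (h + t)) - f (x t, y t))) =
    (fun h => d1 f (u h, y (h + t)) * (h^-1 * (x (h + t) - x t)) +
              d2 f (x t, v h) * (h^-1 * (y (h + t) - y t))).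
    apply/funext => h; have [_ e1] := Hu h; have [_ e2] := Hv h.
    rewrite -[f (x _, y _)](subrK (f (x t, y (h + t)))) e1 -addrA e2; ring.
  have l1 : d1 f (u h, y (h + t)) @[h --> (0 : R)^'] --> d1 f (x t, y t).
    apply: (cvg_pair_continuous (f := d1 f)); first exact: cf1.
      by apply: (sq x) => [h|]; [case: (Hu h)|exact: (sh _ _ dxt)].
    exact: (sh _ _ dyt).
  have l2 : d2 f (x t, v h) @[h --> (0 : R)^'] --> d2 f (x t, y t).
    apply: (cvg_pair_continuous (f := d2 f)); first exact: cf2.
      exact: cvg_cst.
    by apply: (sq y) => [h|]; [case: (Hv h)|exact: (sh _ _ dyt)].
  exact: (cvgD (cvgM l1 (quo _ _ dxt)) (cvgM l2 (quo _ _ dyt))).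
have key' : h^-1 *: ((fun s => f (x s, y s)) (h *: (1 : R) + t) -
    (fun s => f (x s, y s)) t) @[h --> (0 : R)^']
    --> d1 f (x t, y t) * dx + d2 f (x t, y t) * dy.
  apply: cvg_trans key; apply: near_eq_cvg; near=> h => /=.
  by rewrite /GRing.scale /= mulr1.
apply: DeriveDef; first by apply/cvg_ex; eexists; exact: key'.
exact/cvg_lim.
Unshelve. all: by end_near. Qed.

(* Both mixed derivatives are limits of the second difference quotient. *)
Lemma schwarz_symmetry f : Ck 2 f -> d1 (d2 f) = d2 (d1 f).
Proof.
move=> [_ [f1 f2 [_ [_ f12 _ [c12 _]]] [_ [f21 _ [c21 _] _]]]].
apply/funext => -[a b].
have fd1 (c u : R) : is_derive u 1 (fun s => f (s, c)) (d1 f (u, c)).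
  exact: (@is_derive_d1 f (u, c)).
have fd2 (c u : R) : is_derive u 1 (fun s => f (c, s)) (d2 f (c, u)).
  exact: (@is_derive_d2 f (c, u)).
have fd12 (c u : R) : is_derive u 1 (fun s => d1 f (c, s)) (d2 (d1 f) (c, u)).
  exact: (@is_derive_d2 (d1 f) (c, u)).
have fd21 (c u : R) : is_derive u 1 (fun s => d2 f (s, c)) (d1 (d2 f) (u, c)).
  exact: (@is_derive_d1 (d2 f) (u, c)).
have M h : exists q : (R * R) * (R * R),
   [/\ `|q.1.1 - a| <= `|h|, `|q.1.2 - b| <= `|h|,
       `|q.2.1 - a| <= `|h|, `|q.2.2 - b| <= `|h| &
       d1 (d2 f) q.1 * h * h = d2 (d1 f) q.2 * h * h].
  have e (x : R) : x + h - x = h by rewrite addrC addKr.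
  have [c] := mean_value (f := fun s => f (s, b + h) - f (s, b))
    a (a + h) (fun u => is_deriveB (fd1 (b + h) u) (fd1 b u)).
  rewrite e => ca E1.
  have [c'] := mean_value b (b + h) (fd12 c); rewrite e => c'b E1'.
  have [d] := mean_value (f := fun s => f (a + h, s) - f (a, s))
    b (b + h) (fun u => is_deriveB (fd2 (a + h) u) (fd2 a u)).
  rewrite e => db E2.
  have [d'] := mean_value a (a + h) (fd21 d); rewrite e => d'b E2'.
  exists ((d', d), (c, c')); split; [exact: d'b|exact: db|exact: ca|exact: c'b|].
  rewrite [LHS](_ : _ = (d2 f (a + h, d) - d2 f (a, d)) * h); last first.
    by rewrite E2'.
  rewrite [RHS](_ : _ = (d1 f (c, b + h) - d1 f (c, b)) * h); last first.
    by rewrite E1'.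
  by rewrite -E1 -E2; ring.
have [q Hq] := choice M.
have sq (w : R -> R) c : (forall h, `|w h - c| <= `|h|) ->
    w h @[h --> (0 : R)^'] --> c.
  move=> wc; apply/cvgrPdist_le => e e0; near=> h.
  rewrite distrC (le_trans (wc h))//; near: h.
  by apply: dnbhs0_le.
have l1 : d1 (d2 f) (q h).1 @[h --> (0 : R)^'] --> d1 (d2 f) (a, b).
  have -> : (fun h => d1 (d2 f) (q h).1) =
            (fun h => d1 (d2 f) ((q h).1.1, (q h).1.2)).
    by apply/funext => h; case: (q h).1.
  apply: (cvg_pair_continuous (f := d1 (d2 f))); first exact: c21.
    by apply: sq => h; have [] := Hq h.
  by apply: sq => h; have [] := Hq h.
have l2 : d2 (d1 f) (q h).2 @[h --> (0 : R)^'] --> d2 (d1 f) (a, b).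
  have -> : (fun h => d2 (d1 f) (q h).2) =
            (fun h => d2 (d1 f) ((q h).2.1, (q h).2.2)).
    by apply/funext => h; case: (q h).2.
  apply: (cvg_pair_continuous (f := d2 (d1 f))); first exact: c12.
    by apply: sq => h; have [] := Hq h.
  by apply: sq => h; have [] := Hq h.
have l3 : d1 (d2 f) (q h).1 @[h --> (0 : R)^'] --> d2 (d1 f) (a, b).
  apply: cvg_trans l2; apply: near_eq_cvg; near=> h.
  have h0 : h != 0 by near: h; exact: nbhs_dnbhs_neq.
  have [_ _ _ _ E] := Hq h.
  exact: (esym (mulIf h0 (mulIf h0 E))).
exact: (cvg_unique _ l1 l3).
Unshelve. all: by end_near. Qed.

End ChainRule.

(** * Functions that are polynomial near a corner *)

Section LocalPolynomials.
Context {R : realType} (delta : R).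
Hypothesis delta_gt0 : 0 < delta.
Implicit Types (h : R * R -> R) (P Q : {poly {poly R}}).

(** The region is a whole quadrant, hence a neighbourhood of the origin: the splines are prolonged
    beyond the square, and derivatives at the corner are two-sided. The outer variable of [P] is the
    first coordinate. *)
Definition locp h P := forall z, z.1 < delta -> z.2 < delta ->
  h z = P.[z.1%:P].[z.2].

Lemma deriv_horner_polyC P (x : R) :
  (map_poly deriv P).[x%:P] = (P.[x%:P])^`().
Proof.
rewrite (@horner_coef_wide _ (size P)) ?size_poly // horner_coef.
rewrite raddf_sum; apply: eq_bigr => i _ /=.
by rewrite coef_map -rmorphXn /= mulrC mul_polyC mulrC mul_polyC derivZ.
Qed.

Lemma swapXY_deriv P : P^`() = swapXY (map_poly deriv (swapXY P)).
Proof.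
apply/polyP => a; apply/polyP => b.
by rewrite coef_swapXY coef_map !coef_deriv coefMn coef_swapXY.
Qed.

Lemma is_derive_horner1 P (x y : R) :
  is_derive x 1 (fun t => P.[t%:P].[y]) (P^`().[x%:P].[y]).
Proof.
have -> : (fun t => P.[t%:P].[y]) = horner (swapXY P).[y%:P].
  by apply/funext => t; rewrite -[in RHS]horner2_swapXY swapXYK.
rewrite swapXY_deriv horner2_swapXY deriv_horner_polyC.
exact: is_derive_poly.
Qed.

Lemma is_derive_horner2 P (x y : R) :
  is_derive y 1 (fun t => P.[x%:P].[t]) ((map_poly deriv P).[x%:P].[y]).
Proof. by rewrite deriv_horner_polyC; exact: is_derive_poly. Qed.

Lemma near_lt (x : R) : x < delta -> \forall t \near x, t < delta.
Proof. by move=> xd; exact: lt_nbhsl. Qed.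

Lemma eq_d1 h h' : (forall z, z.1 < delta -> z.2 < delta -> h z = h' z) ->
  forall z, z.1 < delta -> z.2 < delta -> d1 h z = d1 h' z.
Proof.
move=> E z z1 z2; rewrite /d1 !derive1E; apply: near_eq_derive.
by near=> t; apply: E => //; near: t; exact: near_lt.
Unshelve. all: by end_near. Qed.

Lemma eq_d2 h h' : (forall z, z.1 < delta -> z.2 < delta -> h z = h' z) ->
  forall z, z.1 < delta -> z.2 < delta -> d2 h z = d2 h' z.
Proof.
move=> E z z1 z2; rewrite /d2 !derive1E; apply: near_eq_derive.
by near=> t; apply: E => //; near: t; exact: near_lt.
Unshelve. all: by end_near. Qed.

Lemma locp_d1 h P : locp h P -> locp (d1 h) P^`().
Proof.
move=> hP z z1 z2.
rewrite (@eq_d1 _ (fun z => P.[z.1%:P].[z.2])) // /d1 derive1E /=.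
by have [_ ->] := is_derive_horner1 P z.1 z.2.
Qed.

Lemma locp_d2 h P : locp h P -> locp (d2 h) (map_poly deriv P).
Proof.
move=> hP z z1 z2.
rewrite (@eq_d2 _ (fun z => P.[z.1%:P].[z.2])) // /d2 derive1E /=.
by have [_ ->] := is_derive_horner2 P z.1 z.2.
Qed.

Lemma locp_dmix h P m1 m2 : locp h P ->
  locp (dmix m1 m2 h) (derivn m1 (iter m2 (map_poly deriv) P)).
Proof.
move=> hP; have : locp (iter m2 d2 h) (iter m2 (map_poly deriv) P).
  by elim: m2 => //= m; exact: locp_d2.
rewrite /dmix => hP2.
by elim: m1 => [//|m IH]; exact: (locp_d1 IH).
Qed.

Lemma coef_iter_map_deriv m P a :
  (iter m (map_poly deriv) P)`_a = derivn m P`_a.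
Proof. by elim: m => [//|m IH]; rewrite iterS coef_map IH. Qed.

Lemma dmix_locp h P m1 m2 : locp h P ->
  dmix m1 m2 h (0, 0) = P`_m1`_m2 * (m1`! * m2`!)%:R.
Proof.
move=> hP; rewrite (locp_dmix m1 m2 hP) //= !horner_coef0.
rewrite coef_derivn addn0 ffactnn coefMn coef_iter_map_deriv coef_derivn addn0.
by rewrite ffactnn -mulrnA mulr_natr mulnC.
Qed.

(** The roots are sampled at [delta / (k + 2)]. The injection [g] lets one statement cover
    univariate polynomials, possibly on a shifted interval, and bivariate ones, whose roots are
    constants [x%:P]. *)
Lemma poly_eq0_itv (A : idomainType) (q : {poly A}) (g : R -> A) :
  injective g -> (forall x, 0 < x < delta -> root q (g x)) -> q = 0.
Proof.
move=> ig qr; pose x (k : nat) := delta / k.+2%:R.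
apply: (@roots_geq_poly_eq0 _ q [seq g (x k) | k <- iota 0 (size q)]).
- apply/allP => _ /mapP[k _ ->]; apply: qr.
  rewrite /x divr_gt0 ?ltr0n//= ltr_pdivrMr ?ltr0n//.
  by rewrite -[X in X < _]mulr1 ltr_pM2l// ltr1n.
- rewrite map_inj_uniq ?iota_uniq// => k l /ig.
  rewrite /x => /(mulfI (lt0r_neq0 delta_gt0)) /invr_inj /eqP.
  by rewrite eqr_nat => /eqP[].
- by rewrite size_map size_iota.
Qed.

Lemma locp_eq0 h P : locp h P ->
  (forall z, 0 < z.1 < delta -> 0 < z.2 < delta -> h z = 0) -> P = 0.
Proof.
move=> hP h0; apply: (@poly_eq0_itv _ P polyC) => [|x x0]; first exact: polyC_inj.
apply/eqP; apply: (@poly_eq0_itv _ _ id) => // y y0.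
case/andP: (x0) (y0) => _ x1 /andP[_ y1].
by rewrite /root -(hP (x, y)) //= h0.
Qed.

Lemma locpD h h' P Q : locp h P -> locp h' Q ->
  locp (fun z => h z + h' z) (P + Q).
Proof. by move=> hP hQ z z1 z2; rewrite hP // hQ // !hornerE. Qed.

Lemma locpZ h P (c : R) : locp h P -> locp (fun z => c * h z) (c%:P%:P * P).
Proof. by move=> hP z z1 z2; rewrite hP // !hornerE. Qed.

End LocalPolynomials.

(** * The chain rule up to order two *)

Section CompositionJet.
Context {R : realType} (delta : R).
Hypothesis delta_gt0 : 0 < delta.
Implicit Types (f : R * R -> R) (F : R * R -> R * R) (X Y J : nat -> nat -> R).

(* The chain rule up to order 2: X and Y are the derivatives of the two
   components of the inner function, J those of the outer one. *)
Definition comp_jet X Y J (m1 m2 : nat) : R :=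
  match m1, m2 with
  | 0%N, 0%N => J 0%N 0%N
  | 1%N, 0%N => J 1%N 0%N * X 1%N 0%N + J 0%N 1%N * Y 1%N 0%N
  | 0%N, 1%N => J 1%N 0%N * X 0%N 1%N + J 0%N 1%N * Y 0%N 1%N
  | 2%N, 0%N => J 2%N 0%N * X 1%N 0%N ^+ 2 + 2 * J 1%N 1%N * X 1%N 0%N * Y 1%N 0%N
            + J 0%N 2%N * Y 1%N 0%N ^+ 2 + J 1%N 0%N * X 2%N 0%N + J 0%N 1%N * Y 2%N 0%N
  | 0%N, 2%N => J 2%N 0%N * X 0%N 1%N ^+ 2 + 2 * J 1%N 1%N * X 0%N 1%N * Y 0%N 1%N
            + J 0%N 2%N * Y 0%N 1%N ^+ 2 + J 1%N 0%N * X 0%N 2%N + J 0%N 1%N * Y 0%N 2%N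
  | 1%N, 1%N => J 2%N 0%N * X 1%N 0%N * X 0%N 1%N
            + J 1%N 1%N * (X 1%N 0%N * Y 0%N 1%N + X 0%N 1%N * Y 1%N 0%N)
            + J 0%N 2%N * Y 1%N 0%N * Y 0%N 1%N + J 1%N 0%N * X 1%N 1%N + J 0%N 1%N * Y 1%N 1%N
  | _, _ => 0
  end.

Lemma comp_jet_lin (K : finType) (c : K -> R) (J : K -> nat -> nat -> R) J0
    X Y m1 m2 :
  (forall a b, (a + b <= 2)%N -> J0 a b = \sum_k c k * J k a b) ->
  comp_jet X Y J0 m1 m2 = \sum_k c k * comp_jet X Y (J k) m1 m2.
Proof.
move=> E; have Z : 0 = \sum_k c k * 0 :> R.
  by rewrite big1 // => k _; rewrite mulr0.
case: m1 m2 => [|[|[|m1]]] [|[|[|m2]]] //=; rewrite !E // ?mulr_sumr;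
  rewrite !mulr_suml ?mulr_sumr -?big_split; apply: eq_bigr => k _ /=; ring.
Qed.

Variables (F : R * R -> R * R) (P Q : {poly {poly R}}).
Hypotheses (FP : locp delta (fst \o F) P) (FQ : locp delta (snd \o F) Q).

Lemma is_derive_comp1 f z : Ck 1 f -> z.1 < delta -> z.2 < delta ->
  is_derive z.1 1 (fun t => f (F (t, z.2)))
   (d1 f (F z) * P^`().[z.1%:P].[z.2] + d2 f (F z) * Q^`().[z.1%:P].[z.2]).
Proof.
move=> cf z1 z2.
have H := is_derive_chain cf (is_derive_horner1 P z.1 z.2)
  (is_derive_horner1 Q z.1 z.2).
have E t : t < delta -> f (F (t, z.2)) = f (P.[t%:P].[z.2], Q.[t%:P].[z.2]).
  move=> t1; have := FP (z := (t, z.2)) t1 z2; have := FQ (z := (t, z.2)) t1 z2.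
  by rewrite /=; case: (F _) => a b /= -> ->.
have -> : F z = (P.[z.1%:P].[z.2], Q.[z.1%:P].[z.2]).
  by rewrite -FP // -FQ // /=; case: (F z).
apply: near_eq_is_derive H; near=> t; apply/esym/E; near: t; exact: lt_nbhsl.
Unshelve. all: by end_near. Qed.

Lemma is_derive_comp2 f z : Ck 1 f -> z.1 < delta -> z.2 < delta ->
  is_derive z.2 1 (fun t => f (F (z.1, t)))
   (d1 f (F z) * (map_poly deriv P).[z.1%:P].[z.2]
    + d2 f (F z) * (map_poly deriv Q).[z.1%:P].[z.2]).
Proof.
move=> cf z1 z2.
have H := is_derive_chain cf (is_derive_horner2 P z.1 z.2)
  (is_derive_horner2 Q z.1 z.2).
have E t : t < delta -> f (F (z.1, t)) = f (P.[z.1%:P].[t], Q.[z.1%:P].[t]).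
  move=> t1; have := FP (z := (z.1, t)) z1 t1; have := FQ (z := (z.1, t)) z1 t1.
  by rewrite /=; case: (F _) => a b /= -> ->.
have -> : F z = (P.[z.1%:P].[z.2], Q.[z.1%:P].[z.2]).
  by rewrite -FP // -FQ // /=; case: (F z).
apply: near_eq_is_derive H; near=> t; apply/esym/E; near: t; exact: lt_nbhsl.
Unshelve. all: by end_near. Qed.

Lemma d1_comp f z : Ck 1 f -> z.1 < delta -> z.2 < delta ->
  d1 (f \o F) z =
   d1 f (F z) * P^`().[z.1%:P].[z.2] + d2 f (F z) * Q^`().[z.1%:P].[z.2].
Proof.
by move=> cf z1 z2; rewrite /d1 derive1E; case: (is_derive_comp1 cf z1 z2).
Qed.

Lemma d2_comp f z : Ck 1 f -> z.1 < delta -> z.2 < delta ->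
  d2 (f \o F) z =
   d1 f (F z) * (map_poly deriv P).[z.1%:P].[z.2]
   + d2 f (F z) * (map_poly deriv Q).[z.1%:P].[z.2].
Proof.
by move=> cf z1 z2; rewrite /d2 derive1E; case: (is_derive_comp2 cf z1 z2).
Qed.

(** The first derivatives of a composition have exactly this shape, so that this yields the second
    ones. *)
Lemma d1_compM f g (U V : {poly {poly R}}) z : Ck 1 f -> Ck 1 g ->
  z.1 < delta -> z.2 < delta ->
  d1 (fun z => f (F z) * U.[z.1%:P].[z.2] + g (F z) * V.[z.1%:P].[z.2]) z =
  d1 (f \o F) z * U.[z.1%:P].[z.2] + f (F z) * U^`().[z.1%:P].[z.2]
  + (d1 (g \o F) z * V.[z.1%:P].[z.2] + g (F z) * V^`().[z.1%:P].[z.2]).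
Proof.
move=> cf cg z1 z2; rewrite !d1_comp // [LHS]/d1 derive1E.
have H := is_deriveD
  (is_deriveM (is_derive_comp1 cf z1 z2) (is_derive_horner1 U z.1 z.2))
  (is_deriveM (is_derive_comp1 cg z1 z2) (is_derive_horner1 V z.1 z.2)).
case: H => _ /= ->; rewrite /GRing.scale /= -!surjective_pairing; ring.
Qed.

Lemma d2_compM f g (U V : {poly {poly R}}) z : Ck 1 f -> Ck 1 g ->
  z.1 < delta -> z.2 < delta ->
  d2 (fun z => f (F z) * U.[z.1%:P].[z.2] + g (F z) * V.[z.1%:P].[z.2]) z =
  d2 (f \o F) z * U.[z.1%:P].[z.2]
  + f (F z) * (map_poly deriv U).[z.1%:P].[z.2]
  + (d2 (g \o F) z * V.[z.1%:P].[z.2]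
     + g (F z) * (map_poly deriv V).[z.1%:P].[z.2]).
Proof.
move=> cf cg z1 z2; rewrite !d2_comp // [LHS]/d2 derive1E.
have H := is_deriveD
  (is_deriveM (is_derive_comp2 cf z1 z2) (is_derive_horner2 U z.1 z.2))
  (is_deriveM (is_derive_comp2 cg z1 z2) (is_derive_horner2 V z.1 z.2)).
case: H => _ /= ->; rewrite /GRing.scale /= -!surjective_pairing; ring.
Qed.

Lemma smooth_d1 f : smooth f -> smooth (d1 f).
Proof. by move=> sf k; have [_ []] := sf k.+1. Qed.

Lemma smooth_d2 f : smooth f -> smooth (d2 f).
Proof. by move=> sf k; have [_ []] := sf k.+1. Qed.

#[local] Opaque d1 d2.

Lemma dmix_comp f m1 m2 : smooth f -> (m1 + m2 <= 2)%N ->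
  dmix m1 m2 (f \o F) (0, 0) =
  comp_jet (fun a b => dmix a b (fst \o F) (0, 0))
    (fun a b => dmix a b (snd \o F) (0, 0))
    (fun a b => dmix a b f (F (0, 0))) m1 m2.
Proof.
move=> sf.
have alg2 (a b d e g x y u v : R) : (a * x + b * y) * x + e * u +
    ((b * x + d * y) * y + g * v) =
    a * x ^+ 2 + 2 * b * x * y + d * y ^+ 2 + e * u + g * v by ring.
have alg11 (a b d e g x1 y1 x2 y2 u v : R) : (a * x1 + b * y1) * x2 + e * u +
    ((b * x1 + d * y1) * y2 + g * v) =
    a * x1 * x2 + b * (x1 * y2 + x2 * y1) + d * y1 * y2 + e * u + g * v by ring.
have c1 := sf 1%N; have c11 := smooth_d1 sf 1%N; have c12 := smooth_d2 sf 1%N.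
have S : d2 (d1 f) = d1 (d2 f) by rewrite schwarz_symmetry //; exact: (sf 2%N).
have dP1 := locp_d1 FP; have dQ1 := locp_d1 FQ.
have dP2 := locp_d2 FP; have dQ2 := locp_d2 FQ.
(* The first-order formulas hold on the whole quadrant, so they may be differentiated once more. *)
have E1 := eq_d1 (fun z z1 z2 => d1_comp c1 z1 z2).
have E2 := eq_d2 (fun z z1 z2 => d2_comp c1 z1 z2).
have E12 := eq_d1 (fun z z1 z2 => d2_comp c1 z1 z2).
pose o : R * R := (0, 0).
have o1 : o.1 < delta by []. have o2 : o.2 < delta by [].
have p1 := dP1 o o1 o2; have q1 := dQ1 o o1 o2.
have p2 := dP2 o o1 o2; have q2 := dQ2 o o1 o2.
have p11 := locp_d1 dP1 o1 o2; have q11 := locp_d1 dQ1 o1 o2.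
have p12 := locp_d1 dP2 o1 o2; have q12 := locp_d1 dQ2 o1 o2.
have p22 := locp_d2 dP2 o1 o2; have q22 := locp_d2 dQ2 o1 o2.
case: m1 => [|[|[|m1]]]; [case: m2 => [|[|[|m2]]] | case: m2 => [|[|m2]]
  | case: m2 => [|m2] |].
- by move=> _; reflexivity.
- by move=> _; rewrite /dmix /= -/o d2_comp; [rewrite p2 q2|..].
- move=> _; change (d2 (d2 (f \o F)) o =
    comp_jet (fun a b => dmix a b (fst \o F) o)
      (fun a b => dmix a b (snd \o F) o) (fun a b => dmix a b f (F o)) 0 2).
  rewrite E2; [|exact: o1|exact: o2].
  rewrite (d2_compM (map_poly deriv P) (map_poly deriv Q) c11 c12 o1 o2).
  rewrite (d2_comp c11 o1 o2) (d2_comp c12 o1 o2) S /comp_jet /dmix /iter.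
  rewrite p2 q2 p22 q22; exact: alg2.
- by rewrite add0n.
- by move=> _; rewrite /dmix /= -/o d1_comp; [rewrite p1 q1|..].
- move=> _; change (d1 (d2 (f \o F)) o =
    comp_jet (fun a b => dmix a b (fst \o F) o)
      (fun a b => dmix a b (snd \o F) o) (fun a b => dmix a b f (F o)) 1 1).
  rewrite E12; [|exact: o1|exact: o2].
  rewrite (d1_compM (map_poly deriv P) (map_poly deriv Q) c11 c12 o1 o2).
  rewrite (d1_comp c11 o1 o2) (d1_comp c12 o1 o2) S /comp_jet /dmix /iter.
  rewrite p1 q1 p2 q2 p12 q12; exact: alg11.
- by rewrite add1n.
- move=> _; change (d1 (d1 (f \o F)) o =
    comp_jet (fun a b => dmix a b (fst \o F) o)
      (fun a b => dmix a b (snd \o F) o) (fun a b => dmix a b f (F o)) 2 0).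
  rewrite E1; [|exact: o1|exact: o2].
  rewrite (d1_compM P^`() Q^`() c11 c12 o1 o2).
  rewrite (d1_comp c11 o1 o2) (d1_comp c12 o1 o2) S /comp_jet /dmix /iter.
  rewrite p1 q1 p11 q11; exact: alg2.
- by rewrite add2n.
- by rewrite addSn.
Qed.

End CompositionJet.

(** * B-splines *)

Section PolynomialPieces.
Context {R : realType} (t : nat -> R).
Hypotheses (t_homo : forall i j, (i <= j)%N -> t i <= t j)
  (t_ge0 : forall i, 0 <= t i) (t_le1 : forall i, t i <= 1).

(** The test in the degree 0 case of [bspline]: an element that starts at 0 or ends at 1 is
    unbounded on that side, because splines are prolonged. *)
Definition on_knots (k : nat) (x : R) : bool :=
  [&& t k < t k.+1, (t k == 0) || (t k <= x) & (t k.+1 == 1) || (x < t k.+1)].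

(* The polynomial that the B-spline of degree d and index i is on [t_k, t_k+1]. *)
Fixpoint bpoly (k d i : nat) : {poly R} :=
  if d is d'.+1 then
    (t (i + d)%N - t i)^-1 *: (('X - (t i)%:P) * bpoly k d' i)
    + (t (i + d).+1 - t i.+1)^-1
        *: (((t (i + d).+1)%:P - 'X) * bpoly k d' i.+1)
  else ((i == k)%:R)%:P.

Lemma bspline0_on_knots k i x : on_knots k x ->
  bspline t 0 i x = (i == k)%:R.
Proof.
case/and3P => tk k0 k1 /=; have [->|ik] := eqVneq i k; first by rewrite tk k0 k1.
case: ltP => //= ti; case: (ltngtP i k) ik => // [ik|ki] _.
  have ik' : t i.+1 <= t k by exact: t_homo.
  have -> : (t i.+1 == 1) = false.
    by apply/lt_eqF/(le_lt_trans ik')/(lt_le_trans tk).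
  case: (ltP x) => //= [xi|]; last by rewrite andbF.
  case/orP: k0 => [/eqP k0|]; last by move=> /(lt_le_trans (lt_le_trans xi ik')); rewrite ltxx.
  by have := t_ge0 i; rewrite leNgt (lt_le_trans ti)// -k0.
have ki' : t k.+1 <= t i by exact: t_homo.
have -> : (t i == 0) = false.
  by apply/gt_eqF/(lt_le_trans _ ki')/(le_lt_trans _ tk).
case/orP: k1 => [/eqP k1|xk].
  by have := t_le1 i.+1; rewrite leNgt -k1 (le_lt_trans ki').
by rewrite [t i <= x]leNgt (lt_le_trans xk ki').
Qed.

Lemma bspline_bpoly k d i x : on_knots k x ->
  bspline t d i x = (bpoly k d i).[x].
Proof.
move=> kx; elim: d i => [|d IH] i; first by rewrite (bspline0_on_knots i kx) hornerC.
rewrite /= !IH !(hornerD, hornerZ, hornerM, hornerN, hornerX, hornerC); ring.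
Qed.

Lemma bpoly_eq0 k d i : ~~ (i <= k <= i + d)%N -> bpoly k d i = 0.
Proof.
elim: d i => [|d IH] i /= H; first by case: eqP H => // ->; rewrite addn0 leqnn.
by rewrite !IH ?mulr0 ?scaler0 ?addr0 //; lia.
Qed.

(** Induction on the degree. In the Cox-de Boor recursion each function of degree [d] occurs twice.
    Once one occurrence is shifted, its total factor is, with [a = t_i] and [b = t_(i+d+1)], a
    product common to both occurrences times [((y - b)(X - a) + (y - a)(b - X)) / (b - a) = y -
    X]. *)
Lemma marsden k d (y : R) : (d <= k)%N -> t k < t k.+1 ->
  \sum_(i < k.+1) (\prod_(m < d) (y - t (i + m).+1)) *: bpoly k d i
  = (y%:P - 'X) ^+ d.
Proof.
move=> + tk; elim: d => [|d IH] dk.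
  rewrite (bigD1 ord_max) //= big_ord0 eqxx scale1r big1 ?addr0 // => i /negPf ik.
  by rewrite -val_eqE /= in ik; rewrite ik scaler0.
rewrite exprS -IH ?(ltnW dk) // mulr_sumr.
pose w i := (t (i + d.+1)%N - t i)^-1.
pose psi (e i : nat) := \prod_(m < e) (y - t (i + m).+1).
(* The second half of the recursion for the index [i.-1]. It vanishes at both ends of the summation
   range, so the shift loses nothing. *)
pose G i := (psi d.+1 i.-1 * w i) *: (((t (i + d.+1)%N)%:P - 'X) * bpoly k d i).
have G0 : G 0%N = 0 by rewrite /G bpoly_eq0 ?mulr0 ?scaler0 //; lia.
have Gk : G k.+1 = 0 by rewrite /G bpoly_eq0 ?mulr0 ?scaler0 //; lia.
have shift : \sum_(i < k.+1) G i.+1 = \sum_(i < k.+1) G i.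
  transitivity (\sum_(i < k.+2) G i); last by rewrite big_ord_recr /= Gk addr0.
  by rewrite [RHS]big_ord_recl G0 add0r.
transitivity (\sum_(i < k.+1) ((psi d.+1 i * w i) *:
    (('X - (t i)%:P) * bpoly k d i) + G i)).
  rewrite big_split -shift -big_split; apply: eq_bigr => i _ /=.
  by rewrite /G /= scalerDr !scalerA -[psi d.+1 i]/(\prod_(_ < _) _) addSn.
apply: eq_bigr => i _.
(* A zero denominator only occurs where the function itself vanishes on the element. *)
have [bi|bi] := eqVneq (bpoly k d i) 0; first by rewrite /G bi !(mulr0, scaler0, addr0).
have /andP[ik kd] : (i <= k <= i + d)%N.
  by apply: contraNT bi => /bpoly_eq0 ->.
have ti : t i < t (i + d.+1)%N.
  by rewrite (le_lt_trans (t_homo ik))// (lt_le_trans tk)// t_homo //; lia.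
have e1 : psi d.+1 i = psi d i * (y - t (i + d.+1)%N).
  by rewrite /psi big_ord_recr /= addnS.
have e2 : psi d.+1 i.-1 = (y - t i) * psi d i.
  have i0 : (0 < i)%N by lia.
  rewrite /psi big_ord_recl /= addn0 prednK //; congr (_ * _).
  by apply: eq_bigr => m _; rewrite /bump /= add1n addnS -addSn prednK.
rewrite /G e1 e2 -!mul_polyC !mulrA -mulrDl.
rewrite -/(psi d i); congr (_ * _).
have wE : (w i)%:P * ((t (i + d.+1)%N)%:P - (t i)%:P) = 1 :> {poly R}.
  by rewrite -polyCB -polyCM mulVf // subr_eq0 gt_eqF.
rewrite !polyCM !polyCB.
transitivity ((psi d i)%:P * (y%:P - 'X) *
  ((w i)%:P * ((t (i + d.+1)%N)%:P - (t i)%:P))); last first.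
  by rewrite wE mulr1 mulrC.
move: (psi d i)%:P (w i)%:P (t i)%:P (t (i + d.+1)%N)%:P y%:P => a b c e f; ring.
Qed.

Lemma coef_expC_subX d m (y : R) :
  ((y%:P - 'X) ^+ d)`_m = y ^+ (d - m) * ((-1) ^+ m *+ 'C(d, m)).
Proof.
rewrite exprBn coef_sum.
have T (i : 'I_d.+1) : ((-1) ^+ i * y%:P ^+ (d - i) * 'X^i *+ 'C(d, i))`_m =
    (m == i)%:R * (y ^+ (d - i) * ((-1) ^+ i *+ 'C(d, i))).
  rewrite coefMn -[-1]/(- 1%:P) -polyCN -!rmorphXn /= -polyCM coefCM coefXn.
  by rewrite -mulrnAr; ring.
under eq_bigr do rewrite T.
have [md|dm] := leqP m d.
  rewrite (bigD1 (Ordinal (md : (m < d.+1)%N))) //= eqxx mul1r big1 ?addr0 //.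
  by move=> i /negPf; rewrite -val_eqE eq_sym /= => ->; rewrite mul0r.
rewrite bin_small // mulr0n mulr0 big1 // => i _.
by rewrite gtn_eqF ?mul0r // (leq_trans _ dm).
Qed.

(** The coefficient matrix of the [d + 1] functions alive on the element is invertible: a linear
    form that kills all of them kills [(y - X)^d] for every [y], by Marsden's identity, and the
    coefficients in [y] of that value are the entries of the form times signed binomials. *)
Lemma bpoly_indep k d (u : nat -> R) : (d <= k)%N -> t k < t k.+1 ->
  \sum_(i < k.+1) u i *: bpoly k d i = 0 ->
  forall i, (i <= k)%N -> (k <= i + d)%N -> u i = 0.
Proof.
move=> dk tk E.
pose C : 'M[R]_d.+1 := \matrix_(s, m) (bpoly k d (k - d + s)%N)`_m.
have win (F : nat -> {poly R}) :
    \sum_(i < k.+1) F i *  bpoly k d i =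
    \sum_(s < d.+1) F (k - d + s)%N * bpoly k d (k - d + s)%N.
  have -> : k.+1 = (k - d + d.+1)%N by lia.
  rewrite big_split_ord /= big1 ?add0r // => i _.
  by rewrite bpoly_eq0 ?mulr0 //; have := ltn_ord i; lia.
have C_inj (v : 'rV[R]_d.+1) : v *m C^T = 0 -> v = 0.
  move=> vC.
  have vy (y : R) : \sum_(m < d.+1) ((y%:P - 'X) ^+ d)`_m * v 0 m = 0.
    have Y : \sum_(i < k.+1) (\prod_(m < d) (y - t (i + m).+1))%:P * bpoly k d i
        = (y%:P - 'X) ^+ d.
      by rewrite -(marsden y dk tk); apply: eq_bigr => i _; rewrite mul_polyC.
    rewrite (win (fun i => (\prod_(m < d) (y - t (i + m).+1))%:P)) in Y.
    rewrite -Y.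
    under eq_bigr => m _ do rewrite coef_sum mulr_suml.
    rewrite exchange_big /= big1 // => s _.
    have /matrixP/(_ 0 s) := vC; rewrite !mxE => vs.
    transitivity ((\prod_(m < d) (y - t (k - d + s + m).+1)) *
      \sum_j v 0 j * C^T j s); last by rewrite vs mulr0.
    rewrite mulr_sumr.
    by apply: eq_bigr => m _; rewrite !mxE coefCM; ring.
  (* The value of the linear form [v] at [(y - X)^d], as a polynomial in [y]. *)
  pose q : {poly R} := \poly_(l < d.+1) (v 0 (inord (d - l)) *
    ((-1) ^+ (d - l) *+ 'C(d, d - l))).
  have q0 : q = 0.
    apply: (@poly_eq0_itv R 1 _ _ q id) => // y _; apply/eqP.
    rewrite -[RHS](vy y) horner_poly [RHS](reindex_inj rev_ord_inj) /=.
    apply: eq_bigr => l _; rewrite subSS.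
    have -> : rev_ord l = inord (d - l) by apply/val_inj; rewrite /= inordK ?subSS //; lia.
    rewrite coef_expC_subX ?subSS subKn; last by rewrite -ltnS.
    by ring.
  apply/rowP => m; rewrite mxE.
  have : q`_(d - m) = 0 by rewrite q0 coef0.
  rewrite coef_poly ifT; last lia.
  rewrite subKn; last by rewrite -ltnS.
  rewrite inord_val => /eqP; rewrite mulf_eq0 => /orP[/eqP//|].
  by rewrite mulrn_eq0 signr_eq0 orbF -leqn0 leqNgt bin_gt0 -ltnS ltn_ord.
have detC : \det C != 0.
  rewrite -det_tr; apply/negP => /det0P[v v0 /C_inj]; exact/eqP.
move=> i ik ki.
pose x : 'rV[R]_d.+1 := \row_s u (k - d + s)%N.
have xC : x *m C = 0.
  have E' : \sum_(i < k.+1) (u i)%:P * bpoly k d i = 0.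
    by rewrite -[RHS]E; apply: eq_bigr => l _; rewrite mul_polyC.
  apply/rowP => m; rewrite !mxE.
  transitivity ((\sum_(i < k.+1) (u i)%:P * bpoly k d i)`_m); last first.
    by rewrite E' coef0.
  rewrite (win (fun i => (u i)%:P)) coef_sum; apply: eq_bigr => s _.
  by rewrite !mxE coefCM.
have x0 : x = 0.
  have Cu : C \in unitmx by rewrite unitmxE unitfE.
  by rewrite -[x](mulmxK Cu) xC mul0mx.
have := congr1 (fun y : 'rV_d.+1 => y 0 (inord (i - (k - d)))) x0.
rewrite !mxE inordK; last lia.
by rewrite (_ : (k - d + _ = i)%N) //; lia.
Qed.

End PolynomialPieces.

(** * B-splines at the ends of the interval *)

Section EndBehaviour.
Context {R : realType} (t : nat -> R) (p : nat).
Hypotheses (t_homo : forall i j, (i <= j)%N -> t i <= t j)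
  (t_first : forall i, (i <= p)%N -> t i = 0) (t_pos : 0 < t p.+1).

(** One half of the recursion gains a factor [X], since [t_i = 0]; the other half involves a
    function that already vanishes to the higher order. For [d = p] the exponent is [i]. *)
Lemma bpoly_dvd_left d i : 'X^(i + d - p) %| bpoly t p d i.
Proof.
elim: d i => [|d IH] i /=.
  by have [->|ip] := eqVneq i p; [rewrite addn0 subnn expr0 dvd1p|rewrite dvdp0].
rewrite dvdp_add // -mul_polyC dvdp_mull //; last first.
  by rewrite dvdp_mull // addnS -addSn.
have [ip|pi] := leqP i p; last by rewrite bpoly_eq0 ?mulr0 ?dvdp0 //; lia.
rewrite (t_first ip) polyC0 subr0 (dvdp_trans _ (dvdp_mul (dvdpp 'X) (IH i))) //.
by rewrite -exprS dvdp_exp2l //; lia.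
Qed.

Lemma coef_dvdXn m (q : {poly R}) l : 'X^m %| q -> (l < m)%N -> q`_l = 0.
Proof. by move=> /dvdpP[s ->] lm; rewrite coefMXn lm. Qed.

(** Both contributions of the recursion to the lowest coefficient are nonnegative and one is
    positive, so nothing cancels. Nonzero lowest coefficients are what makes the Hermite problems at
    a corner triangular. *)
Lemma lead_bpoly_left d i : (i <= p)%N -> (p <= i + d)%N ->
  0 < (bpoly t p d i)`_(i + d - p).
Proof.
have tpos l : (p < l)%N -> 0 < t l by move=> pl; exact: lt_le_trans t_pos (t_homo pl).
elim: d i => [|d IH] i ip pid /=.
  have -> : i = p by lia.
  by rewrite eqxx addn0 subnn coefC.
move eE : (i + d.+1 - p)%N => e.
have c2 : (((t (i + d.+1).+1)%:P - 'X) * bpoly t p d i.+1)`_e =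
    t (i + d.+1).+1 * (bpoly t p d i.+1)`_e.
  rewrite mulrBl coefB coefCM coefXM; case: eqP => [_|e0]; first by rewrite subr0.
  by rewrite (coef_dvdXn (l := e.-1) (bpoly_dvd_left d i.+1)) ?subr0 //; lia.
have w2 : 0 <= (t (i + d.+1).+1 - t i.+1)^-1 * (t (i + d.+1).+1 * (bpoly t p d i.+1)`_e).
  rewrite mulr_ge0 ?invr_ge0 ?subr_ge0 ?t_homo ?mulr_ge0 // ?(ltW (tpos _ _)) //; try lia.
  have [ip1|pi1] := leqP i.+1 p; last by rewrite bpoly_eq0 ?coef0 //; lia.
  by rewrite -eE addnS -addSn ltW // IH //; lia.
rewrite coefD !coefZ c2 (t_first ip) polyC0 !subr0 coefXM.
case: eqP => [e0|e0].
  rewrite mulr0 add0r; apply: mulr_gt0.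
    by rewrite invr_gt0 subr_gt0 (t_first (i := i.+1)) ?tpos //; lia.
  apply: mulr_gt0; first by apply: tpos; lia.
  by rewrite -eE addnS -addSn IH; lia.
rewrite ltr_wpDr //; apply: mulr_gt0; first by rewrite invr_gt0 tpos //; lia.
by rewrite (_ : e.-1 = i + d - p)%N ?IH //; lia.
Qed.

(** One half of the recursion vanishes at every degree, which leaves a power of a linear function.
    Together with the slope of the second function this gives the values and derivatives of [c0] and
    [c1] at 0. *)
Lemma bpoly_first d : (d <= p)%N ->
  bpoly t p d (p - d) = (1 - (t p.+1)^-1 *: 'X) ^+ d.
Proof.
elim: d => [|d IH] dp; first by rewrite subn0 expr0 /= eqxx.
have E : (p - d.+1).+1 = (p - d)%N by lia.
rewrite /= bpoly_eq0 ?mulr0 ?scaler0 ?add0r; last lia.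
rewrite E IH ?(ltnW dp) // exprS -mul_polyC mulrA; congr (_ * _).
rewrite (t_first (i := p - d)) ?leq_subr // subr0.
rewrite (_ : (_ + _).+1 = p.+1); last lia.
rewrite mulrBr -polyCM mulVf ?gt_eqF //.
by rewrite -mul_polyC.
Qed.

Lemma coef1_bpoly_second d : (d <= p)%N ->
  (bpoly t p d (p - d).+1)`_1 = d%:R / t p.+1.
Proof.
elim: d => [|d IH] dp; first by rewrite /= subn0 mul0r gtn_eqF // coefC.
have E : (p - d.+1).+1 = (p - d)%N by lia.
have T1 : 0 < t p.+2 by exact: lt_le_trans t_pos (t_homo _).
rewrite E /= coefD !coefZ (t_first (leq_subr d p)) polyC0 !subr0 coefXM /=.
rewrite (_ : (p - d + d.+1)%N = p.+1); last lia.
have b0 : (bpoly t p d (p - d))`_0 = 1.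
  rewrite bpoly_first ?(ltnW dp) // -horner_coef0 horner_exp hornerD hornerN.
  by rewrite hornerZ hornerX hornerC mulr0 subr0 expr1n.
rewrite b0 mulr1.
rewrite mulrBl coefB coefCM coefXM /= -[(bpoly _ _ _ _)`_0]horner_coef0.
have [d0|d0] := posnP d.
  by rewrite d0 /= subn0 gtn_eqF // hornerC coefC /= !(mulr0, subr0, addr0) div1r.
have -> : (bpoly t p d (p - d).+1).[0] = 0.
  rewrite horner_coef0 (coef_dvdXn (bpoly_dvd_left d _)) //; lia.
rewrite (t_first (i := (p - d).+1)) ?subr0; last lia.
rewrite IH ?(ltnW dp) // mulrA mulVf ?gt_eqF // mul1r -nat1r.
by rewrite mulrDl mul1r.
Qed.

End EndBehaviour.

(** Here [K] is the last element. Compared with the left end the two halves of the recursion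
    exchange their roles: the factor [1 - X] comes from the second one. *)
Lemma bpoly_dvd_right (R : realType) (t : nat -> R) K d i :
  (forall i, (K < i)%N -> t i = 1) ->
  (1 - 'X) ^+ (K - i) %| bpoly t K d i.
Proof.
move=> t1; elim: d i => [|d IH] i /=.
  by have [->|_] := eqVneq i K; [rewrite subnn expr0 dvd1p|rewrite dvdp0].
apply: dvdp_add; rewrite -mul_polyC dvdp_mull //; first by rewrite dvdp_mull.
have [Kid|idK] := leqP K (i.+1 + d); last by rewrite bpoly_eq0 ?mulr0 ?dvdp0 //; lia.
rewrite t1; last lia.
have [iK|Ki] := leqP K i; first by rewrite (eqP iK) expr0 dvd1p.
by rewrite (_ : K - i = (K - i.+1).+1)%N ?exprS ?dvdp_mul //; lia.
Qed.

(** * The open knot vector *)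

Section Knots.
Context {R : realType} (p r n : nat).
Hypotheses (rp : (r < p)%N) (n_gt0 : (0 < n)%N).

Let t : nat -> R := nth 1 (knots p r n).

Lemma nth_flatten_nseq (T : Type) (x0 : T) (f : nat -> T) m a l i :
  (i < m * l)%N ->
  nth x0 (flatten [seq nseq m (f k) | k <- iota a l]) i = f (a + i %/ m)%N.
Proof.
elim: l a i => [|l IH] a i; first by rewrite muln0.
move=> il; have m0 : (0 < m)%N by lia.
rewrite /= nth_cat size_nseq; case: ltnP => im.
  by rewrite nth_nseq im divn_small ?addn0.
rewrite IH; last by rewrite mulnS in il; lia.
by rewrite -{2}(subnK im) divnDr ?dvdnn // divnn m0 addn1 addnS addSn.
Qed.

(** The minimum with [n] covers both the final knots and the default value 1 of [nth], so that
    monotonicity holds for all indices. *)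
Lemma nth_knots i : t i =
  (if (i <= p)%N then 0 else minn ((i - p.+1) %/ (p - r)).+1 n)%:R / n%:R.
Proof.
have m0 : (0 < p - r)%N by rewrite subn_gt0.
have nn : n%:R != 0 :> R by rewrite pnatr_eq0 -lt0n.
rewrite /t /knots nth_cat size_nseq ltnS; case: leqP => ip.
  by rewrite nth_nseq ltnS ip mul0r.
have S : size (flatten [seq nseq (p - r) (k%:R / n%:R : R) | k <- iota 1 n.-1])
    = ((p - r) * n.-1)%N.
  elim: (n.-1) 1%N => [|l IH] a; first by rewrite muln0.
  by rewrite /= size_cat IH size_nseq mulnS.
rewrite nth_cat S; case: ltnP => il.
  rewrite nth_flatten_nseq // add1n (minn_idPl _) //.
  have := il; rewrite mulnC -ltn_divLR //; lia.
rewrite (minn_idPr _) ?divff //; last first.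
  have : (n.-1 <= (i - p.+1) %/ (p - r))%N by rewrite leq_divRL // mulnC.
  lia.
by rewrite nth_nseq; case: ifP.
Qed.

Lemma knots_homo i j : (i <= j)%N -> t i <= t j.
Proof.
move=> ij; rewrite !nth_knots ler_wpM2r ?invr_ge0 ?ler0n // ler_nat.
case: (leqP i p) => // ip; rewrite ifN; last lia.
have : ((i - p.+1) %/ (p - r) <= (j - p.+1) %/ (p - r))%N by apply: leq_div2r; lia.
lia.
Qed.

Lemma knots_ge0 i : 0 <= t i.
Proof. by rewrite nth_knots divr_ge0 ?ler0n. Qed.

Lemma knots_le1 i : t i <= 1.
Proof.
rewrite nth_knots ler_pdivrMr ?ltr0n // mul1r ler_nat.
by case: (leqP i p) => // _; exact: geq_minr.
Qed.

Lemma knots_first i : (i <= p)%N -> t i = 0.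
Proof. by move=> ip; rewrite nth_knots ip mul0r. Qed.

Lemma knots_p1 : t p.+1 = n%:R^-1.
Proof.
by rewrite nth_knots ltnn subnn div0n (minn_idPl _) // mul1r.
Qed.

Lemma knots_last i : (NB p r n <= i)%N -> t i = 1.
Proof.
have m0 : (0 < p - r)%N by rewrite subn_gt0.
rewrite /NB => iN; rewrite nth_knots ifN; last first.
  by move: iN; move: ((p - r) * (n - 1))%N => ?; lia.
have : (n - 1 <= (i - p.+1) %/ (p - r))%N by rewrite leq_divRL // mulnC; lia.
move=> H; rewrite (minn_idPr _); last lia.
by rewrite divff // pnatr_eq0 -lt0n.
Qed.

Lemma knots_pred_last : t (NB p r n).-1 = 1 - n%:R^-1.
Proof.
have m0 : (0 < p - r)%N by rewrite subn_gt0.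
have nn : n%:R != 0 :> R by rewrite pnatr_eq0 -lt0n.
have -> : 1 - n%:R^-1 = (n - 1)%N%:R / n%:R :> R.
  by rewrite natrB // mulrBl divff // mul1r.
rewrite nth_knots /NB; congr (_%:R / _); case: (leqP _ p) => ip.
  have : ((p - r) * (n - 1) = 0)%N.
    by move: ip; move: ((p - r) * (n - 1))%N => ?; lia.
  by move/eqP; rewrite muln_eq0 => /orP[] /eqP; lia.
have n1 : (1 < n)%N.
  by case: (n) n_gt0 ip => [|[|l]] // _; rewrite subnn muln0; lia.
have -> : (((p - r) * (n - 1) + p + 1).-1 - p.+1 =
    (n - 2) * (p - r) + (p - r).-1)%N.
  have -> : (n - 1 = (n - 2).+1)%N by lia.
  by rewrite mulnS mulnC; move: ((n - 2) * (p - r))%N => ?; lia.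
rewrite divnMDl // divn_small; lia.
Qed.

(** Among the actual knots, of indices up to [N + p], none occurs [p + 2] times: the multiplicity is
    [p + 1] at the ends and [p - r] inside. *)
Lemma knots_span j : (j < NB p r n)%N -> t j < t (j + p.+1)%N.
Proof.
have m0 : (0 < p - r)%N by rewrite subn_gt0.
move=> jN; rewrite !nth_knots ltr_pM2r ?invr_gt0 ?ltr0n // ltr_nat.
rewrite [X in (_ < X)%N]ifN; last lia.
have -> : (j + p.+1 - p.+1 = j)%N by lia.
case: (leqP j p) => jp; first by rewrite leq_min n_gt0.
have j1 : ((j - p.+1) %/ (p - r) < n - 1)%N.
  by rewrite ltn_divLR // mulnC; move: jN; rewrite /NB; lia.
have j2 : (((j - p.+1) %/ (p - r)).+1 <= j %/ (p - r))%N.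
  rewrite leq_divRL // mulSn.
  have := leq_trunc_div (j - p.+1) (p - r).
  by move: (_ %/ _ * _)%N => ?; lia.
by rewrite leq_min; lia.
Qed.

Lemma knots_span_ex j : (j < NB p r n)%N ->
  exists2 k, (j <= k <= j + p)%N & t k < t k.+1.
Proof.
move=> /knots_span; elim: {1 2}p => [|m IH].
  by rewrite addn1 => H; exists j => //; rewrite addn0 leqnn.
have [H _|H] := ltP (t j) (t (j + m.+1)%N).
  by have [k k1 k2] := IH H; exists k => //; lia.
rewrite addnS => H'; exists (j + m.+1)%N; first lia.
exact: le_lt_trans H H'.
Qed.

End Knots.

(** * Orders of vanishing at the ends of the interval *)

Section VanishingOrder.
Context {R : realType} (delta : R).
Hypothesis delta_gt0 : 0 < delta.
Implicit Types f g : R -> R.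

(** Besides orders of vanishing at least [a] at 0 and [b] at 1, this asserts that [f] is polynomial
    within [delta] of each end and everywhere beyond it; nothing is said about the middle of the
    interval. *)
Definition ord a b f :=
  (exists q : {poly R}, forall x, x < delta -> f x = x ^+ a * q.[x]) /\
  (exists q : {poly R}, forall x, x < delta -> f (1 - x) = x ^+ b * q.[x]).

Lemma ord_le a b a' b' f : (a' <= a)%N -> (b' <= b)%N -> ord a b f -> ord a' b' f.
Proof.
move=> aa bb [[q Eq] [s Es]]; split.
  exists ('X^(a - a') * q) => x xd.
  by rewrite Eq // hornerM hornerXn mulrA -exprD subnKC.
exists ('X^(b - b') * s) => x xd.
by rewrite Es // hornerM hornerXn mulrA -exprD subnKC.
Qed.

Lemma ord_rev a b f : ord a b f -> ord b a (fun x => f (1 - x)).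
Proof.
by move=> [[q Eq] [s Es]]; split; [exists s | exists q => x xd; rewrite subKr Eq].
Qed.

Lemma ordM a b a' b' f g : ord a b f -> ord a' b' g ->
  ord (a + a') (b + b') (fun x => f x * g x).
Proof.
move=> [[q Eq] [s Es]] [[q' Eq'] [s' Es']]; split.
  by exists (q * q') => x xd; rewrite Eq // Eq' // hornerM exprD; ring.
by exists (s * s') => x xd; rewrite Es // Es' // hornerM exprD; ring.
Qed.

Lemma ordD a b f g : ord a b f -> ord a b g -> ord a b (fun x => f x + g x).
Proof.
move=> [[q Eq] [s Es]] [[q' Eq'] [s' Es']]; split.
  by exists (q + q') => x xd; rewrite Eq // Eq' // hornerD mulrDr.
by exists (s + s') => x xd; rewrite Es // Es' // hornerD mulrDr.
Qed.

Lemma ordZ a b f c : ord a b f -> ord a b (fun x => c * f x).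
Proof.
move=> [[q Eq] [s Es]]; split.
  by exists (c *: q) => x xd; rewrite Eq // hornerZ; ring.
by exists (c *: s) => x xd; rewrite Es // hornerZ; ring.
Qed.

Lemma ord_poly (p : {poly R}) : ord 0 0 (horner p).
Proof.
split; first by exists p => x _; rewrite expr0 mul1r.
exists (p \Po (1 - 'X)) => x _.
by rewrite horner_comp expr0 mul1r hornerD hornerN hornerC hornerX.
Qed.

Lemma derive1_near f (q : {poly R}) x : x < delta ->
  (forall x, x < delta -> f x = q.[x]) -> derive1 f x = q^`().[x].
Proof.
move=> xd E; rewrite derive1E.
have [_ <-] := is_derive_poly q x.
apply: near_eq_derive; near=> y; apply: E; near: y; exact: lt_nbhsl.
Unshelve. all: by end_near. Qed.

Lemma deriv_XnM a (q : {poly R}) :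
  exists s, ('X^a * q)^`() = 'X^(a.-1) * s.
Proof.
case: a => [|a]; first by exists q^`(); rewrite expr0 !mul1r.
exists (a.+1%:R *: q + 'X * q^`()).
by rewrite derivM derivXn /= -mul_polyC rmorph_nat -mulr_natr exprS; ring.
Qed.

Lemma ord_derive1 a b f : ord a b f -> ord a.-1 b.-1 (derive1 f).
Proof.
move=> [[q Eq] [s Es]]; split.
  have [s' Ds] := deriv_XnM a q; exists s' => x xd.
  rewrite (@derive1_near f ('X^a * q)) // => [|y yd].
    by rewrite Ds hornerM hornerXn.
  by rewrite Eq // hornerM hornerXn.
have [s' Ds] := deriv_XnM b s; exists (- s') => x xd.
pose S : {poly R} := 'X^b * s.
have E y : 1 - delta < y -> f y = (S \Po (1 - 'X)).[y].
  move=> yd; rewrite -[y in LHS](subKr 1) Es; last by rewrite ltrBlDr -ltrBlDl.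
  by rewrite horner_comp !hornerE.
rewrite derive1E; have [_ D] := is_derive_poly (S \Po (1 - 'X)) (1 - x).
rewrite (_ : 'D_1 f (1 - x) = 'D_1 (horner (S \Po (1 - 'X))) (1 - x)); last first.
  apply: near_eq_derive; near=> y; apply: E; near: y; apply: lt_nbhsr.
  by rewrite ltrD2l ltrN2.
rewrite D deriv_comp derivB derivX derivC sub0r mulrN1 hornerN horner_comp.
rewrite !(hornerD, hornerN, hornerC, hornerX) subKr Ds hornerM hornerXn.
by rewrite mulrN.
Unshelve. all: by end_near. Qed.

End VanishingOrder.

(** * Univariate B-spline bases *)

Section BsplineBasis.
Context {R : realType} (p r n : nat).
Hypotheses (rp : (r < p)%N) (n_gt0 : (0 < n)%N).

Let t : nat -> R := nth 1 (knots p r n).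
Let delta : R := n%:R^-1.
Let N := NB p r n.

Let delta_gt0 : 0 < delta.
Proof. by rewrite invr_gt0 ltr0n. Qed.

Definition Bpol j : {poly R} := bpoly t p p j.

Let Tho := @knots_homo R p r n rp n_gt0.
Let Tfi := @knots_first R p r n rp n_gt0.

Let t_pos : 0 < t p.+1.
Proof. by rewrite /t knots_p1. Qed.

Lemma Bs_near0 j x : x < delta -> Bs p r n j x = (Bpol j).[x].
Proof.
move=> xd; apply: bspline_bpoly; [exact: Tho|exact: knots_ge0|exact: knots_le1|].
by rewrite /on_knots Tfi // t_pos eqxx /t knots_p1 // xd orbT.
Qed.

Lemma Bpol_low j l : (l < j)%N -> (Bpol j)`_l = 0.
Proof.
move=> lj; have := bpoly_dvd_left Tfi t_pos p j.
by rewrite addnK => /coef_dvdXn ->.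
Qed.

Lemma Bpol_lead j : (j <= p)%N -> 0 < (Bpol j)`_j.
Proof.
by move=> jp; have := lead_bpoly_left Tho Tfi t_pos jp (leq_addl j p); rewrite addnK.
Qed.

Lemma Bpol00 : (Bpol 0)`_0 = 1.
Proof.
have := bpoly_first Tfi t_pos (leqnn p); rewrite subnn /Bpol => ->.
by rewrite -horner_coef0 horner_exp !(hornerD, hornerN, hornerZ, hornerC, hornerX)
  mulr0 subr0 expr1n.
Qed.

Lemma Bpol01 : (Bpol 0)`_1 = - (p%:R * n%:R).
Proof.
have := bpoly_first Tfi t_pos (leqnn p); rewrite subnn /Bpol => ->.
have -> (q : {poly R}) : q`_1 = q^`().[0] by rewrite horner_coef0 coef_deriv.
rewrite deriv_exp derivB derivC derivZ derivX sub0r hornerMn hornerM horner_exp.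
rewrite !(hornerD, hornerN, hornerZ, hornerC, hornerX) !mulr0 subr0 expr1n.
by rewrite !mulr1 knots_p1 // invrK mulNrn mulr_natl.
Qed.

Lemma Bpol11 : (Bpol 1)`_1 = p%:R * n%:R.
Proof.
have := coef1_bpoly_second Tho Tfi t_pos (leqnn p); rewrite subnn /Bpol => ->.
by rewrite knots_p1 // invrK.
Qed.

Lemma Bs_ord j : (j < N)%N -> ord delta j (N - j).-1 (Bs p r n j).
Proof.
move=> jN; split.
  have /dvdpP[q Eq] := bpoly_dvd_left Tfi t_pos p j.
  exists q => x xd; rewrite Bs_near0 // /Bpol Eq addnK hornerM hornerXn mulrC //.
(* The last element has index [N - 1]: from the index [N] on all knots are 1. *)
have t1 i : (N.-1 < i)%N -> t i = 1 by move=> Ni; apply: knots_last => //; lia.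
have /dvdpP[q Eq] := bpoly_dvd_right p j t1.
exists (q \Po (1 - 'X)) => x xd.
have on : on_knots t N.-1 (1 - x).
  rewrite /on_knots [t N.-1](knots_pred_last rp n_gt0) t1 ?eqxx; last lia.
  rewrite gtrBl delta_gt0 andbT /=; apply/orP; right.
  by rewrite lerD2l lerN2 ltW.
rewrite [LHS](bspline_bpoly Tho (knots_ge0 rp n_gt0) (knots_le1 rp n_gt0) _ _ on).
rewrite -/t Eq hornerM horner_exp horner_comp !(hornerD, hornerN, hornerC, hornerX).
by rewrite subKr mulrC -subn1 subnAC subn1.
Qed.

(** It suffices to look at one nonempty element in the support of the [i]-th function, where the
    functions alive on it are already independent. *)
Lemma Bs_indep (u : nat -> R) :
  (forall x, 0 < x < 1 -> \sum_(i < N) u i * Bs p r n i x = 0) ->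
  forall i, (i < N)%N -> u i = 0.
Proof.
move=> H i iN; have [k /andP[ik ki] tk] := @knots_span_ex R p r n rp n_gt0 i iN.
have kp : (p <= k)%N.
  by rewrite leqNgt; apply/negP => kp; move: tk; rewrite !knots_first ?ltxx // ltnW.
have kN : (k < N)%N.
  rewrite ltnNge; apply/negP => kN.
  by move: tk; rewrite !knots_last ?ltxx // leqW.
have E : \sum_(i < k.+1) u i *: bpoly t k p i = 0.
  have d0 : 0 < t k.+1 - t k by rewrite subr_gt0.
  apply: (poly_eq0_itv d0 (g := fun x => t k + x)).
    by move=> x y /addrI.
  move=> x /andP[x0 xd]; have kx : t k < t k + x by rewrite ltrDl.
  have xk : t k + x < t k.+1 by rewrite -ltrBrDl.
  have on : on_knots t k (t k + x).
    by rewrite /on_knots tk (ltW kx) xk !orbT.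
  have x01 : 0 < t k + x < 1.
    rewrite (le_lt_trans (knots_ge0 rp n_gt0 k) kx) /=.
    exact: lt_le_trans xk (knots_le1 rp n_gt0 _).
  apply/eqP; rewrite horner_sum -[RHS](H _ x01).
  rewrite -(big_mkord xpredT (fun i => u i * Bs p r n i (t k + x))).
  rewrite (big_cat_nat (n := k.+1)) //= [X in _ = _ + X]big1_seq ?addr0.
    rewrite big_mkord; apply: eq_bigr => l _; rewrite hornerZ.
    by rewrite [Bs _ _ _ _ _](bspline_bpoly Tho (knots_ge0 rp n_gt0)
      (knots_le1 rp n_gt0) _ _ on).
  move=> l /andP[_]; rewrite mem_index_iota => /andP[kl _].
  rewrite [Bs _ _ _ _ _](bspline_bpoly Tho (knots_ge0 rp n_gt0) (knots_le1 rp n_gt0) _ _ on).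
  have lk : ~~ (l <= k <= l + p)%N by rewrite negb_and -ltnNge kl.
  by rewrite (bpoly_eq0 _ lk) horner0 mulr0.
exact: (bpoly_indep Tho kp tk E).
Qed.

(** A form suited to index types with two components: terms with the same B-spline index are
    collected, while [P] may restrict the other component. *)
Lemma Bs_indep_sum (J : finType) (P : pred J) (ix : J -> nat) (c : J -> R) :
  (forall j, P j -> (ix j < N)%N) ->
  (forall x, 0 < x < 1 -> \sum_(j | P j) c j * Bs p r n (ix j) x = 0) ->
  forall m, \sum_(j | P j && (ix j == m)) c j = 0.
Proof.
move=> PN H m; have [mN|Nm] := ltnP m N; last first.
  by rewrite big_pred0 // => j; apply/negP => /andP[/PN + /eqP]; lia.
apply: (@Bs_indep (fun m => \sum_(j | P j && (ix j == m)) c j)) => // x x01.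
rewrite -[RHS](H x x01).
transitivity (\sum_(i < N) \sum_(j | P j && (ix j == i)) c j * Bs p r n (ix j) x).
  apply: eq_bigr => i _; rewrite mulr_suml.
  by apply: eq_bigr => j /andP[_ /eqP ->].
rewrite (exchange_big_dep P) /= => [|i j _ /andP[]//].
apply: eq_bigr => j Pj; rewrite (big_pred1 (Ordinal (PN j Pj))) // => i.
by rewrite Pj /= -val_eqE eq_sym.
Qed.

End BsplineBasis.

(** * Vanishing of tensor products at the sides of the square *)

Section SeparableSums.
Context {R : realType} (delta : R).
Hypothesis delta_gt0 : 0 < delta.
Implicit Types (K : nat -> nat -> nat -> nat -> Prop) (h : R * R -> R).

Inductive sepsum K : (R * R -> R) -> Prop :=
| sep_term f g a0 a1 b0 b1 : ord delta a0 a1 f -> ord delta b0 b1 g ->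
    K a0 a1 b0 b1 -> sepsum K (fun z => f z.1 * g z.2)
| sep_add h h' : sepsum K h -> sepsum K h' -> sepsum K (fun z => h z + h' z)
| sep_zero : sepsum K (fun=> 0).

Lemma sepsum_impl K K' h :
  (forall a0 a1 b0 b1, K a0 a1 b0 b1 -> K' a0 a1 b0 b1) ->
  sepsum K h -> sepsum K' h.
Proof.
move=> KK'; elim=> [f g a0 a1 b0 b1 Hf Hg /KK' Hk|h1 h2 _ H1 _ H2|].
- exact: sep_term Hf Hg Hk.
- exact: sep_add.
- exact: sep_zero.
Qed.

Lemma sepsumZ K h c : sepsum K h -> sepsum K (fun z => c * h z).
Proof.
elim=> [f g a0 a1 b0 b1 Hf Hg Hk|h1 h2 _ H1 _ H2|].
- rewrite (_ : (fun z => _) = (fun z => (fun x => c * f x) z.1 * g z.2)).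
    exact: sep_term (ordZ c Hf) Hg Hk.
  by apply/funext => z; rewrite mulrA.
- rewrite (_ : (fun z => _) = (fun z => c * h1 z + c * h2 z)).
    exact: sep_add.
  by apply/funext => z; rewrite mulrDr.
- by rewrite (_ : (fun z => _) = (fun=> 0)); [exact: sep_zero|
    apply/funext => z; rewrite mulr0].
Qed.

Lemma sepsum_sum K (J : Type) (s : seq J) (P : pred J) (h : J -> R * R -> R) :
  (forall j, P j -> sepsum K (h j)) ->
  sepsum K (fun z => \sum_(j <- s | P j) h j z).
Proof.
move=> H; elim: s => [|j s IH].
  by rewrite (_ : (fun z => _) = (fun=> 0)); [exact: sep_zero|
    apply/funext => z; rewrite big_nil].
case Pj : (P j); last first.
  by rewrite (_ : (fun z => _) = (fun z => \sum_(j <- s | P j) h j z)) //;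
    apply/funext => z; rewrite big_cons Pj.
rewrite (_ : (fun z => _) = (fun z => h j z + \sum_(j <- s | P j) h j z)).
  exact: sep_add (H _ Pj) IH.
by apply/funext => z; rewrite big_cons Pj.
Qed.

(** Composition with [rot] gives [f(1 - z_2) g(z_1)]: the factors are exchanged and one of them is
    reversed. *)
Definition rotK K := fun a0 a1 b0 b1 => K b1 b0 a0 a1.

Lemma sepsum_rot K h : sepsum K h -> sepsum (rotK K) (h \o rot).
Proof.
elim=> [f g a0 a1 b0 b1 Hf Hg Hk|h1 h2 _ H1 _ H2|].
- rewrite (_ : _ \o rot = fun z => g z.1 * (fun x => f (1 - x)) z.2).
    exact: sep_term Hg (ord_rev Hf) Hk.
  by apply/funext => z /=; rewrite mulrC.
- exact: sep_add H1 H2.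
- exact: sep_zero.
Qed.

Lemma iter_rotK d K h : sepsum K h -> sepsum (iter d rotK K) (h \o iter d rot).
Proof.
elim: d h => [|d IH] h H //.
rewrite (_ : _ \o _ = (h \o iter d rot) \o rot); first exact/sepsum_rot/IH.
by apply/funext => z; rewrite /= -iterSr.
Qed.

Lemma rot4 (z : R * R) : iter 4 rot z = z.
Proof. by case: z => a b; rewrite /rot /= !subKr. Qed.

Lemma iter_rot_mod d (z : R * R) : iter d rot z = iter (d %% 4)%N rot z.
Proof.
rewrite {1}(divn_eq d 4) addnC iterD.
elim: (d %/ 4)%N => [|m IH]; first by rewrite mul0n.
by rewrite mulSn addnC iterD rot4.
Qed.

Lemma map_polyC_mulC (q s : {poly R}) a :
  (map_poly polyC q * s%:P)`_a = q`_a *: s.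
Proof. by rewrite coefMC coef_map mul_polyC. Qed.

Lemma locp_term (f g : R -> R) (q s : {poly R}) :
  (forall x, x < delta -> f x = q.[x]) -> (forall x, x < delta -> g x = s.[x]) ->
  locp delta (fun z => f z.1 * g z.2) (map_poly polyC q * s%:P).
Proof.
move=> Eq Es z z1 z2; rewrite Eq // Es // hornerM horner_map hornerC.
by rewrite hornerM hornerC.
Qed.

(** A product whose factors start at degrees [a0] and [b0] has no term of total degree below
    [a0 + b0]. *)
Lemma sepsum_locp K h : sepsum K h -> exists2 P, locp delta h P &
  (forall a0 a1 b0 b1, K a0 a1 b0 b1 -> (3 <= a0 + b0)%N) ->
  forall a b, (a + b <= 2)%N -> P`_a`_b = 0.
Proof.
elim=> [f g a0 a1 b0 b1 [[q Eq] _] [[s Es] _] Hk|h1 h2 _ [P HP P0] _ [Q HQ Q0]|].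
- exists (map_poly polyC ('X^a0 * q) * ('X^b0 * s)%:P).
    by apply: locp_term => x xd; rewrite ?Eq ?Es // hornerM hornerXn.
  move=> K3 a b ab; rewrite map_polyC_mulC coefZ !coefXnM.
  case: ltnP => aa; first by rewrite mul0r.
  case: ltnP => bb; first by rewrite mulr0.
  by have := K3 _ _ _ _ Hk; lia.
- exists (P + Q) => [|K3 a b ab]; first exact: locpD.
  by rewrite !coefD P0 ?Q0 ?addr0.
- exists 0 => [z _ _|_ a b _]; first by rewrite !horner0.
  by rewrite !coef0.
Qed.

(** The height [y] need not be near a corner, since the second factors enter only through their
    values at [y]. *)
Lemma sepsum_side K h : sepsum K h ->
  (forall a0 a1 b0 b1, K a0 a1 b0 b1 -> (2 <= a0)%N) ->
  forall y, exists q : {poly R}, forall x, x < delta ->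
    h (x, y) = x ^+ 2 * q.[x].
Proof.
move=> Hh K2 y; elim: Hh => [f g a0 a1 b0 b1 [[q Eq] _] _ Hk|h1 h2 _ [q Eq] _ [s Es]|].
- exists (g y *: ('X^(a0 - 2) * q)) => x xd /=.
  rewrite Eq // hornerZ hornerM hornerXn -[in LHS](subnKC (K2 _ _ _ _ Hk)) exprD.
  ring.
- by exists (q + s) => x xd; rewrite Eq // Es // hornerD mulrDr.
- by exists 0 => x _; rewrite horner0 mulr0.
Qed.

(* a0, a1 (b0, b1) are orders of vanishing at z_1 = 0, 1 (at z_2 = 0, 1), for
   patch functions, edge functions (the edge being at z_1 = 0) and vertex
   functions (the vertex being the origin). *)
Definition Kinner a0 a1 b0 b1 := [/\ 2 <= a0, 2 <= a1, 2 <= b0 & 2 <= b1]%N.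
Definition Kedge a0 a1 b0 b1 :=
  [/\ 3 <= a0 + b0, 3 <= a0 + b1, 3 <= a1, 2 <= b0 & 2 <= b1]%N.
Definition Kvert a0 a1 b0 b1 := [/\ 3 <= a1 + b0, 3 <= a1 + b1 & 3 <= a0 + b1]%N.

Lemma Kinner_rot d a0 a1 b0 b1 :
  iter d rotK Kinner a0 a1 b0 b1 -> (2 <= a0)%N /\ (2 <= b0)%N.
Proof.
elim: d a0 a1 b0 b1 => [|d IH] a0 a1 b0 b1; first by case.
suff : forall d a0 a1 b0 b1, iter d rotK Kinner a0 a1 b0 b1 -> Kinner a0 a1 b0 b1.
  by move=> H /H[].
elim=> // {IH a0 a1 b0 b1}e IH a0 a1 b0 b1.
by rewrite iterS => /IH[].
Qed.

Lemma sepsum_mod K h d : sepsum K h ->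
  sepsum (iter (d %% 4)%N rotK K) (h \o iter d rot).
Proof.
move=> /(iter_rotK (d %% 4)%N); congr sepsum.
by apply/funext => z; rewrite /= [in RHS]iter_rot_mod.
Qed.

End SeparableSums.

Lemma mod4_cases d : [\/ d %% 4 = 0, d %% 4 = 1, d %% 4 = 2 | d %% 4 = 3]%N.
Proof.
have := ltn_pmod d (isT : (0 < 4)%N).
by case: (d %% 4)%N => [|[|[|[|]]]] // _;
  [constructor 1|constructor 2|constructor 3|constructor 4].
Qed.

Lemma Kedge_corner d a0 a1 b0 b1 :
  iter (d %% 4)%N rotK Kedge a0 a1 b0 b1 -> (3 <= a0 + b0)%N.
Proof. by case: (mod4_cases d) => -> /= []; lia. Qed.

(** The trivial rotation is excluded because on its own side an edge function has terms of order 0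
    and 1. *)
Lemma Kedge_side d a0 a1 b0 b1 : (d %% 4 != 0)%N ->
  iter (d %% 4)%N rotK Kedge a0 a1 b0 b1 -> (2 <= a0)%N.
Proof. by case: (mod4_cases d) => -> // _ /= []; lia. Qed.

(** The trivial rotation is excluded because there the origin is the vertex itself. *)
Lemma Kvert_corner d a0 a1 b0 b1 : (d %% 4 != 0)%N ->
  iter (d %% 4)%N rotK Kvert a0 a1 b0 b1 -> (3 <= a0 + b0)%N.
Proof. by case: (mod4_cases d) => -> // _ /= []; lia. Qed.

Section LowIndices.
Context {R : realType} {V : lmodType R}.

(** The five indices of an edge projection, written out so that identities between their
    combinations become ring identities. *)
Definition low_sum (F : nat -> nat -> V) :=
  F 0%N 0%N + F 1%N 0%N + F 2%N 0%N + F 0%N 1%N + F 1%N 1%N.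

Lemma big_low_ix (F : nat -> nat -> V) :
  \sum_(j : low_ix) F (val j).1 (val j).2 = low_sum F.
Proof.
rewrite -(big_sub [pred j : 'I_3 * 'I_2 | (j.1 + j.2 <= 2)%N]
  (fun j : 'I_3 * 'I_2 => F j.1 j.2)).
rewrite (eq_bigl (fun j : 'I_3 * 'I_2 => xpredT j.1 && (j.1 + j.2 <= 2)%N)) //.
rewrite -(pair_big_dep xpredT
  (fun (i : 'I_3) (j : 'I_2) => (i + j <= 2)%N) (fun (i : 'I_3) (j : 'I_2) => F i j)) /=.
rewrite !big_ord_recl !big_ord0 /= !big_mkcond !big_ord_recl !big_ord0 /=.
rewrite !big_mkcond !big_ord_recl !big_ord0 /= !addr0.
rewrite big_mkcond !big_ord_recl !big_ord0 /low_sum /bump /= !addr0.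
by rewrite [LHS](AC (2*(2*1)) (1*3*5*2*4)).
Qed.

End LowIndices.

(** * Edge functions and Hermite projections *)

Section EdgeForms.
Context {R : realType} (p r n : nat).
Hypotheses (r_gt0 : (0 < r)%N) (rp : (r + 2 <= p)%N) (n_gt0 : (0 < n)%N)
  (N5 : (5 <= Nminus p r n)%N).

Let delta : R := n%:R^-1.
Let pn : R := p%:R * n%:R.

Let delta_gt0 : 0 < delta.
Proof. by rewrite invr_gt0 ltr0n. Qed.

Let rp0 : (r < p)%N. Proof. lia. Qed.
Let rp1 : (r.+1 < p)%N. Proof. lia. Qed.
Let rp2 : (r < p.-1)%N. Proof. lia. Qed.

Let pn_neq0 : pn != 0.
Proof. by rewrite mulf_neq0 // pnatr_eq0; lia. Qed.

Lemma NB_plus : NB p r.+1 n = (Nminus p r n).+1.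
Proof.
rewrite /Nminus /NB; have -> : (p.-1 - r = p - r.+1)%N by lia.
by move: (_ * _)%N => ?; lia.
Qed.

Lemma NB_ge : (Nminus p r n < NB p r n)%N.
Proof.
rewrite /Nminus /NB.
have : ((p.-1 - r) * (n - 1) <= (p - r) * (n - 1))%N by rewrite leq_mul2r; lia.
by move: ((p.-1 - r) * _)%N ((p - r) * _)%N => ? ?; lia.
Qed.

Definition BP j : {poly R} := Bpol p r.+1 n j.
Definition BM j : {poly R} := Bpol p.-1 r n j.
Definition C0pol : {poly R} := Bpol p r n 0 + Bpol p r n 1.
Definition C1pol : {poly R} := pn^-1 *: Bpol p r n 1.

Lemma c0_near x : x < delta -> c0 p r n x = C0pol.[x].
Proof. by move=> xd; rewrite /c0 !Bs_near0 // hornerD. Qed.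

Lemma c1_near x : x < delta -> c1 p r n x = C1pol.[x].
Proof.
by move=> xd; rewrite /c1 !Bs_near0 // hornerZ /pn invfM; congr (_ * _); rewrite mulrC.
Qed.

Lemma Bs1_c1 x : Bs p r n 1 x = pn * c1 p r n x.
Proof.
by rewrite /c1 mulrA -invfM [n%:R * _]mulrC mulfV // mul1r.
Qed.

Lemma Bs0_c x : Bs p r n 0 x = c0 p r n x - pn * c1 p r n x.
Proof. by rewrite -Bs1_c1 /c0 addrK. Qed.

Lemma C0_0 : C0pol`_0 = 1.
Proof. by rewrite coefD Bpol00 // Bpol_low // addr0. Qed.

Lemma C0_1 : C0pol`_1 = 0.
Proof. by rewrite coefD Bpol01 // Bpol11 // addNr. Qed.

Lemma C1_0 : C1pol`_0 = 0.
Proof. by rewrite coefZ Bpol_low // mulr0. Qed.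

Lemma C1_1 : C1pol`_1 = 1.
Proof. by rewrite coefZ Bpol11 // mulVf. Qed.

Lemma ord_Bs1 : ord delta 1 3 (@Bs R p r n 1).
Proof.
have := NB_ge => H; apply: ord_le (Bs_ord rp0 n_gt0 (j := 1) _) => //; lia.
Qed.

Lemma ord_c1 : ord delta 1 3 (@c1 R p r n).
Proof. by apply: ordZ; exact: ord_Bs1. Qed.

Lemma ord_c0 : ord delta 0 3 (@c0 R p r n).
Proof.
have H := NB_ge; apply: ordD; last exact: ord_le ord_Bs1.
by apply: ord_le (Bs_ord rp0 n_gt0 (j := 0) _) => //; lia.
Qed.

(** The functions [c0] and [c1] have values 1, 0 and derivatives 0, 1 at 0. Hence [A1] is the trace
    on the left side and [A2] the normal derivative there; [bf] is the analogue for the bottom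
    side. *)
Definition lf (A1 A2 : R -> R) : R * R -> R :=
  fun z => A1 z.2 * c0 p r n z.1 + A2 z.2 * c1 p r n z.1.
Definition bf (A1 A2 : R -> R) : R * R -> R :=
  fun z => A1 z.1 * c0 p r n z.2 + A2 z.1 * c1 p r n z.2.

Lemma lfE A1 A2 :
  lf A1 A2 = fun z => c0 p r n z.1 * A1 z.2 + c1 p r n z.1 * A2 z.2.
Proof.
by apply/funext => z; rewrite /lf ![c0 _ _ _ _ * _]mulrC ![c1 _ _ _ _ * _]mulrC.
Qed.

Lemma bf_rot A1 A2 :
  bf A1 A2 \o rot = lf (fun x => A1 (1 - x)) (fun x => A2 (1 - x)).
Proof. by []. Qed.

Lemma lf_sep K a b A1 A2 : ord delta a 3 A1 -> ord delta b 2 A2 ->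
  K 0%N 3%N a 3%N -> K 1%N 3%N b 2%N -> sepsum delta K (lf A1 A2).
Proof.
move=> O1 O2 K1 K2; rewrite lfE.
by apply: sep_add; [exact: sep_term ord_c0 O1 K1|exact: sep_term ord_c1 O2 K2].
Qed.

Lemma bf_sep K a b A1 A2 : ord delta a 3 A1 -> ord delta b 2 A2 ->
  K a 3%N 0%N 3%N -> K b 2%N 1%N 3%N -> sepsum delta K (bf A1 A2).
Proof.
move=> O1 O2 K1 K2.
by apply: sep_add; [exact: sep_term O1 ord_c0 K1|exact: sep_term O2 ord_c1 K2].
Qed.

Lemma lf_edge A1 A2 : ord delta 3 3 A1 -> ord delta 2 2 A2 ->
  sepsum delta Kedge (lf A1 A2).
Proof. by move=> O1 O2; apply: lf_sep O1 O2 _ _; split. Qed.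

Lemma lf_vert A1 A2 : ord delta 0 3 A1 -> ord delta 0 2 A2 ->
  sepsum delta Kvert (lf A1 A2).
Proof. by move=> O1 O2; apply: lf_sep O1 O2 _ _; split. Qed.

Lemma bf_vert A1 A2 : ord delta 0 3 A1 -> ord delta 0 2 A2 ->
  sepsum delta Kvert (bf A1 A2).
Proof. by move=> O1 O2; apply: bf_sep O1 O2 _ _; split. Qed.

Definition lfpol (q1 q2 : {poly R}) : {poly {poly R}} :=
  map_poly polyC C0pol * q1%:P + map_poly polyC C1pol * q2%:P.

Lemma lf_locp A1 A2 q1 q2 : (forall x, x < delta -> A1 x = q1.[x]) ->
  (forall x, x < delta -> A2 x = q2.[x]) -> locp delta (lf A1 A2) (lfpol q1 q2).
Proof.
move=> E1 E2; rewrite lfE.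
exact: locpD (locp_term c0_near E1) (locp_term c1_near E2).
Qed.

Lemma bf_locp A1 A2 q1 q2 : (forall x, x < delta -> A1 x = q1.[x]) ->
  (forall x, x < delta -> A2 x = q2.[x]) ->
  locp delta (bf A1 A2) (swapXY (lfpol q1 q2)).
Proof.
move=> E1 E2 z z1 z2; rewrite horner2_swapXY.
exact: (lf_locp E1 E2 (z := (z.2, z.1))).
Qed.

Lemma coef_lfpol q1 q2 a b :
  (lfpol q1 q2)`_a`_b = C0pol`_a * q1`_b + C1pol`_a * q2`_b.
Proof. by rewrite coefD !map_polyC_mulC coefD !coefZ. Qed.

Lemma coef0_lfpol q1 q2 b : (lfpol q1 q2)`_0`_b = q1`_b.
Proof. by rewrite coef_lfpol C0_0 C1_0 mul1r mul0r addr0. Qed.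

Lemma coef1_lfpol q1 q2 b : (lfpol q1 q2)`_1`_b = q2`_b.
Proof. by rewrite coef_lfpol C0_1 C1_1 mul1r mul0r add0r. Qed.

(* With be = be1, al = al1 (be = be2, al = - al2) these are the coefficients of
   c0 and c1 in the first (second) piece of an interface function; be = 0 and
   al = 1 give the functions of a boundary edge. *)
Definition eA (j1 j2 : nat) : R -> R :=
  fun x => if j2 == 0%N then Bplus p r n j1 x else 0.
Definition eB (be al : {poly R}) (j1 j2 : nat) : R -> R :=
  fun x => if j2 == 0%N then - be.[x] * derive1 (Bplus p r n j1) x
           else pn * (al.[x] * Bminus p r n j1 x).

Definition eApol (j1 j2 : nat) : {poly R} := if j2 == 0%N then BP j1 else 0.
Definition eBpol (be al : {poly R}) (j1 j2 : nat) : {poly R} :=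
  if j2 == 0%N then - be * (BP j1)^`() else pn *: (al * BM j1).

Lemma Bplus_near j x : x < delta -> Bplus p r n j x = (BP j).[x].
Proof. by move=> xd; rewrite /Bplus Bs_near0. Qed.

Lemma Bminus_near j x : x < delta -> Bminus p r n j x = (BM j).[x].
Proof. by move=> xd; rewrite /Bminus Bs_near0. Qed.

Lemma eA_near j1 j2 x : x < delta -> eA j1 j2 x = (eApol j1 j2).[x].
Proof.
by move=> xd; rewrite /eA /eApol; case: ifP; rewrite ?horner0 // Bplus_near.
Qed.

Lemma eB_near be al j1 j2 x : x < delta ->
  eB be al j1 j2 x = (eBpol be al j1 j2).[x].
Proof.
move=> xd; rewrite /eB /eBpol; case: ifP => _.
  rewrite (derive1_near xd (fun y yd => Bplus_near j1 yd)).
  by rewrite hornerM hornerN.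
by rewrite Bminus_near // hornerZ hornerM.
Qed.

Lemma ord_eA a b j1 j2 : (j2 = 0%N -> a <= j1 /\ b + j1 <= Nminus p r n)%N ->
  ord delta a b (eA j1 j2).
Proof.
rewrite /eA; case: (eqVneq j2 0%N) => [_ [//|aj bj]|_ _].
  have jN : (j1 < NB p r.+1 n)%N by rewrite NB_plus; lia.
  apply: ord_le (Bs_ord rp1 n_gt0 jN) => //; rewrite NB_plus; lia.
by split; exists 0 => x _; rewrite horner0 mulr0.
Qed.

Lemma ord_eB a b be al j1 j2 :
  (j2 = 0%N -> a <= j1.-1 /\ b.+1 + j1 <= Nminus p r n)%N ->
  (j2 <> 0%N -> a <= j1 /\ b.+1 + j1 <= Nminus p r n)%N ->
  ord delta a b (eB be al j1 j2).
Proof.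
rewrite /eB; case: (eqVneq j2 0%N) => [-> [//|aj bj] _|j2N _ [|aj bj]]; last 2 first.
- exact/eqP.
- apply: ordZ; rewrite -[a]add0n -[b]add0n; apply: ordM; first exact: ord_poly.
  have jN : (j1 < NB p.-1 r n)%N by rewrite -/(Nminus _ _ _); lia.
  by apply: ord_le (Bs_ord rp2 n_gt0 jN) => //; rewrite -/(Nminus _ _ _); lia.
rewrite -[a]add0n -[b]add0n; apply: ordM.
  rewrite (_ : (fun x => _) = horner (- be)); first exact: ord_poly.
  by apply/funext => x; rewrite hornerN.
have jN : (j1 < NB p r.+1 n)%N by rewrite NB_plus; lia.
apply: ord_le (ord_derive1 (Bs_ord rp1 n_gt0 jN)) => //.
by rewrite NB_plus; lia.
Qed.

Lemma eA_edge j1 j2 : (3 <= j1 + j2)%N -> (j1 + 3 <= Nminus p r n)%N ->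
  ord delta 3 3 (eA j1 j2).
Proof. by move=> j3 jN; apply: ord_eA => j2E; lia. Qed.

Lemma eB_edge be al j1 j2 : (j2 <= 1)%N -> (3 <= j1 + j2)%N ->
  (j1 + 3 <= Nminus p r n)%N -> ord delta 2 2 (eB be al j1 j2).
Proof. by move=> j21 j3 jN; apply: ord_eB => j2E; lia. Qed.

(** This is where [Nminus >= 5] enters: for [j2 = 0] the order at the far end is [Nminus - j1] with
    [j1 <= 2], and it has to be at least 3. *)
Lemma eA_low j1 j2 : (j1 + j2 <= 2)%N -> ord delta 0 3 (eA j1 j2).
Proof. by move=> j3; apply: ord_eA => j2E; lia. Qed.

Lemma eB_low be al j1 j2 : (j1 + j2 <= 2)%N -> ord delta 0 2 (eB be al j1 j2).
Proof. by move=> j3; apply: ord_eB => j2E; lia. Qed.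

End EdgeForms.

(** * Uniqueness and linearity of Hermite projections *)

Section HermiteProjections.
Context {R : realType} (D : multipatch R) (delta : R).
Hypothesis delta_gt0 : 0 < delta.
Implicit Types (u v : mfun D) (a b : frame D) (phi : patch D -> R * R -> R).

Lemma pull_on_patch a b g : pull (on_patch b g) a =
  if a.1 == b.1 then g \o iter ((4 - b.2) + a.2) rot else (fun=> 0).
Proof.
apply/funext => z; rewrite /pull /on_patch.
by case: eqP => // _; rewrite /= -iterD.
Qed.

Lemma pull_on_patch_id a g : pull (on_patch a g) a = g.
Proof.
rewrite pull_on_patch eqxx; apply/funext => z.
by rewrite /= subnK ?(ltnW (ltn_ord _)) // -[iter _ _ _]/(iter 4 rot z) rot4.
Qed.

Lemma pull_on_patch_neq a b g : a.1 != b.1 -> pull (on_patch b g) a = fun=> 0.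
Proof. by rewrite pull_on_patch => /negPf ->. Qed.

(** Partial derivatives are additive only on differentiable functions; being polynomial near every
    corner supplies this. *)
Definition lp u := forall a, exists P, locp delta (pull u a) P.

Definition dpull a m1 m2 u := dmix m1 m2 (pull u a) (0, 0).

Lemma lp_lin (K : finType) (c : K -> R) (u : K -> mfun D) :
  (forall k, lp (u k)) -> lp (\sum_k c k *: u k).
Proof.
move=> H a; have [P HP] := choice (fun k => H k a).
exists (\sum_k (c k)%:P%:P * P k) => z z1 z2.
rewrite /pull !fct_sumE -[RHS]/(horner_eval z.2 (horner_eval z.1%:P _)).
rewrite !raddf_sum; apply: eq_bigr => k _.
by rewrite /= !horner_evalE !hornerM !hornerC -HP.
Qed.

Lemma dpull_lin (K : finType) (c : K -> R) (u : K -> mfun D) a m1 m2 :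
  (forall k, lp (u k)) ->
  dpull a m1 m2 (\sum_k c k *: u k) = \sum_k c k * dpull a m1 m2 (u k).
Proof.
move=> H; have [P HP] := choice (fun k => H k a).
have HS : locp delta (pull (\sum_k c k *: u k) a) (\sum_k (c k)%:P%:P * P k).
  move=> z z1 z2.
  rewrite /pull !fct_sumE -[RHS]/(horner_eval z.2 (horner_eval z.1%:P _)).
  rewrite !raddf_sum; apply: eq_bigr => k _.
  by rewrite /= !horner_evalE !hornerM !hornerC -HP.
rewrite /dpull (dmix_locp delta_gt0 m1 m2 HS) !coef_sum mulr_suml.
apply: eq_bigr => k _.
by rewrite (dmix_locp delta_gt0 m1 m2 (HP k)) !coefCM mulrA.
Qed.

Lemma lspan_lin (V : lmodType R) (J K : finType) (e : J -> V) (c : K -> R)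
    (u : K -> V) : (forall k, lspan e (u k)) -> lspan e (\sum_k c k *: u k).
Proof.
move=> /choice[d Ed]; exists (fun j => \sum_k c k * d k j).
under eq_bigr do rewrite Ed scaler_sumr.
rewrite exchange_big; apply: eq_bigr => j _ /=; rewrite scaler_suml.
by apply: eq_bigr => k _; rewrite scalerA.
Qed.

Definition hermite_match (C : frame D -> nat -> nat -> Prop) phi u :=
  forall a m1 m2, C a m1 m2 ->
    dpull a m1 m2 u = dmix m1 m2 (phi a.1 \o fparam a) (0, 0).

Variables (J : finType) (e : J -> mfun D) (C : frame D -> nat -> nat -> Prop).
Hypotheses (e_lp : forall j, lp (e j))
  (e_uniq : forall u, lspan e u -> (forall a m1 m2, C a m1 m2 -> dpull a m1 m2 u = 0)
     -> u = 0).

(** The default value of [xget] carries no information, so every property of a projection rests on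
    the existence of some interpolant. *)
Lemma hermite_projP phi : (exists2 u, lspan e u & hermite_match C phi u) ->
  lspan e (hermite_proj (lspan e) C phi) /\
  hermite_match C phi (hermite_proj (lspan e) C phi).
Proof.
move=> [u Su Hu]; have /(xgetPex 0)[] : exists u, lspan e u /\ forall a m1 m2,
    C a m1 m2 -> dmix m1 m2 (pull u a) (0, 0) = dmix m1 m2 (phi a.1 \o fparam a) (0, 0).
  by exists u.
by [].
Qed.

Lemma lspan_lp u : lspan e u -> lp u.
Proof. by move=> [c ->]; exact: lp_lin. Qed.

Lemma hermite_proj_uniq phi u : lspan e u -> hermite_match C phi u ->
  hermite_proj (lspan e) C phi = u.
Proof.
move=> Su Hu; have [] := hermite_projP (ex_intro2 _ _ u Su Hu).
set v := hermite_proj _ _ _ => Sv Hv; apply/eqP; rewrite -subr_eq0; apply/eqP.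
pose w (k : bool) := if k then v else u.
have -> : v - u = \sum_k (if k then 1 else -1) *: w k.
  by rewrite big_bool /= scale1r scaleN1r.
have Sw k : lspan e (w k) by case: k.
apply: e_uniq; first exact: lspan_lin.
move=> a m1 m2 Ca; rewrite dpull_lin => [|k]; last exact/lspan_lp.
by rewrite big_bool /= Hv // Hu // mul1r mulN1r subrr.
Qed.

(** Both sides solve the same uniquely solvable problem. Only the derivatives selected by [C]
    matter, so [chi] need not be the combination of the [phi k] as a function. *)
Lemma hermite_proj_lin (K : finType) (c : K -> R) (phi : K -> _) chi :
  (forall k, exists2 u, lspan e u & hermite_match C (phi k) u) ->
  (forall a m1 m2, C a m1 m2 -> dmix m1 m2 (chi a.1 \o fparam a) (0, 0) =
     \sum_k c k * dmix m1 m2 (phi k a.1 \o fparam a) (0, 0)) ->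
  hermite_proj (lspan e) C chi =
  \sum_k c k *: hermite_proj (lspan e) C (phi k).
Proof.
move=> Hex E; apply: hermite_proj_uniq.
  by apply: lspan_lin => k; have [] := hermite_projP (Hex k).
move=> a m1 m2 Ca; rewrite E // dpull_lin; last first.
  by move=> k; apply/lspan_lp; have [] := hermite_projP (Hex k).
by apply: eq_bigr => k _; have [_ ->] := hermite_projP (Hex k).
Qed.

End HermiteProjections.

Section LowSpans.
Context {R : realType} (D : multipatch R) (p r n : nat).
Hypotheses (r_gt0 : (0 < r)%N) (rp : (r + 2 <= p)%N) (n_gt0 : (0 < n)%N)
  (N5 : (5 <= Nminus p r n)%N).
Implicit Types (a b : frame D) (c : nat -> nat -> R).

Let delta : R := n%:R^-1.
Let pn : R := p%:R * n%:R.
Let delta_gt0 : 0 < delta.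
Proof. by rewrite invr_gt0 ltr0n. Qed.
Let rp0 : (r < p)%N. Proof. lia. Qed.
Let rp1 : (r.+1 < p)%N. Proof. lia. Qed.
Let rp2 : (r < p.-1)%N. Proof. lia. Qed.
Let pn_neq0 : pn != 0.
Proof. by rewrite mulf_neq0 // pnatr_eq0; lia. Qed.

Lemma on_patchD a g h :
  on_patch a g + on_patch a h = on_patch a (fun z => g z + h z) :> mfun D.
Proof.
apply/funext => i; apply/funext => z; rewrite /GRing.add /= /on_patch.
by case: eqP => // _; rewrite addr0.
Qed.

Lemma on_patchZ a g k :
  k *: on_patch a g = on_patch a (fun z => k * g z) :> mfun D.
Proof.
apply/funext => i; apply/funext => z; rewrite /GRing.scale /= /on_patch.
by case: eqP => // _; rewrite scaler0.
Qed.

Lemma inter_funE a b j1 j2 : inter_fun p r n a b j1 j2 =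
  on_patch a (lf p r n (eA p r n j1 j2) (eB p r n (be1 (gdata a b)) (al1 (gdata a b)) j1 j2)) +
  on_patch b (bf p r n (eA p r n j1 j2)
    (eB p r n (be2 (gdata a b)) (- al2 (gdata a b)) j1 j2)).
Proof.
rewrite /inter_fun /lf /bf /eA /eB.
case: eqP => _; congr (on_patch _ _ + on_patch _ _); apply/funext => z.
- by rewrite mulNr mulNr.
- by rewrite mulNr mulNr.
- by rewrite (Bs1_c1 r_gt0 rp n_gt0 N5) mul0r add0r; ring.
- by rewrite (Bs1_c1 r_gt0 rp n_gt0 N5) mul0r add0r hornerN; ring.
Qed.

Lemma left_funE a j1 j2 :
  left_fun p r n a j1 j2 = on_patch a (lf p r n (eA p r n j1 j2) (eB p r n 0 1 j1 j2)).
Proof.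
rewrite /left_fun /lf /eA /eB; congr on_patch.
apply/funext => z; case: eqP => _; first by rewrite horner0 oppr0 !mul0r addr0.
by rewrite (Bs1_c1 r_gt0 rp n_gt0 N5) mul0r add0r hornerC; ring.
Qed.

Lemma bottom_funE a j1 j2 :
  bottom_fun p r n a j1 j2 = on_patch a (bf p r n (eA p r n j1 j2) (eB p r n 0 1 j1 j2)).
Proof.
rewrite /bottom_fun /bf /eA /eB; congr on_patch.
apply/funext => z; case: eqP => _; first by rewrite horner0 oppr0 !mul0r addr0.
by rewrite (Bs1_c1 r_gt0 rp n_gt0 N5) mul0r add0r hornerC; ring.
Qed.

Definition lowA c x := low_sum (fun j1 j2 => c j1 j2 * eA p r n j1 j2 x : R^o).
Definition lowB be al c x :=
  low_sum (fun j1 j2 => c j1 j2 * eB p r n be al j1 j2 x : R^o).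

(** Near the vertex [fpol c] is the trace of the combination and [ngpol be al c] its normal
    derivative: the tangential derivative times [- be], plus a free part [gpol c] weighted by
    [al]. *)
Definition fpol c : {poly R} :=
  c 0%N 0%N *: BP p r n 0 + c 1%N 0%N *: BP p r n 1 + c 2%N 0%N *: BP p r n 2.
Definition gpol c : {poly R} :=
  c 0%N 1%N *: BM p r n 0 + c 1%N 1%N *: BM p r n 1.
Definition ngpol (be al : {poly R}) c : {poly R} :=
  - be * (fpol c)^`() + pn *: (al * gpol c).

Lemma lowA_near c x : x < delta -> lowA c x = (fpol c).[x].
Proof.
move=> xd; rewrite /lowA /low_sum !(eA_near r_gt0 rp n_gt0 N5 _ _ xd) /eApol /=.
by rewrite !horner0 !mulr0 !addr0 !hornerD !hornerZ.
Qed.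

Lemma lowB_near be al c x : x < delta -> lowB be al c x = (ngpol be al c).[x].
Proof.
move=> xd; rewrite /lowB /low_sum !(eB_near r_gt0 rp n_gt0 N5 _ _ _ _ xd) /eBpol /=.
rewrite /ngpol /fpol /gpol !derivD !derivZ.
rewrite !(hornerD, hornerZ, hornerM, hornerN) -/pn; ring.
Qed.

Lemma lowA_ord c : ord delta 0 3 (lowA c).
Proof. by do 4?apply: ordD; apply: ordZ; exact: (eA_low r_gt0 rp n_gt0 N5). Qed.

Lemma lowB_ord be al c : ord delta 0 2 (lowB be al c).
Proof. by do 4?apply: ordD; apply: ordZ; exact: (eB_low r_gt0 rp n_gt0 N5). Qed.

Lemma low_spanP (e : nat -> nat -> mfun D) u : low_span e u <->
  exists c, u = low_sum (fun j1 j2 => c j1 j2 *: e j1 j2).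
Proof.
split=> [[c ->]|[c ->]]; last first.
  exists (fun j : low_ix => c (val j).1 (val j).2).
  by rewrite -(big_low_ix (fun j1 j2 => c j1 j2 *: e j1 j2)).
pose c' j1 j2 := \sum_(j : low_ix | ((val j).1 == j1 :> nat) && ((val j).2 == j2 :> nat)) c j.
exists c'; rewrite -(big_low_ix (fun j1 j2 => c' j1 j2 *: e j1 j2)).
apply: eq_bigr => j _; by rewrite /c' (big_pred1 j).
Qed.

Lemma inter_low_span a b u : low_span (inter_fun p r n a b) u <-> exists c,
  u = on_patch a (lf p r n (lowA c) (lowB (be1 (gdata a b)) (al1 (gdata a b)) c)) +
      on_patch b (bf p r n (lowA c) (lowB (be2 (gdata a b)) (- al2 (gdata a b)) c)).
Proof.
suff E c : low_sum (fun j1 j2 => c j1 j2 *: inter_fun p r n a b j1 j2) =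
  on_patch a (lf p r n (lowA c) (lowB (be1 (gdata a b)) (al1 (gdata a b)) c)) +
      on_patch b (bf p r n (lowA c) (lowB (be2 (gdata a b)) (- al2 (gdata a b)) c)).
  by split=> [/low_spanP[c ->]|[c ->]]; [exists c|apply/low_spanP; exists c].
rewrite /low_sum !inter_funE !scalerDr !on_patchZ.
rewrite [LHS](AC (2*2*2*2*2) ((1*3*5*7*9)*(2*4*6*8*10))) /= !on_patchD.
by congr (on_patch _ _ + on_patch _ _); apply/funext => z;
  rewrite /lf /bf /lowA /lowB /low_sum; ring.
Qed.

Lemma left_low_span a u : low_span (left_fun p r n a) u <-> exists c,
  u = on_patch a (lf p r n (lowA c) (lowB 0 1 c)).
Proof.
suff E c : low_sum (fun j1 j2 => c j1 j2 *: left_fun p r n a j1 j2) =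
    on_patch a (lf p r n (lowA c) (lowB 0 1 c)).
  by split=> [/low_spanP[c ->]|[c ->]]; [exists c|apply/low_spanP; exists c].
rewrite /low_sum !left_funE !on_patchZ !on_patchD; congr on_patch.
by apply/funext => z; rewrite /lf /lowA /lowB /low_sum; ring.
Qed.

Lemma bottom_low_span a u : low_span (bottom_fun p r n a) u <-> exists c,
  u = on_patch a (bf p r n (lowA c) (lowB 0 1 c)).
Proof.
suff E c : low_sum (fun j1 j2 => c j1 j2 *: bottom_fun p r n a j1 j2) =
    on_patch a (bf p r n (lowA c) (lowB 0 1 c)).
  by split=> [/low_spanP[c ->]|[c ->]]; [exists c|apply/low_spanP; exists c].
rewrite /low_sum !bottom_funE !on_patchZ !on_patchD; congr on_patch.
by apply/funext => z; rewrite /bf /lowA /lowB /low_sum; ring.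
Qed.

Lemma BP_low j l : (l < j)%N -> (BP p r n j)`_l = 0 :> R.
Proof. by move=> lj; exact: Bpol_low. Qed.

Lemma BM_low j l : (l < j)%N -> (BM p r n j)`_l = 0 :> R.
Proof. by move=> lj; exact: Bpol_low. Qed.

Lemma BP_lead j : (j <= 2)%N -> (BP p r n j)`_j != 0 :> R.
Proof. by move=> j2; rewrite gt_eqF // Bpol_lead //; lia. Qed.

Lemma BM_lead j : (j <= 1)%N -> (BM p r n j)`_j != 0 :> R.
Proof. by move=> j2; rewrite gt_eqF // Bpol_lead //; lia. Qed.

Lemma coef_ngpol0 (be al : {poly R}) c : (ngpol be al c)`_0 =
  - be`_0 * (fpol c)`_1 + pn * (al`_0 * (gpol c)`_0).
Proof.
rewrite coefD coefZ !coefM !big_ord_recl !big_ord0 /= coefN coef_deriv.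
by rewrite mulr1n !addr0.
Qed.

Lemma coef_ngpol1 (be al : {poly R}) c : (ngpol be al c)`_1 =
  - be`_0 * (2 * (fpol c)`_2) - be`_1 * (fpol c)`_1
  + pn * (al`_0 * (gpol c)`_1 + al`_1 * (gpol c)`_0).
Proof.
rewrite coefD coefZ !coefM !big_ord_recl !big_ord0 /= /bump /= !coefN !coef_deriv.
by rewrite mulr1n !addr0 mulr_natl mulNr [- _ * (fpol c)`_1]mulNr.
Qed.

(** A triangular system. As [b^+_j] starts at degree [j], the 2-jet of the trace kills the
    coefficients with [j2 = 0] one after the other; then, [al] being nonzero at the vertex, the
    1-jet of the normal derivative kills those with [j2 = 1]. *)
Lemma ngpol_inj (be al : {poly R}) c : al`_0 != 0 ->
  (forall m, (m <= 2)%N -> (fpol c)`_m = 0) ->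
  (ngpol be al c)`_0 = 0 -> (ngpol be al c)`_1 = 0 ->
  [/\ c 0%N 0%N = 0, c 1%N 0%N = 0, c 2%N 0%N = 0, c 0%N 1%N = 0 & c 1%N 1%N = 0].
Proof.
move=> al0 f0; rewrite coef_ngpol0 coef_ngpol1 !f0 // !(mulr0, add0r, subr0).
have K x : pn * (al`_0 * x) = 0 -> x = 0.
  by move/(canRL (mulKf pn_neq0)); rewrite mulr0 => /(canRL (mulKf al0)); rewrite mulr0.
move=> /K g0; rewrite g0 mulr0 addr0 oppr0 add0r => /K g1.
have c00 : c 0%N 0%N = 0.
  have /eqP := f0 0%N isT; rewrite !coefD !coefZ ![(BP _ _ _ _.+1)`_0]BP_low //.
  by rewrite !mulr0 !addr0 mulf_eq0 (negPf (BP_lead _)) // orbF => /eqP.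
have c10 : c 1%N 0%N = 0.
  have /eqP := f0 1%N isT; rewrite !coefD !coefZ c00 [(BP _ _ _ 2)`_1]BP_low //.
  by rewrite mul0r !mulr0 !addr0 add0r mulf_eq0 (negPf (BP_lead _)) // orbF => /eqP.
have c20 : c 2%N 0%N = 0.
  have /eqP := f0 2%N isT; rewrite !coefD !coefZ c00 c10.
  by rewrite !mul0r !add0r mulf_eq0 (negPf (BP_lead _)) // orbF => /eqP.
have c01 : c 0%N 1%N = 0.
  move/eqP: g0; rewrite !coefD !coefZ [(BM _ _ _ 1)`_0]BM_low //.
  by rewrite mulr0 addr0 mulf_eq0 (negPf (BM_lead _)) // orbF => /eqP.
have c11 : c 1%N 1%N = 0.
  move/eqP: g1; rewrite !coefD !coefZ c01.
  by rewrite mul0r add0r mulf_eq0 (negPf (BM_lead _)) // orbF => /eqP.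
by [].
Qed.

Lemma ngpol_surj (be al : {poly R}) (f0 f1 f2 h0 h1 : R) : al`_0 != 0 -> exists c,
  [/\ (fpol c)`_0 = f0, (fpol c)`_1 = f1, (fpol c)`_2 = f2,
      (ngpol be al c)`_0 = h0 & (ngpol be al c)`_1 = h1].
Proof.
move=> al0.
have l0 := BP_lead (isT : (0 <= 2)%N); have l1 := BP_lead (isT : (1 <= 2)%N).
have l2 := BP_lead (isT : (2 <= 2)%N).
have m0 := BM_lead (isT : (0 <= 1)%N); have m1 := BM_lead (isT : (1 <= 1)%N).
(* The scalars [g0] and [g1] are the 1-jet that [gpol] must have, found by solving the formulas for
   the coefficients of [ngpol]. The five unknowns below come from forward substitution. *)
pose g0 := (h0 + be`_0 * f1) / pn / al`_0.
pose g1 := ((h1 + be`_0 * (2 * f2) + be`_1 * f1) / pn - al`_1 * g0) / al`_0.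
pose c00 := f0 / (BP p r n 0)`_0.
pose c10 := (f1 - c00 * (BP p r n 0)`_1) / (BP p r n 1)`_1.
pose c20 := (f2 - c00 * (BP p r n 0)`_2 - c10 * (BP p r n 1)`_2) / (BP p r n 2)`_2.
pose c01 := g0 / (BM p r n 0)`_0.
pose c11 := (g1 - c01 * (BM p r n 0)`_1) / (BM p r n 1)`_1.
pose c (j1 j2 : nat) := if j2 == 0%N then (if j1 == 0%N then c00 else
   if j1 == 1%N then c10 else c20) else if j1 == 0%N then c01 else c11.
have F0 : (fpol c)`_0 = f0.
  rewrite !coefD !coefZ ![(BP _ _ _ _.+1)`_0]BP_low // !mulr0 !addr0.
  by rewrite /c /= /c00 divfK.
have F1 : (fpol c)`_1 = f1.
  rewrite !coefD !coefZ [(BP _ _ _ 2)`_1]BP_low // !mulr0 !addr0 /c /= /c10 divfK //.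
  by rewrite addrC subrK.
have F2 : (fpol c)`_2 = f2.
  by rewrite !coefD !coefZ /c /= /c20 divfK //; ring.
have G0 : (gpol c)`_0 = g0.
  rewrite !coefD !coefZ [(BM _ _ _ 1)`_0]BM_low // mulr0 addr0.
  by rewrite /c /= /c01 divfK.
have G1 : (gpol c)`_1 = g1.
  by rewrite !coefD !coefZ /c /= /c11 divfK // addrC subrK.
exists c; split=> //; rewrite ?coef_ngpol0 ?coef_ngpol1 ?F1 ?F2 G0 ?G1.
  by rewrite /g0; move: pn_neq0 al0 => ? ?; field; apply/andP.
by rewrite /g1; move: pn_neq0 al0 => ? ?; field; apply/andP.
Qed.

(* al2 (ngpol be1 al1) + al1 (ngpol be2 (- al2)) + (al1 be2 + al2 be1) f' = 0 *)
Lemma ngpol_compat (be1 be2 al1 al2 : {poly R}) c (w0 w1 : R) :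
  al1`_0 != 0 ->
  let be := al1 * be2 + al2 * be1 in
  let f := fpol c in let h := ngpol be1 al1 c in
  al1`_0 * w0 + al2`_0 * h`_0 + be`_0 * f`_1 = 0 ->
  al1`_1 * w0 + al1`_0 * w1 + al2`_1 * h`_0 + al2`_0 * h`_1 + be`_1 * f`_1
    + be`_0 * (2 * f`_2) = 0 ->
  (ngpol be2 (- al2) c)`_0 = w0 /\ (ngpol be2 (- al2) c)`_1 = w1.
Proof.
move=> al0 be f h.
have b0 : be`_0 = al1`_0 * be2`_0 + al2`_0 * be1`_0.
  by rewrite /be coefD !coefM !big_ord_recl !big_ord0 /= !addr0.
have b1 : be`_1 = al1`_0 * be2`_1 + al1`_1 * be2`_0
    + (al2`_0 * be1`_1 + al2`_1 * be1`_0).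
  by rewrite /be coefD !coefM !big_ord_recl !big_ord0 /= /bump /= !addr0.
rewrite /h b0 b1 !coef_ngpol0 !coef_ngpol1 !coefN -/f.
move: (gpol c)`_0 (gpol c)`_1 (f`_1) (f`_2) => g0 g1 f1 f2 E0 E1.
have e0 : - be2`_0 * f1 + pn * (- al2`_0 * g0) = w0.
  apply: (mulfI al0); apply/eqP; rewrite -subr_eq0 -oppr_eq0; apply/eqP.
  by rewrite -[RHS]E0; ring.
split=> //; apply: (mulfI al0); apply/eqP; rewrite -subr_eq0 -oppr_eq0; apply/eqP.
rewrite -[RHS]E1 -e0; ring.
Qed.

End LowSpans.

Section VertexPieces.
Context {R : realType} (D : multipatch R) (p r n : nat).
Hypotheses (r_gt0 : (0 < r)%N) (rp : (r + 2 <= p)%N) (n_gt0 : (0 < n)%N)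
  (N5 : (5 <= Nminus p r n)%N).
Implicit Types (a b : frame D) (phi : patch D -> R * R -> R) (U : nat -> nat -> R)
  (c : nat -> nat -> R) (be al : {poly R}).

Let delta : R := n%:R^-1.
Let delta_gt0 : 0 < delta.
Proof. by rewrite invr_gt0 ltr0n. Qed.

Definition pullback_jet phi a (m1 m2 : nat) : R :=
  dmix m1 m2 (phi a.1 \o fparam a) (0, 0).

(** The Hermite conditions on the left side, with [q1] the trace and [q2] the normal derivative.
    Here [U] holds derivatives instead of coefficients, whence the factor 2; the bottom side is
    reached by transposing [U]. *)
Definition ljet (q1 q2 : {poly R}) U :=
  [/\ q1`_0 = U 0%N 0%N, q1`_1 = U 0%N 1%N, q1`_2 * 2 = U 0%N 2%N,
      q2`_0 = U 1%N 0%N & q2`_1 = U 1%N 1%N].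

Definition transpose U m1 m2 := U m2 m1.

Lemma ljetP q1 q2 U : ljet q1 q2 U <-> forall m1 m2, (m1 + m2 <= 2)%N -> (m1 <= 1)%N ->
  (lfpol p r n q1 q2)`_m1`_m2 * (m1`! * m2`!)%:R = U m1 m2.
Proof.
have L0 := coef0_lfpol r_gt0 rp n_gt0 N5 q1 q2.
have L1 := coef1_lfpol r_gt0 rp n_gt0 N5 q1 q2.
split=> [[E0 E1 E2 F0 F1] [|[|m1]] [|[|[|m2]]] //= _ _|H].
- by rewrite L0 mulr1.
- by rewrite L0 mulr1.
- by rewrite L0.
- by rewrite L1 mulr1.
- by rewrite L1 mulr1.
split.
- by rewrite -(H 0 0)%N // L0 mulr1.
- by rewrite -(H 0 1)%N // L0 mulr1.
- by rewrite -(H 0 2)%N // L0.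
- by rewrite -(H 1 0)%N // L1 mulr1.
- by rewrite -(H 1 1)%N // L1 mulr1.
Qed.

Lemma dmix_lf A1 A2 q1 q2 m1 m2 : (forall x, x < delta -> A1 x = q1.[x]) ->
  (forall x, x < delta -> A2 x = q2.[x]) ->
  dmix m1 m2 (lf p r n A1 A2) (0, 0) =
  (lfpol p r n q1 q2)`_m1`_m2 * (m1`! * m2`!)%:R.
Proof.
by move=> E1 E2; exact: (dmix_locp delta_gt0 _ _ (lf_locp r_gt0 rp n_gt0 N5 E1 E2)).
Qed.

Lemma dmix_bf A1 A2 q1 q2 m1 m2 : (forall x, x < delta -> A1 x = q1.[x]) ->
  (forall x, x < delta -> A2 x = q2.[x]) ->
  dmix m1 m2 (bf p r n A1 A2) (0, 0) =
  (lfpol p r n q1 q2)`_m2`_m1 * (m2`! * m1`!)%:R.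
Proof.
move=> E1 E2; rewrite -coef_swapXY mulnC.
exact: (dmix_locp delta_gt0 _ _ (bf_locp r_gt0 rp n_gt0 N5 E1 E2)).
Qed.

Lemma lp_on_patch K b h : sepsum delta K h -> lp delta (on_patch b h : mfun D).
Proof.
move=> Hh a; rewrite pull_on_patch; case: ifP => _; last first.
  by exists 0 => z _ _; rewrite !horner0.
by have [P HP _] := sepsum_locp delta_gt0 (sepsum_mod (4 - b.2 + a.2) Hh); exists P.
Qed.

Lemma lpD (u v : mfun D) : lp delta u -> lp delta v -> lp delta (u + v).
Proof.
move=> Hu Hv a; have [P HP] := Hu a; have [Q HQ] := Hv a; exists (P + Q).
exact: locpD HP HQ.
Qed.

Lemma lowLV be al c : sepsum delta Kvert (lf p r n (lowA p r n c) (lowB p r n be al c)).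
Proof.
exact: (lf_vert r_gt0 rp n_gt0 N5 (lowA_ord r_gt0 rp n_gt0 N5 c)
         (lowB_ord r_gt0 rp n_gt0 N5 be al c)).
Qed.

Lemma lowBV be al c : sepsum delta Kvert (bf p r n (lowA p r n c) (lowB p r n be al c)).
Proof.
exact: (bf_vert r_gt0 rp n_gt0 N5 (lowA_ord r_gt0 rp n_gt0 N5 c)
         (lowB_ord r_gt0 rp n_gt0 N5 be al c)).
Qed.

Lemma dmix_lowL be al c m1 m2 :
  dmix m1 m2 (lf p r n (lowA p r n c) (lowB p r n be al c)) (0, 0) =
  (lfpol p r n (fpol p r n c) (ngpol p r n be al c))`_m1`_m2 * (m1`! * m2`!)%:R.
Proof.
apply: dmix_lf => x xd; first exact: (lowA_near r_gt0 rp n_gt0 N5).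
exact: (lowB_near r_gt0 rp n_gt0 N5).
Qed.

Lemma dmix_lowB be al c m1 m2 :
  dmix m1 m2 (bf p r n (lowA p r n c) (lowB p r n be al c)) (0, 0) =
  (lfpol p r n (fpol p r n c) (ngpol p r n be al c))`_m2`_m1 * (m2`! * m1`!)%:R.
Proof.
apply: dmix_bf => x xd; first exact: (lowA_near r_gt0 rp n_gt0 N5).
exact: (lowB_near r_gt0 rp n_gt0 N5).
Qed.

Lemma low0 c : [/\ c 0%N 0%N = 0, c 1%N 0%N = 0, c 2%N 0%N = 0, c 0%N 1%N = 0
    & c 1%N 1%N = 0] ->
  lowA p r n c = (fun=> 0 : R) /\ forall be al, lowB p r n be al c = (fun=> 0 : R).
Proof.
move=> [E0 E1 E2 E3 E4]; split=> [|be al]; apply/funext => x;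
  by rewrite /lowA /lowB /low_sum E0 E1 E2 E3 E4 !mul0r !addr0.
Qed.

Lemma lf0 : lf p r n (fun=> 0) (fun=> 0) = (fun=> 0 : R).
Proof. by apply/funext => z; rewrite /lf !mul0r addr0. Qed.

Lemma bf0 : bf p r n (fun=> 0) (fun=> 0) = (fun=> 0 : R).
Proof. by apply/funext => z; rewrite /bf !mul0r addr0. Qed.

Lemma on_patch0 a : on_patch a (fun=> 0) = 0 :> mfun D.
Proof. by apply/funext => i; apply/funext => z; rewrite /on_patch; case: eqP. Qed.

Lemma ljet_low0 be al c : al`_0 != 0 ->
  ljet (fpol p r n c) (ngpol p r n be al c) (fun _ _ => 0) ->
  lowA p r n c = (fun=> 0 : R) /\ forall be al, lowB p r n be al c = (fun=> 0 : R).
Proof.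
move=> al0 [f0 f1 f2 g0 g1]; apply: low0.
apply: (ngpol_inj r_gt0 rp n_gt0 N5 al0 _ g0 g1) => -[|[|[|m]]] // _.
by apply/eqP; move/eqP: f2; rewrite mulf_eq0 pnatr_eq0 orbF.
Qed.

Section Interface.
Variables (a b : frame D).
Hypotheses (ab : a.1 != b.1) (al1_0 : (al1 (gdata a b))`_0 != 0).

Let g := gdata a b.
Let C (a' : frame D) (m1 m2 : nat) := (m1 + m2 <= 2)%N /\
  (a' = a /\ (m1 <= 1)%N \/ a' = b /\ (m2 <= 1)%N).
Let U0 : nat -> nat -> R := fun _ _ => 0.

Let interu c : mfun D :=
  on_patch a (lf p r n (lowA p r n c) (lowB p r n (be1 g) (al1 g) c)) +
  on_patch b (bf p r n (lowA p r n c) (lowB p r n (be2 g) (- al2 g) c)).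

Lemma inter_lp j : lp delta (inter_fun p r n a b (val (j : low_ix)).1 (val j).2).
Proof.
have [c ->] : exists c, inter_fun p r n a b (val j).1 (val j).2 = interu c.
  apply/(inter_low_span r_gt0 rp n_gt0 N5).
  exists (fun j' => (j' == j)%:R); rewrite (bigD1 j) //= eqxx scale1r big1 ?addr0 //.
  by move=> i /negPf ->; rewrite scale0r.
by apply: lpD; [exact: lp_on_patch (lowLV _ _ _)|exact: lp_on_patch (lowBV _ _ _)].
Qed.

Lemma pull_interu_a c : pull (interu c) a =
  lf p r n (lowA p r n c) (lowB p r n (be1 g) (al1 g) c).
Proof.
rewrite -[RHS](pull_on_patch_id a); apply/funext => z.
rewrite -[LHS]/(pull (on_patch a _) a z + pull (on_patch b _) a z).
by rewrite (pull_on_patch_neq _ ab) addr0.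
Qed.

Lemma pull_interu_b c : pull (interu c) b =
  bf p r n (lowA p r n c) (lowB p r n (be2 g) (- al2 g) c).
Proof.
rewrite -[RHS](pull_on_patch_id b); apply/funext => z.
rewrite -[LHS]/(pull (on_patch a _) b z + pull (on_patch b _) b z).
have ba : b.1 != a.1 by rewrite eq_sym.
by rewrite (pull_on_patch_neq _ ba) add0r.
Qed.

Lemma inter_match c Ua Ub :
  (forall a' m1 m2, C a' m1 m2 -> dpull a' m1 m2 (interu c) =
      if a' == a then Ua m1 m2 else Ub m1 m2) <->
  ljet (fpol p r n c) (ngpol p r n (be1 g) (al1 g) c) Ua /\
  ljet (fpol p r n c) (ngpol p r n (be2 g) (- al2 g) c) (transpose Ub).
Proof.
have ba : b == a = false by apply: contraNF ab => /eqP ->.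
split=> [H|[/ljetP Ha /ljetP Hb] a' m1 m2 [m12 [[-> m]|[-> m]]]].
- split; apply/ljetP => m1 m2 m12 m.
    rewrite -dmix_lowL -pull_interu_a.
    have E := H a m1 m2; rewrite eqxx in E; apply: E; split; first exact: m12.
    by left.
  rewrite -dmix_lowB -pull_interu_b.
  have E := H b m2 m1; rewrite ba in E; apply: E; split; first by rewrite addnC.
  by right.
- by rewrite eqxx /dpull pull_interu_a dmix_lowL Ha.
- by rewrite ba /dpull pull_interu_b dmix_lowB Hb // addnC.
Qed.

(** The conditions on the first patch alone determine all five coefficients. *)
Lemma inter_uniq u : low_span (inter_fun p r n a b) u ->
  (forall a' m1 m2, C a' m1 m2 -> dpull a' m1 m2 u = 0) -> u = 0.
Proof.
move=> /(inter_low_span r_gt0 rp n_gt0 N5)[c ->] H.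
have [/(ljet_low0 al1_0)[EA EB] _] : ljet (fpol p r n c) (ngpol p r n (be1 g) (al1 g) c) U0 /\
  ljet (fpol p r n c) (ngpol p r n (be2 g) (- al2 g) c) (transpose U0).
  by apply/inter_match => a' m1 m2 /H; rewrite if_same.
by rewrite EA !EB lf0 bf0 !on_patch0 addr0.
Qed.

(** What makes the ten conditions consistent: equal traces up to order 2 along the interface, then
    the gluing relation and its first derivative along the interface, both at the vertex. *)
Definition glue_compat (Ua Ub : nat -> nat -> R) :=
  let al := al1 g in let be := al1 g * be2 g + al2 g * be1 g in
  [/\ Ub 0%N 0%N = Ua 0%N 0%N, Ub 1%N 0%N = Ua 0%N 1%N, Ub 2%N 0%N = Ua 0%N 2%N,
   al`_0 * Ub 0%N 1%N + (al2 g)`_0 * Ua 1%N 0%N + be`_0 * Ua 0%N 1%N = 0 &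
   al`_1 * Ub 0%N 1%N + al`_0 * Ub 1%N 1%N + (al2 g)`_1 * Ua 1%N 0%N
   + (al2 g)`_0 * Ua 1%N 1%N + be`_1 * Ua 0%N 1%N + be`_0 * Ua 0%N 2%N = 0].

Lemma inter_solve Ua Ub : glue_compat Ua Ub -> exists c,
  ljet (fpol p r n c) (ngpol p r n (be1 g) (al1 g) c) Ua /\
  ljet (fpol p r n c) (ngpol p r n (be2 g) (- al2 g) c) (transpose Ub).
Proof.
move=> [E00 E10 E20 G0 G1].
have [c [f0 f1 f2 h0 h1]] := ngpol_surj r_gt0 rp n_gt0 N5 (be1 g)
  (Ua 0 0)%N (Ua 0 1)%N (Ua 0 2 / 2)%N (Ua 1 0)%N (Ua 1 1)%N al1_0.
have two : Ua 0%N 2%N / 2 * 2 = Ua 0%N 2%N by rewrite divfK // pnatr_eq0.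
have [k0 k1] : (ngpol p r n (be2 g) (- al2 g) c)`_0 = Ub 0%N 1%N /\
     (ngpol p r n (be2 g) (- al2 g) c)`_1 = Ub 1%N 1%N.
  apply: (ngpol_compat (be1 := be1 g) al1_0); rewrite h0 f1 // h1 f2.
  by rewrite [2 * _]mulrC two.
by exists c; split; split; rewrite ?f2 // ?f0 ?f1 ?two /transpose ?E00 ?E10 ?E20.
Qed.

Lemma inter_exists phi :
  glue_compat (pullback_jet phi a) (pullback_jet phi b) ->
  exists2 u, low_span (inter_fun p r n a b) u & hermite_match C phi u.
Proof.
move=> /inter_solve[c /inter_match H].
exists (interu c); first by apply/(inter_low_span r_gt0 rp n_gt0 N5); exists c.
move=> a' m1 m2 Ca; rewrite (H _ _ _ Ca); case: eqP => [->|na]; first reflexivity.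
by case: Ca => _ [[/na]|[->]].
Qed.

End Interface.
End VertexPieces.

(** * The three kinds of projections at a vertex *)

Section VertexProjections.
Context {R : realType} (D : multipatch R) (p r n : nat).
Hypotheses (r_gt0 : (0 < r)%N) (rp : (r + 2 <= p)%N) (n_gt0 : (0 < n)%N)
  (N5 : (5 <= Nminus p r n)%N).
Implicit Types (a b : frame D) (phi : patch D -> R * R -> R) (U : nat -> nat -> R)
  (c : nat -> nat -> R) (be al : {poly R}).

Let delta : R := n%:R^-1.
Let pn : R := p%:R * n%:R.
Let delta_gt0 : 0 < delta.
Proof. by rewrite invr_gt0 ltr0n. Qed.
Let rp0 : (r < p)%N. Proof. by apply: leq_trans rp; rewrite addn2. Qed.
Let p_gt0 : (0 < p)%N. Proof. exact: leq_ltn_trans rp0. Qed.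
Let pn_neq0 : pn != 0.
Proof. by rewrite mulf_neq0 // pnatr_eq0 -lt0n. Qed.
Let jet := @pullback_jet R D.

Definition low_left be al c := lf p r n (lowA p r n c) (lowB p r n be al c).
Definition low_bottom be al c := bf p r n (lowA p r n c) (lowB p r n be al c).

Lemma inter_proj_spec a b phi : a.1 != b.1 -> (al1 (gdata a b))`_0 != 0 ->
  glue_compat a b (jet phi a) (jet phi b) -> exists c,
  [/\ inter_proj p r n a b phi =
      on_patch a (low_left (be1 (gdata a b)) (al1 (gdata a b)) c) +
      on_patch b (low_bottom (be2 (gdata a b)) (- al2 (gdata a b)) c),
    ljet (fpol p r n c) (ngpol p r n (be1 (gdata a b)) (al1 (gdata a b)) c) (jet phi a)
  & ljet (fpol p r n c) (ngpol p r n (be2 (gdata a b)) (- al2 (gdata a b)) c)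
      (transpose (jet phi b))].
Proof.
move=> ab al0 Hc.
have [S M] := hermite_projP (inter_exists r_gt0 rp n_gt0 N5 ab al0 Hc).
move/(inter_low_span r_gt0 rp n_gt0 N5): (S) => [c E]; exists c.
rewrite E in M.
have [|H1 H2] := (inter_match r_gt0 rp n_gt0 N5 ab c (jet phi a) (jet phi b)).1.
  move=> a' m1 m2 Ca; rewrite (M _ _ _ Ca); case: eqP => [->|na]; first reflexivity.
  by case: Ca => _ [[/na]|[->]].
by split.
Qed.

Lemma inter_proj_lin a b (K : finType) (c : K -> R) (phi : K -> _) chi :
  a.1 != b.1 -> (al1 (gdata a b))`_0 != 0 ->
  (forall k, glue_compat a b (jet (phi k) a) (jet (phi k) b)) ->
  (forall a' m1 m2, (m1 + m2 <= 2)%N -> a' = a \/ a' = b ->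
     jet chi a' m1 m2 = \sum_k c k * jet (phi k) a' m1 m2) ->
  inter_proj p r n a b chi = \sum_k c k *: inter_proj p r n a b (phi k).
Proof.
move=> ab al0 Hc E.
apply: (hermite_proj_lin delta_gt0 (fun j => inter_lp r_gt0 rp n_gt0 N5 a b j)).
- exact: (inter_uniq r_gt0 rp n_gt0 N5 ab al0).
- by move=> k; exact: (inter_exists r_gt0 rp n_gt0 N5 ab al0).
- move=> a' m1 m2 [m12 H]; apply: E => //.
  by case: H => -[-> _]; [left|right].
Qed.

Lemma on_patch_lp K a h : sepsum delta K h -> lp delta (on_patch a h : mfun D).
Proof. exact: lp_on_patch. Qed.

Section Single.
Variables (a : frame D) (e : nat -> nat -> mfun D) (side : bool).

(* side = true is the left side, side = false the bottom one *)
Let form c := if side then low_left 0 1 c else low_bottom 0 1 c.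
Hypothesis e_form : forall u, low_span e u <-> exists c, u = on_patch a (form c).
Let C (a' : frame D) (m1 m2 : nat) :=
  a' = a /\ (m1 + m2 <= 2)%N /\ ((if side then m1 else m2) <= 1)%N.
Let tr U := if side then U else transpose U.

Let form_sep c : sepsum delta Kvert (form c).
Proof. by rewrite /form; case: side; [exact: lowLV|exact: lowBV]. Qed.

Lemma single_lp (j : low_ix) : lp delta (e (val j).1 (val j).2).
Proof.
have [c ->] : exists c, e (val j).1 (val j).2 = on_patch a (form c).
  apply/e_form; exists (fun j' => (j' == j)%:R).
  rewrite (bigD1 j) //= eqxx scale1r big1 ?addr0 //.
  by move=> i /negPf ->; rewrite scale0r.
exact: on_patch_lp (form_sep c).
Qed.

Lemma single_match c U :
  (forall a' m1 m2, C a' m1 m2 -> dpull a' m1 m2 (on_patch a (form c)) = U m1 m2) <->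
  ljet (fpol p r n c) (ngpol p r n 0 1 c) (tr U).
Proof.
rewrite /C /tr /form; case: side; split=> [H|/(ljetP r_gt0 rp n_gt0 N5) H].
- apply/(ljetP r_gt0 rp n_gt0 N5) => m1 m2 m12 m.
  rewrite -(dmix_lowL r_gt0 rp n_gt0 N5) -(H a m1 m2) //.
  by rewrite /dpull pull_on_patch_id.
- move=> a' m1 m2 [-> [m12 m]]; rewrite /dpull pull_on_patch_id.
  by rewrite (dmix_lowL r_gt0 rp n_gt0 N5) H.
- apply/(ljetP r_gt0 rp n_gt0 N5) => m1 m2 m12 m.
  rewrite -(dmix_lowB r_gt0 rp n_gt0 N5) /transpose -(H a m2 m1); last by rewrite addnC.
  by rewrite /dpull pull_on_patch_id.
- move=> a' m1 m2 [-> [m12 m]]; rewrite /dpull pull_on_patch_id.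
  by rewrite (dmix_lowB r_gt0 rp n_gt0 N5) H // addnC.
Qed.

Let one0 : (1 : {poly R})`_0 != 0.
Proof. by rewrite coefC oner_neq0. Qed.

Lemma single_uniq u : low_span e u ->
  (forall a' m1 m2, C a' m1 m2 -> dpull a' m1 m2 u = 0) -> u = 0.
Proof.
move=> /e_form[c ->] H.
have /(ljet_low0 r_gt0 rp n_gt0 N5 one0)[EA EB] :
    ljet (fpol p r n c) (ngpol p r n 0 1 c) (fun _ _ => 0).
  have /single_match : forall a' m1 m2, C a' m1 m2 ->
    dpull a' m1 m2 (on_patch a (form c)) = (fun _ _ => 0 : R) m1 m2 by [].
  by rewrite /tr; case: side.
rewrite /form /low_left /low_bottom EA EB; case: side.
  by rewrite lf0 on_patch0.
by rewrite bf0 on_patch0.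
Qed.

Lemma single_exists phi : exists2 u, low_span e u & hermite_match C phi u.
Proof.
have H (U : nat -> nat -> R) : exists c, ljet (fpol p r n c) (ngpol p r n 0 1 c) U.
  have [c [f0 f1 f2 h0 h1]] := ngpol_surj r_gt0 rp n_gt0 N5 0
    (U 0 0)%N (U 0 1)%N (U 0 2 / 2)%N (U 1 0)%N (U 1 1)%N one0.
  by exists c; split; rewrite // f2 divfK // pnatr_eq0.
have [c /single_match Hc] := H (tr (jet phi a)).
exists (on_patch a (form c)); first by apply/e_form; exists c.
by move=> a' m1 m2 Ca; rewrite (Hc _ _ _ Ca); case: Ca => ->.
Qed.

Lemma single_spec phi : exists2 c,
  hermite_proj (low_span e) C phi = on_patch a (form c) &
  ljet (fpol p r n c) (ngpol p r n 0 1 c) (tr (jet phi a)).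
Proof.
have [S M] := hermite_projP (single_exists phi).
move/e_form: (S) => [c E]; exists c => //; rewrite E in M.
apply/single_match => a' m1 m2 Ca; rewrite (M _ _ _ Ca).
by case: Ca => ->.
Qed.

Lemma single_lin (K : finType) (c : K -> R) (phi : K -> _) chi :
  (forall m1 m2, (m1 + m2 <= 2)%N ->
     jet chi a m1 m2 = \sum_k c k * jet (phi k) a m1 m2) ->
  hermite_proj (low_span e) C chi =
    \sum_k c k *: hermite_proj (low_span e) C (phi k).
Proof.
move=> E; apply: (hermite_proj_lin delta_gt0 single_lp single_uniq).
  by move=> k; exact: single_exists.
by move=> a' m1 m2 [-> [m12 _]]; exact: E.
Qed.

End Single.

Definition patch4 c : R * R -> R := fun z =>
  c 0%N 0%N * (Bs p r n 0 z.1 * Bs p r n 0 z.2)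
  + c 0%N 1%N * (Bs p r n 0 z.1 * Bs p r n 1 z.2)
  + c 1%N 0%N * (Bs p r n 1 z.1 * Bs p r n 0 z.2)
  + c 1%N 1%N * (Bs p r n 1 z.1 * Bs p r n 1 z.2).

Lemma patch_span a u :
  lspan (fun j : 'I_2 * 'I_2 => patch_fun p r n a j.1 j.2) u <->
  exists c, u = on_patch a (patch4 c).
Proof.
have E c : \sum_(j : 'I_2 * 'I_2) c j.1 j.2 *: patch_fun p r n a j.1 j.2 =
    on_patch a (patch4 c) :> mfun D.
  rewrite -(pair_big xpredT xpredT (fun i j : 'I_2 => c i j *: patch_fun p r n a i j)) /=.
  rewrite !big_ord_recl !big_ord0 /= /bump /= !addr0 /patch_fun !on_patchZ.
  rewrite !addrA !on_patchD; congr on_patch.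
split=> [[c ->]|[c ->]]; last by exists (fun j : 'I_2 * 'I_2 => c j.1 j.2).
exists (fun i j => c (inord i, inord j)); rewrite -E.
by apply: eq_bigr => -[i j] _ /=; rewrite !inord_val.
Qed.

Definition qA c i : R -> R := fun x => c i 0%N * Bs p r n 0 x + c i 1%N * Bs p r n 1 x.
Definition qpol c i : {poly R} := c i 0%N *: Bpol p r n 0 + c i 1%N *: Bpol p r n 1.

(** Since [b_0 = c_0 - pn c_1] and [b_1 = pn c_1], a patch term has the shape of a function of the
    left edge, and can be compared with edge terms coefficient by coefficient. *)
Lemma patch4_lf c :
  patch4 c = lf p r n (qA c 0) (fun x => pn * (qA c 1 x - qA c 0 x)).
Proof.
apply/funext => z; rewrite /patch4 /lf /qA.
rewrite (Bs1_c1 r_gt0 rp n_gt0 N5 z.1) (Bs0_c r_gt0 rp n_gt0 N5 z.1) -/pn; ring.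
Qed.

Lemma patch4_bf c :
  patch4 c = bf p r n (qA (transpose c) 0)
    (fun x => pn * (qA (transpose c) 1 x - qA (transpose c) 0 x)).
Proof.
apply/funext => z; rewrite /patch4 /bf /qA /transpose.
rewrite (Bs1_c1 r_gt0 rp n_gt0 N5 z.2) (Bs0_c r_gt0 rp n_gt0 N5 z.2) -/pn; ring.
Qed.

Lemma qA_near c i x : x < delta -> qA c i x = (qpol c i).[x].
Proof. by move=> xd; rewrite /qA !Bs_near0 // hornerD !hornerZ. Qed.

Lemma qA2_near c x : x < delta ->
  pn * (qA c 1 x - qA c 0 x) = (pn *: (qpol c 1 - qpol c 0)).[x].
Proof. by move=> xd; rewrite !qA_near // hornerZ hornerD hornerN. Qed.

Lemma ord_Bs01 j : (j <= 1)%N -> ord delta 0 3 (@Bs R p r n j).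
Proof.
have H := @NB_ge R p r n r_gt0 rp n_gt0 N5; move=> j1.
have jN : (j < NB p r n)%N by lia.
by apply: ord_le (Bs_ord rp0 n_gt0 jN) => //; lia.
Qed.

Lemma patch4_sep c : sepsum delta Kvert (patch4 c).
Proof.
have O0 := ord_Bs01 (isT : (0 <= 1)%N); have O1 := ord_Bs01 (isT : (1 <= 1)%N).
have T i j (Oi : ord delta 0 3 (@Bs R p r n i)) (Oj : ord delta 0 3 (@Bs R p r n j)) k :
    sepsum delta Kvert (fun z => k * (Bs p r n i z.1 * Bs p r n j z.2)).
  by apply: sepsumZ; apply: sep_term Oi Oj _; split.
by do 3?apply: sep_add; apply: T.
Qed.

(** The derivatives of [patch4 c] at the origin are scaled finite differences of [c], because [b_0]
    and [b_1] have values 1, 0 and slopes [- pn], [pn] at 0. *)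
Definition pjet c U := [/\ c 0%N 0%N = U 0%N 0%N, pn * (c 0%N 1%N - c 0%N 0%N) = U 0%N 1%N,
  pn * (c 1%N 0%N - c 0%N 0%N) = U 1%N 0%N &
  pn * (pn * (c 1%N 1%N - c 1%N 0%N) - pn * (c 0%N 1%N - c 0%N 0%N)) = U 1%N 1%N].

Lemma qpol_0 c i : (qpol c i)`_0 = c i 0%N.
Proof. by rewrite coefD !coefZ Bpol00 // Bpol_low // mulr1 mulr0 addr0. Qed.

Lemma qpol_1 c i : (qpol c i)`_1 = pn * (c i 1%N - c i 0%N).
Proof. by rewrite coefD !coefZ Bpol01 // Bpol11 // -/pn; ring. Qed.

Lemma qpol2_0 c :
  (pn *: (qpol c 1 - qpol c 0))`_0 = pn * (c 1%N 0%N - c 0%N 0%N).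
Proof. by rewrite coefZ coefB !qpol_0. Qed.

Lemma dmix_patch4 c m1 m2 : dmix m1 m2 (patch4 c) (0, 0) =
  (lfpol p r n (qpol c 0) (pn *: (qpol c 1 - qpol c 0)))`_m1`_m2 * (m1`! * m2`!)%:R.
Proof.
rewrite patch4_lf; apply: (dmix_lf r_gt0 rp n_gt0 N5) => x xd; first exact: qA_near.
exact: qA2_near.
Qed.

Lemma dmix_patch4t c m1 m2 : dmix m1 m2 (patch4 c) (0, 0) =
  (lfpol p r n (qpol (transpose c) 0)
    (pn *: (qpol (transpose c) 1 - qpol (transpose c) 0)))`_m2`_m1 * (m2`! * m1`!)%:R.
Proof.
rewrite patch4_bf; apply: (dmix_bf r_gt0 rp n_gt0 N5) => x xd; first exact: qA_near.
exact: qA2_near.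
Qed.

Lemma patch4_jet c U : (forall m1 m2, (m1 <= 1)%N -> (m2 <= 1)%N ->
    dmix m1 m2 (patch4 c) (0, 0) = U m1 m2) <-> pjet c U.
Proof.
have Q0 := qpol_0 c 0; have Q0' := qpol_0 c 1.
have Q1 := qpol_1 c 0; have Q1' := qpol_1 c 1.
have L0 := coef0_lfpol r_gt0 rp n_gt0 N5 (qpol c 0) (pn *: (qpol c 1 - qpol c 0)).
have L1 := coef1_lfpol r_gt0 rp n_gt0 N5 (qpol c 0) (pn *: (qpol c 1 - qpol c 0)).
have E00 : dmix 0 0 (patch4 c) (0, 0) = c 0%N 0%N.
  by rewrite dmix_patch4 L0 Q0 mulr1.
have E01 : dmix 0 1 (patch4 c) (0, 0) = pn * (c 0%N 1%N - c 0%N 0%N).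
  by rewrite dmix_patch4 L0 Q1 mulr1.
have E10 : dmix 1 0 (patch4 c) (0, 0) = pn * (c 1%N 0%N - c 0%N 0%N).
  by rewrite dmix_patch4 L1 coefZ coefB Q0 Q0' mulr1.
have E11 : dmix 1 1 (patch4 c) (0, 0) =
    pn * (pn * (c 1%N 1%N - c 1%N 0%N) - pn * (c 0%N 1%N - c 0%N 0%N)).
  by rewrite dmix_patch4 L1 coefZ coefB Q1 Q1' mulr1.
split=> [H|[H0 H1 H2 H3] m1 m2 m1l m2l].
  split; first by rewrite -H // E00.
  - by rewrite -H // E01.
  - by rewrite -H // E10.
  - by rewrite -H // E11.
case: m1 m1l => [|[|//]] _; case: m2 m2l => [|[|//]] _.
- by rewrite E00.
- by rewrite E01.
- by rewrite E10.
- by rewrite E11.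
Qed.

Lemma patch_match a c U :
  (forall a' m1 m2, a' = a /\ (m1 <= 1)%N /\ (m2 <= 1)%N ->
     dpull a' m1 m2 (on_patch a (patch4 c)) = U m1 m2) <-> pjet c U.
Proof.
split=> [H|/patch4_jet H a' m1 m2 [-> [m1l m2l]]].
  apply/patch4_jet => m1 m2 m1l m2l; rewrite -(H a m1 m2) //.
  by rewrite /dpull pull_on_patch_id.
by rewrite /dpull pull_on_patch_id H.
Qed.

Lemma pjet0 c : pjet c (fun _ _ => 0) -> patch4 c = (fun=> 0).
Proof.
have K x : pn * x = 0 -> x = 0.
  by move/(canRL (mulKf pn_neq0)); rewrite mulr0.
move=> [E0 /K E1 /K E2 /K E3]; rewrite E0 in E1 E2; rewrite !subr0 in E1 E2.
rewrite E0 E1 E2 !subr0 mulr0 subr0 in E3; move/K: E3 => E3.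
by apply/funext => z; rewrite /patch4 E0 E1 E2 E3 !mul0r !addr0.
Qed.

Section PatchProjection.
Variable a : frame D.
Let C (a' : frame D) (m1 m2 : nat) := a' = a /\ (m1 <= 1)%N /\ (m2 <= 1)%N.
Let e (j : 'I_2 * 'I_2) : mfun D := patch_fun p r n a j.1 j.2.

Let patch_lp j : lp delta (e j).
Proof.
have [c ->] : exists c, e j = on_patch a (patch4 c).
  apply/patch_span; exists (fun j' => (j' == j)%:R).
  rewrite (bigD1 j) //= eqxx scale1r big1 ?addr0 //.
  by move=> i /negPf ->; rewrite scale0r.
exact: on_patch_lp (patch4_sep c).
Qed.

Let patch_uniq u : lspan e u ->
  (forall a' m1 m2, C a' m1 m2 -> dpull a' m1 m2 u = 0) -> u = 0.
Proof.
move=> /patch_span[c ->] H.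
have /pjet0 -> : pjet c (fun _ _ => 0) by apply/(patch_match a).
by rewrite on_patch0.
Qed.

Let patch_exists phi : exists2 u, lspan e u & hermite_match C phi u.
Proof.
have H (U : nat -> nat -> R) : exists c, pjet c U.
  pose c01 := U 0%N 0%N + U 0%N 1%N / pn.
  pose c10 := U 0%N 0%N + U 1%N 0%N / pn.
  pose c11 := c10 + (c01 - U 0%N 0%N) + U 1%N 1%N / pn / pn.
  exists (fun i j => if i == 0%N then (if j == 0%N then U 0%N 0%N else c01)
    else if j == 0%N then c10 else c11).
  move: pn_neq0; rewrite /pjet /c11 /c10 /c01 /=; move: pn => q q0.
  by split=> //; field.
have [c /(patch_match a) Hc] := H (jet phi a).
exists (on_patch a (patch4 c)); first by apply/patch_span; exists c.
by move=> a' m1 m2 Ca; rewrite (Hc _ _ _ Ca); case: Ca => ->.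
Qed.

Lemma patch_proj_spec phi : exists2 c,
  patch_proj p r n a phi = on_patch a (patch4 c) & pjet c (jet phi a).
Proof.
have [S M] := hermite_projP (patch_exists phi).
move/patch_span: (S) => [c E]; exists c => //; rewrite E in M.
apply/(patch_match a) => a' m1 m2 Ca; rewrite (M _ _ _ Ca).
by case: Ca => ->.
Qed.

Lemma patch_proj_lin (K : finType) (c : K -> R) (phi : K -> _) chi :
  (forall m1 m2, (m1 + m2 <= 2)%N ->
     jet chi a m1 m2 = \sum_k c k * jet (phi k) a m1 m2) ->
  patch_proj p r n a chi = \sum_k c k *: patch_proj p r n a (phi k).
Proof.
move=> E; apply: (hermite_proj_lin delta_gt0 patch_lp patch_uniq).
  by move=> k; exact: patch_exists.
by move=> a' m1 m2 [-> [m1l m2l]]; apply: E; exact: leq_add m1l m2l.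
Qed.

End PatchProjection.

(* The derivative of order (2, 0) of the patch term only depends on the jet of
   order (1, 0) and is the one of the left term; symmetrically for (0, 2). *)
Lemma corner_jet U cL beL alL cB beB alB cP :
  ljet (fpol p r n cL) (ngpol p r n beL alL cL) U ->
  ljet (fpol p r n cB) (ngpol p r n beB alB cB) (transpose U) ->
  pjet cP U -> forall m1 m2, (m1 + m2 <= 2)%N ->
  dmix m1 m2 (low_left beL alL cL) (0, 0) + dmix m1 m2 (low_bottom beB alB cB) (0, 0)
  - dmix m1 m2 (patch4 cP) (0, 0) = U m1 m2.
Proof.
move=> HL HB HP m1 m2 m12.
have JL := (ljetP r_gt0 rp n_gt0 N5 _ _ _).1 HL.
have JB := (ljetP r_gt0 rp n_gt0 N5 _ _ _).1 HB.
have MP := (patch4_jet _ _).2 HP.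
have ML k1 k2 : (k1 + k2 <= 2)%N -> (k1 <= 1)%N ->
    dmix k1 k2 (low_left beL alL cL) (0, 0) = U k1 k2.
  by move=> k12 k1l; rewrite (dmix_lowL r_gt0 rp n_gt0 N5) JL.
have MB k1 k2 : (k1 + k2 <= 2)%N -> (k2 <= 1)%N ->
    dmix k1 k2 (low_bottom beB alB cB) (0, 0) = U k1 k2.
  by move=> k12 k2l; rewrite (dmix_lowB r_gt0 rp n_gt0 N5) JB // addnC.
have [H0 H1 H2 H3] := HP.
have [m1l|m1g] := leqP m1 1; have [m2l|m2g] := leqP m2 1.
- by rewrite ML // MB // MP // addrK.
- have [-> ->] : m1 = 0%N /\ m2 = 2%N by lia.
  rewrite ML //; case: HB => E0 _ _ E1 _.
  rewrite (dmix_lowB r_gt0 rp n_gt0 N5) dmix_patch4t !coef_lfpol.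
  rewrite E0 E1 qpol2_0 qpol_0 /transpose H1 H0.
  by rewrite addrK.
- have [-> ->] : m1 = 2%N /\ m2 = 0%N by lia.
  rewrite MB //; case: HL => E0 _ _ E1 _.
  rewrite (dmix_lowL r_gt0 rp n_gt0 N5) dmix_patch4 !coef_lfpol.
  rewrite E0 E1 qpol2_0 qpol_0 H2 H0.
  by rewrite addrAC subrr add0r.
- lia.
Qed.

End VertexProjections.

(** * Corners and vertex functions *)

Section CornerGeometry.
Context {R : realType} (D : multipatch R) (p r n : nat).
Hypotheses (n_gt0 : (0 < n)%N) (HD : multipatch_domain D p r n).
Implicit Types (a b : frame D).

Let delta : R := n%:R^-1.
Let delta_gt0 : 0 < delta.
Proof. by rewrite invr_gt0 ltr0n. Qed.
Let delta_le1 : delta <= 1.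
Proof. by rewrite invf_le1 ?ltr0n // ler1n. Qed.

Let Kany (a0 a1 b0 b1 : nat) := True.

Lemma spline_ord (f : R -> R) : spline_space p r n f -> ord delta 0 0 f.
Proof.
move=> [_ Hf]; split.
  have [q _ Eq] := Hf 0%N n_gt0; exists q => x xd.
  rewrite expr0 mul1r Eq //; split; first by left.
  by right; rewrite mul1r ltW.
have n1 : (n.-1 < n)%N by rewrite prednK.
have [q _ Eq] := Hf n.-1 n1; exists (q \Po (1 - 'X)) => x xd.
rewrite expr0 mul1r Eq ?horner_comp ?hornerE //; split; last by left; rewrite prednK.
right; rewrite ler_pdivrMr ?ltr0n // mulrBl mul1r lerBrDr.
rewrite -[in leRHS](prednK n_gt0) -[in leRHS]natr1 lerD2l.
by rewrite -ler_pdivlMr ?ltr0n // div1r ltW.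
Qed.

Lemma param_sep i (k : 'I_2) : sepsum delta Kany (coord k \o param (m := D) i).
Proof.
have [m [f1 [f2 [Hf ->]]]] := param_spline HD i k.
apply: sepsum_sum => l _; have [F1 F2] := Hf l.
exact: sep_term (spline_ord F1) (spline_ord F2) I.
Qed.

Lemma coord0E : coord ord0 = fst :> (R * R -> R).
Proof. by apply/funext. Qed.

Lemma coord1E : coord ord_max = snd :> (R * R -> R).
Proof. by apply/funext. Qed.

Lemma fparam_sep a k : sepsum delta Kany (coord k \o fparam a).
Proof.
have := iter_rotK a.2 (param_sep a.1 k).
by apply: sepsum_impl.
Qed.

Lemma fparam_locp a k : exists P, locp delta (coord k \o fparam a) P.
Proof. by have [P HP _] := sepsum_locp delta_gt0 (fparam_sep a k); exists P. Qed.

Definition fjet a (k : 'I_2) (m1 m2 : nat) : R := dmix m1 m2 (coord k \o fparam a) (0, 0).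

Lemma pullback_jetE (phi : patch D -> R * R -> R) a m1 m2 :
  smooth (phi a.1) -> (m1 + m2 <= 2)%N ->
  pullback_jet phi a m1 m2 = comp_jet (fjet a ord0) (fjet a ord_max)
    (fun k l => dmix k l (phi a.1) (corner a)) m1 m2.
Proof.
move=> sphi m12; have [P HP] := fparam_locp a ord0; have [Q HQ] := fparam_locp a ord_max.
rewrite coord0E in HP; rewrite coord1E in HQ.
rewrite /pullback_jet (dmix_comp delta_gt0 HP HQ sphi m12) /fjet.
by rewrite coord0E coord1E.
Qed.

Lemma horner_polyC0 (P : {poly {poly R}}) (x : R) : P.[(0:R)%:P].[x] = (P`_0).[x].
Proof. by rewrite polyC0 horner_coef0. Qed.

Lemma horner_swap0 (P : {poly {poly R}}) (x : R) : P.[x%:P].[0] = ((swapXY P)`_0).[x].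
Proof. by rewrite -horner_polyC0 horner2_swapXY. Qed.

Lemma horner_swap1 (P : {poly {poly R}}) (x : R) :
  (map_poly deriv P).[x%:P].[0] = ((swapXY P)`_1).[x].
Proof.
rewrite deriv_horner_polyC horner_coef0 coef_deriv mulr1n horner_polyC coef_map.
by [].
Qed.

(** On the first element the matching of the parametrizations and the gluing condition are
    polynomial identities in the position along the edge. Comparing their lowest coefficients
    replaces differentiation at the vertex. *)
Lemma interface_jet a b (k : 'I_2) : std_interface a b -> is_gluing a b (gdata a b) ->
  let X := fjet a k in let Z := fjet b k in let g := gdata a b in
  let be := al1 g * be2 g + al2 g * be1 g in
  [/\ Z 0%N 0%N = X 0%N 0%N, Z 1%N 0%N = X 0%N 1%N, Z 2%N 0%N = X 0%N 2%N,
   (al1 g)`_0 * Z 0%N 1%N + (al2 g)`_0 * X 1%N 0%N + be`_0 * X 0%N 1%N = 0 &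
   (al1 g)`_1 * Z 0%N 1%N + (al1 g)`_0 * Z 1%N 1%N + (al2 g)`_1 * X 1%N 0%N
   + (al2 g)`_0 * X 1%N 1%N + be`_1 * X 0%N 1%N + be`_0 * X 0%N 2%N = 0].
Proof.
move=> [_ Hst] [_ _ _ Hg] X Z g be.
have [P HP] := fparam_locp a k; have [Q HQ] := fparam_locp b k.
have EX m1 m2 : X m1 m2 = P`_m1`_m2 * (m1`! * m2`!)%:R.
  exact: (dmix_locp delta_gt0 _ _ HP).
have EZ m1 m2 : Z m1 m2 = Q`_m1`_m2 * (m1`! * m2`!)%:R.
  exact: (dmix_locp delta_gt0 _ _ HQ).
have ut t : 0 < t < delta -> unit_itv t.
  move=> /andP[t0 td]; apply/andP; split; first exact: ltW.
  exact: ltW (lt_le_trans td delta_le1).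
have E0 : P`_0 = (swapXY Q)`_0.
  apply/eqP; rewrite -subr_eq0; apply/eqP.
  apply: (poly_eq0_itv delta_gt0 (g := id)) => // t t0; apply/eqP.
  have td : t < delta by case/andP: t0.
  rewrite hornerD hornerN -horner_polyC0 -horner_swap0.
  rewrite -(HP (0, t)) // -(HQ (t, 0)) //=; apply/eqP; rewrite subr_eq0; apply/eqP.
  by congr (coord k _); exact/Hst/ut.
have E1 : al1 g * (swapXY Q)`_1 + al2 g * P`_1 + be * (P`_0)^`() = 0.
  apply: (poly_eq0_itv delta_gt0 (g := id)) => // t t0; apply/eqP.
  have td : t < delta by case/andP: t0.
  rewrite -[RHS](Hg t (ut t t0) k).
  rewrite (locp_d2 HQ) // (locp_d1 HP) // (locp_d2 HP) //=.
  rewrite !hornerD !hornerM; congr (_ * _ + _ * _ + _ * _).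
  - by rewrite horner_swap1.
  - by rewrite horner_polyC0 coef_deriv.
  - by rewrite /be hornerD !hornerM.
  - by rewrite deriv_horner_polyC polyC0 horner_coef0.
have S0 m : Q`_m`_0 = P`_0`_m by rewrite E0 coef_swapXY.
split.
- by rewrite EX EZ S0.
- by rewrite EX EZ S0.
- by rewrite EX EZ S0 mulnC.
- have H : (al1 g * (swapXY Q)`_1)`_0 + (al2 g * P`_1)`_0 + (be * (P`_0)^`())`_0 = 0.
    by rewrite -!coefD E1 coef0.
  rewrite !EX !EZ !mulr1 -[RHS]H !coefM.
  by rewrite !big_ord_recl !big_ord0 /= !addr0 subnn coef_deriv coef_swapXY mulr1n.
- have H : (al1 g * (swapXY Q)`_1)`_1 + (al2 g * P`_1)`_1 + (be * (P`_0)^`())`_1 = 0.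
    by rewrite -!coefD E1 coef0.
  rewrite !EX !EZ !mulr1 -[RHS]H !coefM.
  rewrite !big_ord_recl !big_ord0 /= /bump /= !addr0 !subn0 !subnn.
  rewrite !coef_deriv !coef_swapXY mulr1n -[_ *+ 2]mulr_natr.
  rewrite (_ : (0`! * 2`!)%N = 2%N) // addn0.
  by move: (be`_0) (be`_1) => b0 b1; ring.
Qed.

Lemma eq_comp_jet X Y (J J' : nat -> nat -> R) m1 m2 :
  (forall k l, (k + l <= 2)%N -> J k l = J' k l) ->
  comp_jet X Y J m1 m2 = comp_jet X Y J' m1 m2.
Proof. by move=> E; case: m1 m2 => [|[|[|m1]]] [|[|[|m2]]] //=; rewrite !E. Qed.

(** The relations for a pullback are combinations of those for the two components. At first order
    the gradient of the outer function multiplies them; after differentiation there is in addition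
    its Hessian, paired with the tangent [(X 0 1, Y 0 1)] of the edge and the undifferentiated
    relations. *)
Lemma comp_jet_gluing (X Y Z T J : nat -> nat -> R) (a0 a1 c0 c1 b0 b1 : R) :
  Z 1%N 0%N = X 0%N 1%N -> Z 2%N 0%N = X 0%N 2%N ->
  T 1%N 0%N = Y 0%N 1%N -> T 2%N 0%N = Y 0%N 2%N ->
  a0 * Z 0%N 1%N + c0 * X 1%N 0%N + b0 * X 0%N 1%N = 0 ->
  a0 * T 0%N 1%N + c0 * Y 1%N 0%N + b0 * Y 0%N 1%N = 0 ->
  a1 * Z 0%N 1%N + a0 * Z 1%N 1%N + c1 * X 1%N 0%N + c0 * X 1%N 1%N
    + b1 * X 0%N 1%N + b0 * X 0%N 2%N = 0 ->
  a1 * T 0%N 1%N + a0 * T 1%N 1%N + c1 * Y 1%N 0%N + c0 * Y 1%N 1%N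
    + b1 * Y 0%N 1%N + b0 * Y 0%N 2%N = 0 ->
  let U := comp_jet X Y J in let W := comp_jet Z T J in
  [/\ W 0%N 0%N = U 0%N 0%N, W 1%N 0%N = U 0%N 1%N, W 2%N 0%N = U 0%N 2%N,
   a0 * W 0%N 1%N + c0 * U 1%N 0%N + b0 * U 0%N 1%N = 0 &
   a1 * W 0%N 1%N + a0 * W 1%N 1%N + c1 * U 1%N 0%N + c0 * U 1%N 1%N
    + b1 * U 0%N 1%N + b0 * U 0%N 2%N = 0].
Proof.
move=> Z1 Z2 T1 T2 gX0 gY0 gX1 gY1 /=; rewrite Z1 Z2 T1 T2; split=> //.
  transitivity (J 1%N 0%N * (a0 * Z 0%N 1%N + c0 * X 1%N 0%N + b0 * X 0%N 1%N)
    + J 0%N 1%N * (a0 * T 0%N 1%N + c0 * Y 1%N 0%N + b0 * Y 0%N 1%N)); first ring.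
  by rewrite gX0 gY0 !mulr0 addr0.
transitivity (J 1%N 0%N * (a1 * Z 0%N 1%N + a0 * Z 1%N 1%N + c1 * X 1%N 0%N + c0 * X 1%N 1%N
      + b1 * X 0%N 1%N + b0 * X 0%N 2%N)
    + J 0%N 1%N * (a1 * T 0%N 1%N + a0 * T 1%N 1%N + c1 * Y 1%N 0%N + c0 * Y 1%N 1%N
      + b1 * Y 0%N 1%N + b0 * Y 0%N 2%N)
    + J 2%N 0%N * X 0%N 1%N * (a0 * Z 0%N 1%N + c0 * X 1%N 0%N + b0 * X 0%N 1%N)
    + J 1%N 1%N * (X 0%N 1%N * (a0 * T 0%N 1%N + c0 * Y 1%N 0%N + b0 * Y 0%N 1%N)
    + Y 0%N 1%N * (a0 * Z 0%N 1%N + c0 * X 1%N 0%N + b0 * X 0%N 1%N))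
    + J 0%N 2%N * Y 0%N 1%N * (a0 * T 0%N 1%N + c0 * Y 1%N 0%N + b0 * Y 0%N 1%N)); first ring.
by rewrite gX0 gY0 gX1 gY1 !(mulr0, addr0).
Qed.

Lemma compat_of_interface a b (phi : patch D -> R * R -> R) :
  std_interface a b -> is_gluing a b (gdata a b) -> smooth (phi a.1) -> smooth (phi b.1) ->
  (forall m1 m2, (m1 + m2 <= 2)%N ->
     dmix m1 m2 (phi b.1) (corner b) = dmix m1 m2 (phi a.1) (corner a)) ->
  glue_compat a b (pullback_jet phi a) (pullback_jet phi b).
Proof.
move=> Hst Hg sa sb HJ.
have [_ Z1 Z2 gX0 gX1] := interface_jet ord0 Hst Hg.
have [_ T1 T2 gY0 gY1] := interface_jet ord_max Hst Hg.
pose J k l := dmix k l (phi a.1) (corner a).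
have Ja m1 m2 : (m1 + m2 <= 2)%N -> pullback_jet phi a m1 m2 =
    comp_jet (fjet a ord0) (fjet a ord_max) J m1 m2.
  by move=> m12; exact: (pullback_jetE sa m12).
have Jb m1 m2 : (m1 + m2 <= 2)%N -> pullback_jet phi b m1 m2 =
    comp_jet (fjet b ord0) (fjet b ord_max) J m1 m2.
  by move=> m12; rewrite (pullback_jetE sb m12); exact: eq_comp_jet.
have [h0 h1 h2 h3 h4] := comp_jet_gluing J Z1 Z2 T1 T2 gX0 gY0 gX1 gY1.
rewrite /glue_compat.
rewrite !(Ja 0 0 isT)%N !(Ja 0 1 isT)%N !(Ja 0 2 isT)%N !(Ja 1 0 isT)%N !(Ja 1 1 isT)%N.
rewrite !(Jb 0 0 isT)%N !(Jb 0 1 isT)%N !(Jb 2 0 isT)%N !(Jb 1 0 isT)%N !(Jb 1 1 isT)%N.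
by split; [exact: h0|exact: h1|exact: h2|exact: h3|exact: h4].
Qed.

Lemma ord_derivable f x0 : ord delta 0 0 f -> x0 = 0 \/ x0 = 1 -> derivable f x0 1.
Proof.
move=> [[q Eq] [s Es]] [->|->].
  apply: (@near_eq_derivable _ _ _ (horner q)); last exact: derivable_horner.
  near=> x; rewrite Eq ?expr0 ?mul1r //; near: x; exact: lt_nbhsl.
apply: (@near_eq_derivable _ _ _ (horner (s \Po (1 - 'X)))); last exact: derivable_horner.
near=> x; rewrite -[in RHS](subKr 1 x) Es ?expr0 ?mul1r ?horner_comp ?hornerE //.
rewrite ltrBlDr -ltrBlDl; near: x; apply: lt_nbhsr; by rewrite gtrBl.
Unshelve. all: by end_near. Qed.

Lemma sepsum_derivable h x0 y : sepsum delta Kany h -> x0 = 0 \/ x0 = 1 ->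
  derivable (fun t => h (t, y)) x0 1 /\ derivable (fun t => h (y, t)) x0 1.
Proof.
move=> Hh x01; elim: Hh => [f g a0 a1 b0 b1 Hf Hg _|h1 h2 _ [H1 H1'] _ [H2 H2']|].
- split => /=.
    apply: derivableM; last exact: derivable_cst.
    exact: ord_derivable (ord_le (leq0n _) (leq0n _) Hf) x01.
  apply: derivableM; first exact: derivable_cst.
  exact: ord_derivable (ord_le (leq0n _) (leq0n _) Hg) x01.
- by split; exact: derivableD.
- by split; exact: derivable_cst.
Qed.

Definition cross (h1 h2 : R * R -> R) z := d1 h1 z * d2 h2 z - d2 h1 z * d1 h2 z.

Definition is_corner (z : R * R) := (z.1 = 0 \/ z.1 = 1) /\ (z.2 = 0 \/ z.2 = 1).

Lemma corner_rot z : is_corner z -> is_corner (rot z).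
Proof.
move=> [z1 z2]; split; last exact: z1.
by case: z2 => z2; rewrite /rot /= z2; [right; rewrite subr0|left; rewrite subrr].
Qed.

Lemma d2_rot h z : sepsum delta Kany h -> is_corner z ->
  d2 (h \o rot) z = - d1 h (rot z).
Proof.
move=> Hh Hz; rewrite /d2 /d1 /=.
have [c1 _] := corner_rot Hz.
have [dh _] := sepsum_derivable z.1 Hh c1.
have drev (t : R) : is_derive t 1 (fun t : R => 1 - t) (-1).
  have := is_deriveB (is_derive_cst (1 : R) t 1) (is_derive_id t (1 : R)).
  by rewrite sub0r.
have := @derive1_comp R (fun t : R => 1 - t) (fun t => h (t, z.1)) z.2 _ dh.
rewrite /comp /= => ->; last by case: (drev z.2).
by rewrite [X in _ * X]derive1E; case: (drev z.2) => _ ->; rewrite mulrN1.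
Qed.

(** A rotation has determinant 1. The statement is confined to corners, where differentiability is
    known from the end pieces of the splines. *)
Lemma cross_rot h1 h2 z : sepsum delta Kany h1 -> sepsum delta Kany h2 -> is_corner z ->
  cross (h1 \o rot) (h2 \o rot) z = cross h1 h2 (rot z).
Proof.
move=> H1 H2 Hz; rewrite /cross (d2_rot H1 Hz) (d2_rot H2 Hz).
rewrite -[d1 (h1 \o rot) z]/(d2 h1 (rot z)) -[d1 (h2 \o rot) z]/(d2 h2 (rot z)).
move: (d1 h1 _) (d1 h2 _) (d2 h1 _) (d2 h2 _) => e1 e2 e3 e4; ring.
Qed.

Lemma cross_iter_rot m h1 h2 z : sepsum delta Kany h1 -> sepsum delta Kany h2 ->
  is_corner z ->
  cross (h1 \o iter m rot) (h2 \o iter m rot) z = cross h1 h2 (iter m rot z).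
Proof.
elim: m h1 h2 z => [|m IH] h1 h2 z H1 H2 Hz //.
have S h : sepsum delta Kany h -> sepsum delta Kany (h \o rot).
  by move=> /sepsum_rot; apply: sepsum_impl.
rewrite iterS -cross_rot //; last by elim: m {IH} => //= m; exact: corner_rot.
by rewrite -(IH _ _ _ (S _ H1) (S _ H2) Hz).
Qed.

Lemma det_2x2 (A : 'M[R]_2) : \det A =
  A ord0 ord0 * A ord_max ord_max - A ord0 ord_max * A ord_max ord0.
Proof.
have l1 (i : 'I_1) : lift ord0 i = ord_max :> 'I_2.
  by rewrite [i]ord1; apply/val_inj.
have l2 (i : 'I_1) : lift ord_max i = ord0 :> 'I_2.
  by rewrite [i]ord1; apply/val_inj.
rewrite (expand_det_row _ ord0) !big_ord_recl big_ord0 /cofactor !det_mx11 !mxE.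
rewrite !l1 l2 addr0 /= expr0 expr1 mul1r; ring.
Qed.

Lemma det_jacE (F : R * R -> R * R) z :
  \det (jac F z) = cross (coord ord0 \o F) (coord ord_max \o F) z.
Proof. by rewrite det_2x2 !mxE. Qed.

Lemma fjet_cross a :
  fjet a ord0 1 0 * fjet a ord_max 0 1 - fjet a ord0 0 1 * fjet a ord_max 1 0 != 0.
Proof.
have c0 : is_corner (0, 0) by split; left.
rewrite -[X in X != 0]/(cross (coord ord0 \o param a.1 \o iter a.2 rot)
   (coord ord_max \o param a.1 \o iter a.2 rot) (0, 0)).
rewrite cross_iter_rot //; [|exact: param_sep|exact: param_sep].
rewrite -det_jacE gt_eqF // (param_det HD) //.
have : is_corner (iter a.2 rot (0, 0)) by elim: (nat_of_ord a.2) => //= m; exact: corner_rot.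
have u0 : unit_itv (0 : R) by apply/andP; rewrite lexx ler01.
have u1 : unit_itv (1 : R) by apply/andP; rewrite lexx ler01.
by case: (iter _ _ _) => x y [/= [->|->] [->|->]]; split.
Qed.

Lemma jac_fparam_neq0 a : jac (fparam a) (0, 0) != 0.
Proof.
apply/negP => /eqP J0; have := fjet_cross a.
have E (k l : 'I_2) : jac (fparam a) (0, 0) k l = 0 by rewrite J0 mxE.
have E1 := E ord0 ord0; have E2 := E ord0 ord_max.
rewrite !mxE /= in E1 E2.
rewrite -[fjet a ord0 1 0]/(d1 (coord ord0 \o fparam a) (0, 0)) E1.
rewrite -[fjet a ord0 0 1]/(d2 (coord ord0 \o fparam a) (0, 0)) E2.
by rewrite !mul0r subrr eqxx.
Qed.

Lemma cramer2 (x10 x01 y10 y01 u v : R) : x10 * y01 - x01 * y10 != 0 ->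
  u * x10 + v * y10 = 0 -> u * x01 + v * y01 = 0 -> u = 0 /\ v = 0.
Proof.
move=> d0 e1 e2; split; apply: (mulIf d0); rewrite mul0r.
  transitivity ((u * x10 + v * y10) * y01 - (u * x01 + v * y01) * y10); first ring.
  by rewrite e1 e2 !mul0r subrr.
transitivity ((u * x01 + v * y01) * x10 - (u * x10 + v * y10) * x01); first ring.
by rewrite e1 e2 !mul0r subrr.
Qed.

(** Cramer's rule makes the gradient vanish, and then the second-order data are the Hessian
    evaluated on pairs of tangent vectors. A second use shows that the Hessian kills each tangent
    vector, a third one that its rows are zero. *)
Lemma comp_jet_inj X Y (J : nat -> nat -> R) :
  X 1%N 0%N * Y 0%N 1%N - X 0%N 1%N * Y 1%N 0%N != 0 ->
  (forall m1 m2, (m1 + m2 <= 2)%N -> comp_jet X Y J m1 m2 = 0) ->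
  forall m1 m2, (m1 + m2 <= 2)%N -> J m1 m2 = 0.
Proof.
move=> d0 H.
have J00 := H 0%N 0%N isT.
have [J10 J01] := cramer2 d0 (H 1%N 0%N isT) (H 0%N 1%N isT).
have := H 2%N 0%N isT; have := H 1%N 1%N isT; have := H 0%N 2%N isT.
rewrite /comp_jet J10 J01 !mul0r !addr0 => H02 H11 H20.
have [p1 q1] : J 2%N 0%N * X 1%N 0%N + J 1%N 1%N * Y 1%N 0%N = 0 /\
    J 1%N 1%N * X 1%N 0%N + J 0%N 2%N * Y 1%N 0%N = 0.
  by apply: (cramer2 d0); [rewrite -[RHS]H20|rewrite -[RHS]H11]; ring.
have [p2 q2] : J 2%N 0%N * X 0%N 1%N + J 1%N 1%N * Y 0%N 1%N = 0 /\
    J 1%N 1%N * X 0%N 1%N + J 0%N 2%N * Y 0%N 1%N = 0.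
  by apply: (cramer2 d0); [rewrite -[RHS]H11|rewrite -[RHS]H02]; ring.
have [J20 J11] := cramer2 d0 p1 p2; have [_ J02] := cramer2 d0 q1 q2.
by move=> [|[|[|m1]]] [|[|[|m2]]].
Qed.

End CornerGeometry.

(** * Bivariate polynomials as smooth functions *)

Section PolynomialFunctions.
Context {R : realType}.

(** With pairs of univariate factors differentiation acts on one factor only, and monomials centred
    at a vertex need no expansion. *)
Definition tpoly (s : seq ({poly R} * {poly R})) : R * R -> R :=
  fun x => \sum_(q <- s) q.1.[x.1] * q.2.[x.2].

Lemma is_derive_tpoly1 s (x y : R) : is_derive x 1 (fun t => tpoly s (t, y))
  (tpoly [seq (q.1^`(), q.2) | q <- s] (x, y)).
Proof.
elim: s => [|q s IH].
  rewrite /tpoly /= big_nil (_ : (fun t => _) = cst 0); first exact: is_derive_cst.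
  by apply/funext => t; rewrite big_nil.
have H := is_deriveD (is_deriveM (is_derive_poly q.1 x) (is_derive_cst q.2.[y] x 1)) IH.
rewrite (_ : (fun t => tpoly (q :: s) (t, y)) =
    (horner q.1 * cst q.2.[y] + (fun t => tpoly s (t, y)))); last first.
  by apply/funext => t; rewrite /tpoly big_cons.
apply: is_derive_eq H _; rewrite /tpoly /= big_cons /= /GRing.scale /=.
by rewrite mulr0 add0r mulrC.
Qed.

Lemma is_derive_tpoly2 s (x y : R) : is_derive y 1 (fun t => tpoly s (x, t))
  (tpoly [seq (q.1, q.2^`()) | q <- s] (x, y)).
Proof.
elim: s => [|q s IH].
  rewrite /tpoly /= big_nil (_ : (fun t => _) = cst 0); first exact: is_derive_cst.
  by apply/funext => t; rewrite big_nil.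
have H := is_deriveD (is_deriveM (is_derive_cst q.1.[x] y 1) (is_derive_poly q.2 y)) IH.
rewrite (_ : (fun t => tpoly (q :: s) (x, t)) =
    (cst q.1.[x] * horner q.2 + (fun t => tpoly s (x, t)))); last first.
  by apply/funext => t; rewrite /tpoly big_cons.
apply: is_derive_eq H _; rewrite /tpoly /= big_cons /= /GRing.scale /=.
by rewrite mulr0 addr0.
Qed.

Lemma d1_tpoly s : d1 (tpoly s) = tpoly [seq (q.1^`(), q.2) | q <- s].
Proof.
apply/funext => -[x y]; rewrite /d1 derive1E /=.
by case: (is_derive_tpoly1 s x y).
Qed.

Lemma d2_tpoly s : d2 (tpoly s) = tpoly [seq (q.1, q.2^`()) | q <- s].
Proof.
apply/funext => -[x y]; rewrite /d2 derive1E /=.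
by case: (is_derive_tpoly2 s x y).
Qed.

Lemma continuous_tpoly s : continuous (tpoly s).
Proof.
elim: s => [|q s IH].
  rewrite (_ : tpoly [::] = cst 0); first exact: cst_continuous.
  by apply/funext => x; rewrite /tpoly big_nil.
rewrite (_ : tpoly (q :: s) = (fun x => q.1.[x.1] * q.2.[x.2] + tpoly s x)).
  move=> x; apply: cvgD; last exact: IH.
  apply: cvgM.
    by apply: continuous_comp; [exact: cvg_fst|exact: continuous_horner].
  by apply: continuous_comp; [exact: cvg_snd|exact: continuous_horner].
by apply/funext => x; rewrite /tpoly big_cons.
Qed.

Lemma smooth_tpoly s : smooth (tpoly s).
Proof.
move=> k; elim: k s => [|k IH] s; first by split=> //; exact: continuous_tpoly.
split; first exact: continuous_tpoly.
split.
- by move=> [x y]; case: (is_derive_tpoly1 s x y).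
- by move=> [x y]; case: (is_derive_tpoly2 s x y).
- by rewrite d1_tpoly; exact: IH.
- by rewrite d2_tpoly; exact: IH.
Qed.

Lemma dmix_tpoly s m1 m2 :
  dmix m1 m2 (tpoly s) = tpoly [seq (q.1^`(m1), q.2^`(m2)) | q <- s].
Proof.
have E2 : iter m2 d2 (tpoly s) = tpoly [seq (q.1, q.2^`(m2)) | q <- s].
  elim: m2 => [|m IH] /=; first by congr tpoly; rewrite -[LHS]map_id; apply: eq_map; case.
  by rewrite IH d2_tpoly -map_comp.
rewrite /dmix E2; elim: m1 => [|m IH] //=.
by rewrite IH d1_tpoly -map_comp.
Qed.

Lemma derivn_exp_XsubC (x : R) j m :
  (('X - x%:P) ^+ j)^`(m) = ('X - x%:P) ^+ (j - m) *+ j ^_ m.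
Proof.
elim: m => [|m IH]; first by rewrite subn0.
rewrite derivnS IH derivMn deriv_exp derivXsubC mul1r -mulrnA ffactnSr.
by rewrite subnS mulnC.
Qed.

Lemma derivn_monomial (x : R) j m :
  ((('X - x%:P) ^+ j)^`(m)).[x] = (j == m)%:R * (j`!)%:R.
Proof.
rewrite derivn_exp_XsubC hornerMn horner_exp hornerXsubC subrr expr0n subn_eq0.
case: (ltngtP j m) => [jm|mj|->].
- by rewrite ffact_small // mulr0n mul0r.
- by rewrite mul0rn mul0r.
- by rewrite ffactnn mul1r.
Qed.

End PolynomialFunctions.

(** * Vertex projections, patch by patch *)

Section VertexSpaces.
Context {R : realType} (D : multipatch R) (p r n : nat) (nrm : 'M[R]_2 -> R).
Hypotheses (r_gt0 : (0 < r)%N) (rp : (r + 2 <= p)%N) (n_gt0 : (0 < n)%N)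
  (N5 : (5 <= Nminus p r n)%N).
Hypotheses (HD : multipatch_domain D p r n) (HS : standard_forms D)
  (HA : analysis_suitable D) (Hn : is_norm nrm).
Implicit Types (a b : frame D) (phi : patch D -> R * R -> R) (v : vert D).

Let delta : R := n%:R^-1.
Let delta_gt0 : 0 < delta.
Proof. by rewrite invr_gt0 ltr0n. Qed.
Let jet := @pullback_jet R D.

Lemma closed_patch_corner a : closed_patch a.1 (corner a).
Proof.
exists (iter a.2 rot (0, 0)); last by [].
have : is_corner (iter a.2 rot (0 : R, 0 : R)).
  by elim: (nat_of_ord a.2) => [|m IH]; [split; left|exact: corner_rot].
have u0 : unit_itv (0 : R) by apply/andP; rewrite lexx ler01.
have u1 : unit_itv (1 : R) by apply/andP; rewrite lexx ler01.
by case: (iter _ _ _) => x y [/= [->|->] [->|->]]; split.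
Qed.

Lemma fan_closed_patch v (l : 'I_(valence v)) : closed_patch (fan l).1 (vpos v).
Proof. by rewrite -(fan_corner HS l); exact: closed_patch_corner. Qed.

Lemma valence_gt0 v : (0 < valence v)%N.
Proof.
have [/(_ v I)/= [a va] _ _] := vert_bij HS.
have Hv : [set i | closed_patch i (vpos v)] a.1 by rewrite /= va; exact: closed_patch_corner.
have [_ _ /(_ _ Hv)[l _ _]] := fan_patches HS v.
by rewrite (leq_ltn_trans _ (ltn_ord l)).
Qed.

Lemma al1_neq0 a b : std_interface a b -> (al1 (gdata a b))`_0 != 0.
Proof.
move=> /HA[[_ _ Hpos _] _]; have u0 : unit_itv (0 : R) by apply/andP; rewrite lexx ler01.
have := Hpos 0 u0; rewrite -!horner_coef0; case: eqP => // ->.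
by rewrite mul0r ltxx.
Qed.

Section OneFunction.
Variables (v : vert D) (phi : patch D -> R * R -> R).
Hypothesis Hphi : C2_at v phi.

Lemma fan_compat (l m : 'I_(valence v)) : std_interface (fan l) (fan m) ->
  glue_compat (fan l) (fan m) (jet phi (fan l)) (jet phi (fan m)).
Proof.
move=> Hst; have [Hs Hj] := Hphi; have [Hg _] := HA Hst.
apply: (compat_of_interface n_gt0 HD Hst Hg (Hs _) (Hs _)) => m1 m2 m12.
by rewrite !(fan_corner HS); apply: Hj => //; exact: fan_closed_patch.
Qed.

(** Leaving [be] and [al] open lets interfaces and boundary edges be treated alike: only the jet
    matched at the corner counts. *)
Definition left_piece a (h : R * R -> R) := exists be al c,
  h = low_left p r n be al c /\
  ljet (fpol p r n c) (ngpol p r n be al c) (jet phi a).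
Definition bottom_piece a (h : R * R -> R) := exists be al c,
  h = low_bottom p r n be al c /\
  ljet (fpol p r n c) (ngpol p r n be al c) (transpose (jet phi a)).
Definition patch_piece a (h : R * R -> R) := exists c,
  h = patch4 p r n c /\ pjet p n c (jet phi a).

Lemma inter_pieces (l m : 'I_(valence v)) : std_interface (fan l) (fan m) ->
  exists q : (R * R -> R) * (R * R -> R),
  [/\ inter_proj p r n (fan l) (fan m) phi = on_patch (fan l) q.1 + on_patch (fan m) q.2,
      left_piece (fan l) q.1 & bottom_piece (fan m) q.2].
Proof.
move=> Hst; have [c [E H1 H2]] := inter_proj_spec r_gt0 rp n_gt0 N5 Hst.1
  (al1_neq0 Hst) (fan_compat Hst).
by eexists (_, _); split; [exact: E|do 3 eexists; split; [reflexivity|exact: H1]|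
  do 3 eexists; split; [reflexivity|exact: H2]].
Qed.

Lemma left_pieces a : exists h,
  left_proj p r n a phi = on_patch a h /\ left_piece a h.
Proof.
have [c E H] := single_spec (side := true) r_gt0 rp n_gt0 N5
  (left_low_span r_gt0 rp n_gt0 N5 a) phi.
exists (low_left p r n 0 1 c); split; first exact: E.
by do 3 eexists; split; [reflexivity|exact: H].
Qed.

Lemma bottom_pieces a : exists h,
  bottom_proj p r n a phi = on_patch a h /\ bottom_piece a h.
Proof.
have [c E H] := single_spec (side := false) r_gt0 rp n_gt0 N5
  (bottom_low_span r_gt0 rp n_gt0 N5 a) phi.
exists (low_bottom p r n 0 1 c); split; first exact: E.
by do 3 eexists; split; [reflexivity|exact: H].
Qed.

Lemma patch_pieces a : exists h,
  patch_proj p r n a phi = on_patch a h /\ patch_piece a h.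
Proof.
have [c E H] := patch_proj_spec r_gt0 rp n_gt0 N5 a phi.
by exists (patch4 p r n c); split; [exact: E|exists c].
Qed.

Lemma pieces_sep_jet a hL hB hP :
  left_piece a hL -> bottom_piece a hB -> patch_piece a hP ->
  sepsum delta Kvert (fun z => hL z + hB z + (-1) * hP z) /\
  forall m1 m2, (m1 + m2 <= 2)%N ->
    dmix m1 m2 (fun z => hL z + hB z + (-1) * hP z) (0, 0) = jet phi a m1 m2.
Proof.
move=> [be [al [c [-> HL]]]] [be' [al' [c' [-> HB]]]] [c'' [-> HP]].
have SL := lowLV r_gt0 rp n_gt0 N5 be al c.
have SB := lowBV r_gt0 rp n_gt0 N5 be' al' c'.
have SP := patch4_sep r_gt0 rp n_gt0 N5 c''.
split; first by apply: sep_add; [exact: sep_add SL SB|exact: sepsumZ].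
move=> m1 m2 m12; rewrite -(corner_jet r_gt0 rp n_gt0 N5 HL HB HP m12).
have [PL EL _] := sepsum_locp delta_gt0 SL.
have [PB EB _] := sepsum_locp delta_gt0 SB.
have [PP EP _] := sepsum_locp delta_gt0 SP.
have := dmix_locp delta_gt0 m1 m2 (locpD (locpD EL EB) (locpZ (-1) EP)).
rewrite /low_left /low_bottom => ->.
rewrite (dmix_locp delta_gt0 m1 m2 EL) (dmix_locp delta_gt0 m1 m2 EB).
rewrite (dmix_locp delta_gt0 m1 m2 EP) !coefD !coefCM.
by rewrite !mulrDl mulN1r mulNr.
Qed.

End OneFunction.

(** The sums over edges are regrouped by patches. Every patch of the fan receives a left piece from
    the edge that follows it and a bottom piece from the edge that precedes it, these being boundary
    edges at the two ends of the fan of a boundary vertex. *)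
Lemma vert_pieces v phi : C2_at v phi ->
  exists H : 'I_(valence v) -> R * R -> R,
    vert_proj p r n v phi = \sum_l on_patch (fan l) (H l) /\
    forall l, sepsum delta Kvert (H l) /\ forall m1 m2, (m1 + m2 <= 2)%N ->
      dmix m1 m2 (H l) (0, 0) = jet phi (fan l) m1 m2.
Proof.
move=> Hphi.
have [fP HP] := choice (fun l : 'I_(valence v) => patch_pieces phi (fan l)).
suff [fL [fB [E HL HB]]] : exists fL fB : 'I_(valence v) -> R * R -> R,
  [/\ vert_proj p r n v phi = \sum_(l < valence v) on_patch (fan l) (fL l)
        + \sum_(l < valence v) on_patch (fan l) (fB l)
        - \sum_(l < valence v) patch_proj p r n (fan l) phi,
      forall l, left_piece phi (fan l) (fL l)
    & forall l, bottom_piece phi (fan l) (fB l)].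
  exists (fun l z => fL l z + fB l z + (-1) * fP l z); split.
    rewrite E -big_split -sumrB; apply: eq_bigr => l _ /=.
    by rewrite (HP l).1 -scaleN1r on_patchZ !on_patchD.
  move=> l; exact: (pieces_sep_jet (HL l) (HB l) (HP l).2).
have HQ (l : 'I_(valence v)) : exists q : (R * R -> R) * (R * R -> R),
   dom D (vpos v) \/ (l.+1 < valence v)%N ->
   [/\ inter_proj p r n (fan l) (fan (ordS l)) phi =
         on_patch (fan l) q.1 + on_patch (fan (ordS l)) q.2,
      left_piece phi (fan l) q.1 & bottom_piece phi (fan (ordS l)) q.2].
  (* The value [(0, 0)] is a placeholder for the last patch at a boundary vertex, which no interface
     follows. *)
  have [c|c] := pselect (dom D (vpos v) \/ (l.+1 < valence v)%N); last by exists (0, 0).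
  have [q Hq] := inter_pieces Hphi (fan_inter HS c); by exists q.
have [fX HX] := choice HQ.
rewrite /vert_proj; case: asboolP => Hd.
  exists (fun l : 'I_(valence v) => (fX l).1),
    (fun l : 'I_(valence v) => (fX (ord_pred l)).2); split.
  - congr (_ - _); rewrite [X in _ = _ + X](reindex_inj (@ordS_inj _)) -big_split /=.
    by apply: eq_bigr => l _; rewrite ordSK; have [] := HX l (or_introl Hd).
  - by move=> l; have [] := HX l (or_introl Hd).
  - by move=> l; have [_ _] := HX (ord_pred l) (or_introl Hd); rewrite ord_predK.
have [fl Hl] := choice (fun l : 'I_(valence v) => left_pieces phi (fan l)).
have [fb Hb] := choice (fun l : 'I_(valence v) => bottom_pieces phi (fan l)).
exists (fun l : 'I_(valence v) => if (l.+1 < valence v)%N then (fX l).1 else fl l),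
  (fun l : 'I_(valence v) => if l == 0%N :> nat then fb l else (fX (ord_pred l)).2).
(* The cyclic predecessor of a patch is the last patch only if the patch is the first one; this
   separates true interfaces from the wrap-around. *)
have pred_lt (l : 'I_(valence v)) : l != 0%N :> nat -> ((ord_pred l).+1 < valence v)%N.
  rewrite -lt0n => l0; rewrite -[nat_of_ord (ord_pred l)]/((l + valence v).-1 %% valence v)%N.
  rewrite (_ : (l + valence v).-1 = l.-1 + valence v)%N; last by rewrite -!subn1 addnBAC.
  rewrite modnDr modn_small; last exact: leq_ltn_trans (leq_pred _) (ltn_ord l).
  by rewrite prednK.
have pred_0 (l : 'I_(valence v)) : l = 0%N :> nat -> ((ord_pred l).+1 < valence v)%N = false.
  move=> l0; have v0 := ltn_ord l.
  rewrite -[nat_of_ord (ord_pred l)]/((l + valence v).-1 %% valence v)%N l0 add0n.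
  rewrite l0 in v0; rewrite modn_small; last by rewrite prednK.
  by rewrite prednK // ltnn.
split.
- congr (_ - _).
  rewrite [X in _ = X + _](bigID (fun l : 'I_(valence v) => (l.+1 < valence v)%N)) /=.
  rewrite [X in _ = _ + X](bigID (fun l : 'I_(valence v) => (l == 0%N :> nat))).
  rewrite [X in _ = _ + (_ + X)](reindex_inj (@ordS_inj _)).
  have -> : \sum_(l < valence v | (l.+1 < valence v)%N)
        inter_proj p r n (fan l) (fan (ordS l)) phi =
      \sum_(l < valence v | (l.+1 < valence v)%N) on_patch (fan l) (fX l).1 +
      \sum_(l < valence v | (l.+1 < valence v)%N) on_patch (fan (ordS l)) (fX l).2.
    by rewrite -big_split; apply: eq_bigr => l lv; have [] := HX l (or_intror lv).
  rewrite [LHS](AC (1*2*1) ((2*4)*(1*3))) /=.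
  congr (_ + _ + (_ + _)).
  + by apply: eq_bigr => l ->.
  + apply: eq_big => l; first by rewrite -leqNgt eqn_leq ltn_ord.
    by move=> /eqP lv; rewrite ifN; [exact: (Hl l).1|rewrite -leqNgt lv].
  + by apply: eq_bigr => l l0; rewrite ifT; [exact: (Hb l).1|exact: l0].
  + apply: eq_big => l.
      rewrite -{1}(ordSK l); apply/idP/idP => [lv|H]; last exact: (pred_lt (ordS l) H).
      by apply/negP => /eqP H; have := pred_0 (ordS l) H; rewrite lv.
    move=> lv; rewrite ordSK ifN //; apply/negP => /eqP H.
    by have := pred_0 (ordS l) H; rewrite ordSK lv.
- move=> l; case: ifP => lv; last exact: (Hl l).2.
  by have [] := HX l (or_intror lv).
- move=> l; case: ifP => [_|/negbT l0]; first exact: (Hb l).2.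
  by have [_ _] := HX (ord_pred l) (or_intror (pred_lt l l0)); rewrite ord_predK.
Qed.

End VertexSpaces.

(** * Bases of the vertex spaces *)

Section VertexBasis.
Context {R : realType} (D : multipatch R) (p r n : nat) (nrm : 'M[R]_2 -> R).
Hypotheses (r_gt0 : (0 < r)%N) (rp : (r + 2 <= p)%N) (n_gt0 : (0 < n)%N)
  (N5 : (5 <= Nminus p r n)%N).
Hypotheses (HD : multipatch_domain D p r n) (HS : standard_forms D)
  (HA : analysis_suitable D) (Hn : is_norm nrm).
Implicit Types (a b : frame D) (v : vert D).

Let jet := @pullback_jet R D.

Lemma glue_lin (K : finType) (c : K -> R) (u : K -> mfun D) :
  glue (\sum_k c k *: u k) = \sum_k c k *: glue (u k).
Proof.
apply/funext => x; transitivity (\sum_k c k * glue (u k) x); last by rewrite fct_sumE.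
rewrite /glue.
case: pickP => [i _|_]; first by rewrite !fct_sumE.
by rewrite big1 // => k _; rewrite mulr0.
Qed.

Lemma jet_lin v (K : finType) (c : K -> R) (phi : K -> patch D -> R * R -> R) chi
    (l : 'I_(valence v)) :
  (forall k, C2_at v (phi k)) -> C2_at v chi ->
  (forall i, closed_patch i (vpos v) -> forall m1 m2, (m1 + m2 <= 2)%N ->
     dmix m1 m2 (chi i) (vpos v) = \sum_k c k * dmix m1 m2 (phi k i) (vpos v)) ->
  forall m1 m2, (m1 + m2 <= 2)%N ->
    jet chi (fan l) m1 m2 = \sum_k c k * jet (phi k) (fan l) m1 m2.
Proof.
move=> Hphi [Hchi _] E m1 m2 m12; rewrite /jet (pullback_jetE n_gt0 HD (Hchi _) m12).
pose J k (m1 m2 : nat) := dmix m1 m2 (phi k (fan l).1) (corner (fan l)).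
rewrite (comp_jet_lin (c := c) (J := J)).
  apply: eq_bigr => k _; have [Hk _] := Hphi k.
  by rewrite (pullback_jetE n_gt0 HD (Hk _) m12).
by move=> k1 k2 k12; rewrite /J (fan_corner HS); apply: E => //; exact: fan_closed_patch.
Qed.

(** Formulated on jets at the vertex: for a family of one function it says that the projection
    depends on the 2-jet only. *)
Lemma vert_proj_lin v (K : finType) (c : K -> R) (phi : K -> patch D -> R * R -> R) chi :
  (forall k, C2_at v (phi k)) -> C2_at v chi ->
  (forall i, closed_patch i (vpos v) -> forall m1 m2, (m1 + m2 <= 2)%N ->
     dmix m1 m2 (chi i) (vpos v) = \sum_k c k * dmix m1 m2 (phi k i) (vpos v)) ->
  vert_proj p r n v chi = \sum_k c k *: vert_proj p r n v (phi k).
Proof.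
move=> Hphi Hchi E; have EJ l := jet_lin l Hphi Hchi E.
have EI (l : 'I_(valence v)) : std_interface (fan l) (fan (ordS l)) ->
    inter_proj p r n (fan l) (fan (ordS l)) chi =
    \sum_k c k *: inter_proj p r n (fan l) (fan (ordS l)) (phi k).
  move=> Hst; apply: (inter_proj_lin r_gt0 rp n_gt0 N5 Hst.1).
  - exact: (al1_neq0 HA Hst).
  - by move=> k; exact: (fan_compat n_gt0 HD HS HA (Hphi k) Hst).
  - by move=> a' m1 m2 m12 [->|->]; exact: EJ.
have EL (l : 'I_(valence v)) : left_proj p r n (fan l) chi =
    \sum_k c k *: left_proj p r n (fan l) (phi k).
  apply: (single_lin (side := true) r_gt0 rp n_gt0 N5 (left_low_span r_gt0 rp n_gt0 N5 _)).
  exact: EJ.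
have EB (l : 'I_(valence v)) : bottom_proj p r n (fan l) chi =
    \sum_k c k *: bottom_proj p r n (fan l) (phi k).
  apply: (single_lin (side := false) r_gt0 rp n_gt0 N5
    (bottom_low_span r_gt0 rp n_gt0 N5 _)).
  exact: EJ.
have EP (l : 'I_(valence v)) : patch_proj p r n (fan l) chi =
    \sum_k c k *: patch_proj p r n (fan l) (phi k).
  by apply: (patch_proj_lin r_gt0 rp n_gt0 N5); exact: EJ.
have X (P : pred 'I_(valence v)) (F : 'I_(valence v) -> _ -> mfun D) :
    (forall l, P l -> F l chi = \sum_k c k *: F l (phi k)) ->
    \sum_(l | P l) F l chi = \sum_k c k *: \sum_(l | P l) F l (phi k).
  move=> EF; rewrite (eq_bigr _ EF) exchange_big; apply: eq_bigr => k _.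
  by rewrite scaler_sumr.
rewrite /vert_proj; case: asboolP => Hd.
  rewrite (X xpredT (fun l => inter_proj p r n (fan l) (fan (ordS l)))); last first.
    by move=> l _; apply/EI/(fan_inter HS); left.
  rewrite (X xpredT (fun l => patch_proj p r n (fan l))) // -sumrB.
  by apply: eq_bigr => k _; rewrite scalerBr.
rewrite (X _ (fun l => bottom_proj p r n (fan l))) //.
rewrite (X _ (fun l => inter_proj p r n (fan l) (fan (ordS l)))); last first.
  by move=> l lv; apply/EI/(fan_inter HS); right.
rewrite (X _ (fun l => left_proj p r n (fan l))) //.
rewrite (X xpredT (fun l => patch_proj p r n (fan l))) //.
rewrite -!big_split -sumrB.
by apply: eq_bigr => k _; rewrite /= scalerBr !scalerDr.
Qed.

Let s v := vert_scale p n nrm v.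

Lemma norm_gt0 (A : 'M[R]_2) : A != 0 -> 0 < nrm A.
Proof.
have [H0 HZ HT] := Hn; move=> A0.
have n0 : nrm 0 = 0 by have := HZ 0 0; rewrite scale0r normr0 mul0r.
have nN : nrm (- A) = nrm A by rewrite -scaleN1r HZ normrN1 mul1r.
have : 0 <= nrm A + nrm A by rewrite -{2}nN -n0 -(subrr A); exact: HT.
rewrite -mulr2n pmulrn_lge0 // le_eqVlt => /orP[/eqP/esym/H0 A00|//].
by rewrite A00 eqxx in A0.
Qed.

Lemma vert_scale_neq0 v : s v != 0.
Proof.
rewrite /s /vert_scale invr_eq0 gt_eqF //.
have v0 := valence_gt0 HS v; have p0 : (0 < p)%N by lia.
apply: mulr_gt0.
  by rewrite divr_gt0 ?invr_gt0 ?mulr_gt0 ?ltr0n.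
rewrite (bigD1 (Ordinal v0)) //=; apply: ltr_wpDr.
  by apply: sumr_ge0 => l _; apply/ltW/norm_gt0/(jac_fparam_neq0 n_gt0 HD).
exact/norm_gt0/(jac_fparam_neq0 n_gt0 HD).
Qed.

Definition monomial_polys v (j1 j2 : nat) : {poly R} * {poly R} :=
  ((s v ^+ (j1 + j2) / j1`!%:R) *: ('X - (vpos v).1%:P) ^+ j1,
   j2`!%:R^-1 *: ('X - (vpos v).2%:P) ^+ j2).

(** The coefficients refer to the scaled monomials whose projections are the vertex functions, so
    that [c] becomes the coordinate vector of the projection. *)
Definition taylor v (c : vert_ix -> R) : patch D -> R * R -> R :=
  fun _ => tpoly [seq (c j *: (monomial_polys v (val j).1 (val j).2).1,
    (monomial_polys v (val j).1 (val j).2).2) | j <- index_enum vert_ix].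

Definition monomial v (j : vert_ix) : patch D -> R * R -> R :=
  fun _ => tpoly [:: monomial_polys v (val j).1 (val j).2].

Lemma vert_funE v (j : vert_ix) :
  vert_fun p r n nrm v (val j).1 (val j).2 = vert_proj p r n v (monomial v j).
Proof.
rewrite /vert_fun; congr vert_proj; apply/funext => i; apply/funext => x.
rewrite /monomial /tpoly big_seq1 /monomial_polys /= !hornerZ !horner_exp !hornerXsubC.
rewrite -/(s v); ring.
Qed.

Lemma C2_at_tpoly v q : C2_at v (fun=> tpoly q : R * R -> R).
Proof. by split=> [i|//]; exact: smooth_tpoly. Qed.

Lemma dmix_monomial v (j : vert_ix) i m1 m2 :
  dmix m1 m2 (monomial v j i) (vpos v) =
  s v ^+ ((val j).1 + (val j).2) * ((val j).1 == m1 :> nat)%:R * ((val j).2 == m2 :> nat)%:R.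
Proof.
rewrite /monomial dmix_tpoly /tpoly /= big_seq1 /= !derivnZ !hornerZ !derivn_monomial.
have F k : (k`!)%:R != 0 :> R by rewrite pnatr_eq0 -lt0n fact_gt0.
by have := F (val j).1; have := F (val j).2 => f1 f2; field; apply/andP.
Qed.

Lemma dmix_taylor v c i m1 m2 : dmix m1 m2 (taylor v c i) (vpos v) =
  \sum_j c j * dmix m1 m2 (monomial v j i) (vpos v).
Proof.
rewrite /taylor dmix_tpoly /tpoly !big_map; apply: eq_bigr => j _ /=.
by rewrite /monomial dmix_tpoly /tpoly /= big_seq1 /= derivnZ hornerZ mulrA.
Qed.

Lemma vert_ix_ex m1 m2 : (m1 + m2 <= 2)%N ->
  exists j : vert_ix, (val j).1 = m1 :> nat /\ (val j).2 = m2 :> nat.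
Proof.
move=> m12.
have H : ((inord m1 : 'I_3) + (inord m2 : 'I_3) <= 2)%N by rewrite !inordK //; lia.
exists (exist _ (inord m1, inord m2) H : vert_ix).
by split; rewrite /= inordK //; lia.
Qed.

Lemma vert_ix_eq (j k : vert_ix) : (val k).1 = (val j).1 :> nat ->
  (val k).2 = (val j).2 :> nat -> k = j.
Proof.
move=> e1 e2; apply/val_inj; move: e1 e2; case: (val j) (val k) => x y [x' y'] /=.
by move=> /val_inj -> /val_inj ->.
Qed.

Lemma jet_taylor v c i (j : vert_ix) :
  dmix (val j).1 (val j).2 (taylor v c i) (vpos v) =
  c j * s v ^+ ((val j).1 + (val j).2).
Proof.
rewrite dmix_taylor (bigD1 j) //= big1 ?addr0; first by rewrite dmix_monomial !eqxx !mulr1.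
move=> k kj; rewrite dmix_monomial.
case: eqP => e1; last by rewrite mulr0 mul0r mulr0.
case: eqP => e2; last by rewrite !mulr0.
by rewrite (vert_ix_eq e1 e2) eqxx in kj.
Qed.

Lemma vert_proj_taylor v c : vert_proj p r n v (taylor v c) =
  \sum_j c j *: vert_fun p r n nrm v (val j).1 (val j).2.
Proof.
rewrite (vert_proj_lin (phi := monomial v) (c := c)).
- by apply: eq_bigr => j _; rewrite vert_funE.
- by move=> j; exact: C2_at_tpoly.
- exact: C2_at_tpoly.
- by move=> i _ m1 m2 _; exact: dmix_taylor.
Qed.

(** A function and its Taylor polynomial at the vertex have the same 2-jet, hence the same
    projection. The jet is common to all patches at the vertex, so any one of them, here [i0],
    provides the coefficients. *)
Lemma vert_space_lspan v : vert_space p r n v = lspan (vert_basis p r n nrm v).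
Proof.
apply/seteqP; split=> [_ [phi Hphi <-]|_ [c ->]]; last first.
  exists (taylor v c); first exact: C2_at_tpoly.
  by rewrite vert_proj_taylor glue_lin.
have v0 := valence_gt0 HS v; pose i0 := (fan (Ordinal v0)).1.
have Hi0 : closed_patch i0 (vpos v) by exact: fan_closed_patch.
pose c (j : vert_ix) := dmix (val j).1 (val j).2 (phi i0) (vpos v)
  / s v ^+ ((val j).1 + (val j).2).
exists c; rewrite -glue_lin -vert_proj_taylor; congr glue.
(* Linearity for a family with a single member of coefficient 1 amounts to equality of the two
   projections. *)
rewrite (vert_proj_lin (phi := fun _ : unit => taylor v c) (c := fun=> 1)).
- by rewrite big_const card_unit /= addr0 scale1r.
- by move=> _; exact: C2_at_tpoly.
- exact: Hphi.
move=> i Hi m1 m2 m12; rewrite big_const card_unit /= addr0 mul1r.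
have [j [<- <-]] := vert_ix_ex m12.
rewrite jet_taylor /c divfK ?expf_neq0 ?vert_scale_neq0 //.
by case: Hphi => _; apply => //; case: j => -[? ?].
Qed.

Lemma taylor_jet_inj v c (l : 'I_(valence v)) :
  (forall m1 m2, (m1 + m2 <= 2)%N -> jet (taylor v c) (fan l) m1 m2 = 0) ->
  forall j, c j = 0.
Proof.
move=> H j.
have j12 : ((val j).1 + (val j).2 <= 2)%N by case: j => -[].
have : dmix (val j).1 (val j).2 (taylor v c (fan l).1) (corner (fan l)) = 0.
  apply: (comp_jet_inj (fjet_cross n_gt0 HD (fan l))
    (J := fun k m => dmix k m (taylor v c (fan l).1) (corner (fan l)))) => //.
  move=> m1 m2 m12; rewrite -[RHS](H m1 m2 m12).
  by rewrite /jet (pullback_jetE n_gt0 HD) //; exact: smooth_tpoly.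
rewrite (fan_corner HS) jet_taylor => /eqP.
by rewrite mulf_eq0 expf_eq0 (negPf (vert_scale_neq0 v)) andbF orbF => /eqP.
Qed.

End VertexBasis.

(** * Linear independence *)

Section Independence.
Context {R : realType} (D : multipatch R) (p r n : nat) (nrm : 'M[R]_2 -> R).
Hypotheses (r_gt0 : (0 < r)%N) (rp : (r + 2 <= p)%N) (n_gt0 : (0 < n)%N)
  (N5 : (5 <= Nminus p r n)%N).
Hypotheses (HD : multipatch_domain D p r n) (HS : standard_forms D)
  (HA : analysis_suitable D) (Hn : is_norm nrm).
Implicit Types (a b : frame D) (v : vert D) (u : mfun D).

Let delta : R := n%:R^-1.
Let pn : R := p%:R * n%:R.
Let delta_gt0 : 0 < delta.
Proof. by rewrite invr_gt0 ltr0n. Qed.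
Let delta_le1 : delta <= 1.
Proof. by rewrite invf_le1 ?ltr0n // ler1n. Qed.
Let rp0 : (r < p)%N. Proof. by apply: leq_trans rp; rewrite addn2. Qed.
Let rp1 : (r.+1 < p)%N. Proof. by apply: leq_trans rp; rewrite addn2. Qed.
Let rp2 : (r < p.-1)%N. Proof. by rewrite -ltnS prednK // (leq_trans _ rp1). Qed.
Let pn_neq0 : pn != 0.
Proof. by rewrite mulf_neq0 // pnatr_eq0 -lt0n // (leq_trans _ rp0). Qed.

Lemma open_rot z : open_sq z -> open_sq (rot z : R * R).
Proof.
by case: z => x y [/= /andP[x0 x1] /andP[y0 y1]]; split => /=; apply/andP; split; lra.
Qed.

Lemma open_iter_rot m z : open_sq z -> open_sq (iter m rot z : R * R).
Proof. by elim: m => //= m IH /IH; exact: open_rot. Qed.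

Lemma open_unit z : open_sq z -> unit_sq (z : R * R).
Proof.
by move=> [/andP[x0 x1] /andP[y0 y1]]; split; apply/andP; split; exact: ltW.
Qed.

Lemma unit_iter_rot m z : unit_sq z -> unit_sq (iter m rot z : R * R).
Proof.
elim: m z => //= m IH z /IH; case: (iter m rot z) => x y [].
move=> /= /andP[x0 x1] /andP[y0 y1].
by split; apply/andP; split => /=; lra.
Qed.

Lemma left_side_not_open m (t : R) : ~ open_sq (iter m rot (0, t)).
Proof.
(* Three times as many further rotations complete [m] full turns and bring the point back to the
   left side. *)
move=> H; have := @open_iter_rot (m * 3) _ H; rewrite -iterD.
have -> : iter (m * 3 + m) rot (0, t) = (0, t).
  rewrite (_ : (m * 3 + m = m * 4)%N); last by lia.
  by elim: m {H} => [//|m IH]; rewrite mulSn iterD IH rot4.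
by move=> [/andP[]] /=; rewrite ltxx.
Qed.

(** Distinct closed patches meet in vertices or edges only, so a point of an open patch lies in no
    other closed patch, and injectivity fixes its parameter. *)
Lemma glue_interior u i z : open_sq z -> glue u (param i z) = u i z.
Proof.
move=> Hz; have Uz := open_unit Hz; rewrite /glue.
have side a t : unit_itv t -> a.1 = i -> param i z = fparam a (0, t) -> False.
  move=> Ht ai Eq; have u0 : unit_itv (0 : R) by apply/andP; rewrite lexx ler01.
  have U : unit_sq (iter a.2 rot (0, t)) by apply: unit_iter_rot; split.
  rewrite /fparam ai in Eq.
  by have Ez := param_inj HD Uz U Eq; rewrite Ez in Hz; exact: left_side_not_open Hz.
case: pickP => [j /asboolP Hj|/(_ i)]; last by move/asboolPn; case; exists z.
have ij : j = i.
  apply/eqP; apply: contraT; rewrite eq_sym => ij.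
  have Hi : closed_patch i (param i z) by exists z.
  have I : (closed_patch i `&` closed_patch j) (param i z) by [].
  case: (no_hanging_nodes HD ij) => [E|[a [b [ai bj _ E]]]|[a [b [ai bj E _]]]].
  - by rewrite E in I.
  - rewrite E in I; case: (side a 0) => //.
    by apply/andP; rewrite lexx ler01.
  - by rewrite E in I; case: I => t Ht Eq; case: (side a t).
subst j; case: xgetP => [w -> [Uw Ew]|/(_ z)[]//].
by rewrite (param_inj HD Uw Uz Ew).
Qed.

Lemma glue_eq0 u i z : glue u = 0 -> open_sq z -> u i z = 0.
Proof. by move=> u0 Hz; rewrite -glue_interior // u0. Qed.

Lemma pull_eq0 u a z : glue u = 0 -> open_sq z -> pull u a z = 0.
Proof. by move=> u0 Hz; apply: glue_eq0 => //; exact: open_iter_rot. Qed.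

Lemma dpull_eq0 u a m1 m2 : lp delta u -> glue u = 0 -> dpull a m1 m2 u = 0.
Proof.
move=> /(_ a)[P HP] u0; rewrite /dpull (dmix_locp delta_gt0 _ _ HP).
have -> : P = 0.
  apply: (locp_eq0 delta_gt0 HP) => z /andP[x0 x1] /andP[y0 y1].
  by apply: pull_eq0 => //; split; apply/andP; split => //; exact: lt_le_trans delta_le1.
by rewrite !coef0 mul0r.
Qed.

Lemma frame_eq a b : a.1 = b.1 -> ((4 - b.2 + a.2) %% 4 = 0)%N -> a = b.
Proof.
case: a b => [i [k Hk]] [j [l Hl]] /= -> H; congr (_, _); apply/val_inj => /=.
move: k l Hk Hl H => [|[|[|[|//]]]] [|[|[|[|//]]]] _ _ //=.
Qed.

(** The number [(4 - b.2 + a.2) %% 4] is the rotation that relates two frames of one patch; on any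
    other patch the function is 0. *)
Lemma dpull_on_patch0 K a b h m1 m2 : sepsum delta K h -> (m1 + m2 <= 2)%N ->
  (a.1 = b.1 -> forall a0 a1 b0 b1 : nat,
     iter ((4 - b.2 + a.2) %% 4)%N rotK K a0 a1 b0 b1 -> (3 <= a0 + b0)%N) ->
  dpull a m1 m2 (on_patch b h) = 0.
Proof.
move=> Hh m12 HK; rewrite /dpull pull_on_patch; case: eqP => [ab|_]; last first.
  have L : locp delta (fun=> 0) 0 by move=> z _ _; rewrite !horner0.
  by rewrite (dmix_locp delta_gt0 _ _ L) !coef0 mul0r.
have [P HP P0] := sepsum_locp delta_gt0 (sepsum_mod (4 - b.2 + a.2) Hh).
by rewrite (dmix_locp delta_gt0 _ _ HP) P0 ?mul0r //; exact: HK ab.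
Qed.

Lemma pull_on_patch_side K a b h : sepsum delta K h ->
  (a.1 = b.1 -> forall a0 a1 b0 b1 : nat,
     iter ((4 - b.2 + a.2) %% 4)%N rotK K a0 a1 b0 b1 -> (2 <= a0)%N) ->
  forall y, exists q : {poly R}, forall x, x < delta ->
    pull (on_patch b h) a (x, y) = x ^+ 2 * q.[x].
Proof.
move=> Hh HK y; rewrite pull_on_patch; case: eqP => [ab|_]; last first.
  by exists 0 => x _; rewrite horner0 mulr0.
exact: (sepsum_side (sepsum_mod (4 - b.2 + a.2) Hh) (HK ab)).
Qed.

Definition efr (e : edge D) : frame D :=
  match e with inl s => (inter_std s).1 | inr s => bdry_std s end.

Lemma left_edge_nonempty a : left_edge a !=set0.
Proof. by exists (fparam a (0, 2^-1)); exists 2^-1 => //=; apply/andP; split; lra. Qed.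

(** Within each kind of edges this is part of the bijections with sets of points. An interface is no
    boundary edge, since it lies in the domain, which [Gamma] avoids. *)
Lemma efr_inj e e' : left_edge (efr e) = left_edge (efr e') -> e = e'.
Proof.
have [fi ii _] := inter_bij HS; have [fb ib _] := bdry_bij HS.
have disj (s : inter D) (s' : bdry D) :
    left_edge (inter_std s).1 = left_edge (bdry_std s') -> False.
  have [_ Hs] := fi s I; have [_ Hs'] := fb s' I; move=> E.
  have [x Hx] := left_edge_nonempty (bdry_std s').
  have [_] := Hs' x Hx; apply; apply: Hs; by rewrite /= E.
case: e e' => [s|s] [s'|s'] /= E.
- by congr inl; apply: ii => //; rewrite inE.
- by case: (disj _ _ E).
- by case: (disj _ _ (esym E)).
- by congr inr; apply: ib => //; rewrite inE.
Qed.

Definition edge_mfun (e : edge D) (j1 j2 : nat) : mfun D :=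
  match e with
  | inl s => inter_fun p r n (inter_std s).1 (inter_std s).2 j1 j2
  | inr s => left_fun p r n (bdry_std s) j1 j2
  end.

Definition edge_be (e : edge D) : {poly R} := match e with
  inl s => be1 (gdata (inter_std s).1 (inter_std s).2) | inr _ => 0 end.
Definition edge_al (e : edge D) : {poly R} := match e with
  inl s => al1 (gdata (inter_std s).1 (inter_std s).2) | inr _ => 1 end.

Lemma edge_al_neq0 e y : 0 < y < 1 -> (edge_al e).[y] != 0.
Proof.
move=> /andP[y0 y1]; case: e => [s|s] /=; last by rewrite hornerC oner_neq0.
have [[_ _ Hp _] _] := HA (inter_is_std HS s).
have := Hp y; case: eqP => // ->; rewrite mul0r ltxx => H; apply: H.
by apply/andP; split; exact: ltW.
Qed.

Lemma fparam_turn b t : fparam (turn b) (0, t) = fparam b (1 - t, 0).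
Proof.
rewrite /fparam /turn; congr param.
rewrite -[nat_of_ord (ordS b.2)]/(b.2.+1 %% 4)%N -iter_rot_mod iterSr.
by rewrite /rot.
Qed.

Lemma left_edge_turn b : left_edge (turn b) = bottom_edge b.
Proof.
apply/seteqP; split=> [_ [t t01 <-]|_ [t t01 <-]].
  exists (1 - t); last by rewrite fparam_turn.
  by move: t01 => /andP[t0 t1] /=; apply/andP; split; lra.
exists (1 - t); last by rewrite fparam_turn subKr.
by move: t01 => /andP[t0 t1] /=; apply/andP; split; lra.
Qed.

Lemma left_edge_std a b : std_interface a b -> left_edge (turn b) = left_edge a.
Proof.
move=> [_ H]; rewrite left_edge_turn.
apply/seteqP; split=> [_ [t t01 <-]|_ [t t01 <-]]; exists t => //; rewrite H //;
  by move: t01 => /andP[t0 t1]; apply/andP; split; exact: ltW.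
Qed.

Lemma on_patch_turn b h : on_patch b h = on_patch (turn b) (h \o rot) :> mfun D.
Proof.
apply/funext => i; apply/funext => z; rewrite /on_patch /=; case: eqP => // _.
rewrite -iterS iter_rot_mod [in RHS]iter_rot_mod; congr (h (iter _ _ _)).
by case: b.2 => -[|[|[|[|//]]]].
Qed.

(** In the frame [turn b] the interface is the left side of the second patch as well, so [Kedge]
    controls both halves. The second half lives on another patch and is invisible in the frame of
    the first; for a boundary edge it is 0. *)
Lemma edge_forms e (j : edge_ix p r n) : exists b h,
  [/\ edge_mfun e (val j).1 (val j).2 =
      on_patch (efr e) (lf p r n (eA p r n (val j).1 (val j).2)
         (eB p r n (edge_be e) (edge_al e) (val j).1 (val j).2)) + on_patch b h,
      sepsum delta Kedge h, left_edge b = left_edge (efr e),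
      sepsum delta Kedge (lf p r n (eA p r n (val j).1 (val j).2)
         (eB p r n (edge_be e) (edge_al e) (val j).1 (val j).2)) &
      pull (on_patch b h) (efr e) = fun=> 0].
Proof.
have [j3 jN] : (3 <= (val j).1 + (val j).2)%N /\ ((val j).1 + 3 <= Nminus p r n)%N.
  by case: j => x /= /andP.
have j2 : ((val j).2 <= 1)%N by rewrite -ltnS.
have OA := eA_edge r_gt0 rp n_gt0 N5 j3 jN.
have OB be al := eB_edge r_gt0 rp n_gt0 N5 be al j2 j3 jN.
case: e => [s|s] /=.
  have [ab Hst] := inter_is_std HS s; set a := (inter_std s).1; set b := (inter_std s).2.
  rewrite (inter_funE r_gt0 rp n_gt0 N5) [on_patch b _]on_patch_turn.
  eexists (turn b), _; split; first reflexivity.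
  - by rewrite bf_rot; apply: (lf_edge r_gt0 rp n_gt0 N5); exact: ord_rev.
  - exact: left_edge_std.
  - exact: (lf_edge r_gt0 rp n_gt0 N5).
  - exact: pull_on_patch_neq.
exists (bdry_std s), (fun=> 0); split.
- by rewrite (left_funE r_gt0 rp n_gt0 N5) on_patch0 addr0.
- exact: sep_zero.
- by [].
- exact: (lf_edge r_gt0 rp n_gt0 N5).
- by rewrite on_patch0.
Qed.

Lemma dpullD a m1 m2 (u w : mfun D) : lp delta u -> lp delta w ->
  dpull a m1 m2 (u + w) = dpull a m1 m2 u + dpull a m1 m2 w.
Proof.
move=> Hu Hw; have [P HP] := Hu a; have [Q HQ] := Hw a.
rewrite /dpull (dmix_locp delta_gt0 _ _ HP) (dmix_locp delta_gt0 _ _ HQ).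
rewrite -mulrDl -!coefD.
exact: (dmix_locp delta_gt0 _ _ (locpD HP HQ)).
Qed.

Definition corner_flat a u :=
  lp delta u /\ forall m1 m2, (m1 + m2 <= 2)%N -> dpull a m1 m2 u = 0.

Lemma corner_flat_lin a (K : finType) (c : K -> R) (u : K -> mfun D) :
  (forall k, corner_flat a (u k)) -> corner_flat a (\sum_k c k *: u k).
Proof.
move=> H; split; first by apply: lp_lin => k; have [] := H k.
move=> m1 m2 m12; rewrite (dpull_lin delta_gt0); last by move=> k; have [] := H k.
by rewrite big1 // => k _; have [_ ->] := H k; rewrite ?mulr0.
Qed.

Lemma corner_flat_sum a (K : finType) (P : pred K) (u : K -> mfun D) :
  (forall k, P k -> corner_flat a (u k)) -> corner_flat a (\sum_(k | P k) u k).
Proof.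
move=> H; apply: (big_ind (corner_flat a)) => //; last 1 first.
- move=> u1 u2 [L1 Z1] [L2 Z2]; split; first exact: lpD.
  by move=> m1 m2 m12; rewrite dpullD // Z1 // Z2 // addr0.
have L : forall b, locp delta (pull (0 : mfun D) b) 0 by move=> b z _ _; rewrite !horner0.
split; first by move=> b; exists 0.
by move=> m1 m2 _; rewrite /dpull (dmix_locp delta_gt0 _ _ (L a)) !coef0 mul0r.
Qed.

Lemma corner_flatD a u w : corner_flat a u -> corner_flat a w -> corner_flat a (u + w).
Proof.
move=> [L1 Z1] [L2 Z2]; split; first exact: lpD.
by move=> m1 m2 m12; rewrite dpullD // Z1 // Z2 // addr0.
Qed.

Lemma patch_fun_sep i (j : patch_ix p r n) :
  exists2 h, patch_fun p r n ((i, ord0) : frame D) (val j).1 (val j).2 = on_patch (i, ord0) h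
  & sepsum delta Kinner h.
Proof.
eexists; first reflexivity.
have /and4P[j1 j1' j2 j2'] : [&& 2 <= (val j).1, (val j).1 + 3 <= NB p r n,
    2 <= (val j).2 & (val j).2 + 3 <= NB p r n]%N by case: j.
have O (k : 'I_(NB p r n)) : (2 <= k)%N -> (k + 3 <= NB p r n)%N ->
    ord delta 2 2 (@Bs R p r n k).
  by move=> k2 kN; apply: ord_le (Bs_ord rp0 n_gt0 (ltn_ord k)) => //; lia.
by apply: (sep_term (O _ j1 j1') (O _ j2 j2')); split.
Qed.

Lemma patch_corner_flat a i (j : patch_ix p r n) :
  corner_flat a (patch_fun p r n ((i, ord0) : frame D) (val j).1 (val j).2).
Proof.
have [h -> Hh] := patch_fun_sep i j; split; first exact: lp_on_patch Hh.
move=> m1 m2 m12; apply: (dpull_on_patch0 Hh m12) => _ a0 a1 b0 b1 /Kinner_rot[]; lia.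
Qed.

Lemma edge_corner_flat a e (j : edge_ix p r n) :
  corner_flat a (edge_mfun e (val j).1 (val j).2).
Proof.
have [b [h [-> Hh _ Hl _]]] := edge_forms e j.
have F b' h' : sepsum delta Kedge h' -> corner_flat a (on_patch b' h').
  move=> H; split; first exact: lp_on_patch H.
  by move=> m1 m2 m12; apply: (dpull_on_patch0 H m12) => _ ? ? ? ?; exact: Kedge_corner.
exact: (corner_flatD (F _ _ Hl) (F _ _ Hh)).
Qed.

(** A frame determines its corner. If a patch belongs to the fans of both vertices, its two frames
    therefore differ by a nontrivial rotation, and [Kvert] applies. *)
Lemma vert_corner_flat v v' (l : 'I_(valence v)) c : v' != v ->
  corner_flat (fan l) (vert_proj p r n v' (taylor p n nrm v' c)).
Proof.
move=> vv; have [H [-> HH]] := vert_pieces r_gt0 rp n_gt0 N5 HD HS HA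
  (C2_at_tpoly v' _ : C2_at v' (taylor p n nrm v' c)).
apply: corner_flat_sum => m _; have [Hm _] := HH m; split; first exact: lp_on_patch Hm.
move=> m1 m2 m12; apply: (dpull_on_patch0 Hm m12) => Efan a0 a1 b0 b1.
apply: Kvert_corner; apply: contra vv => /eqP /(frame_eq Efan) E.
have [_ vinj _] := vert_bij HS.
by apply/eqP/vinj; rewrite ?inE // -(fan_corner HS m) -(fan_corner HS l) E.
Qed.

Lemma vert_own_corner v (l : 'I_(valence v)) c m1 m2 : (m1 + m2 <= 2)%N ->
  lp delta (vert_proj p r n v (taylor p n nrm v c)) /\
  dpull (fan l) m1 m2 (vert_proj p r n v (taylor p n nrm v c)) =
  pullback_jet (taylor p n nrm v c) (fan l) m1 m2.
Proof.
move=> m12; have [H [-> HH]] := vert_pieces r_gt0 rp n_gt0 N5 HD HS HA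
  (C2_at_tpoly v _ : C2_at v (taylor p n nrm v c)).
have Lp m : lp delta (on_patch (fan m) (H m)) by have [Hm _] := HH m; exact: lp_on_patch Hm.
rewrite (bigD1 l) //=.
have [LR ZR] : corner_flat (fan l) (\sum_(m < valence v | m != l) on_patch (fan m) (H m)).
  apply: corner_flat_sum => m ml; split; first exact: Lp.
  move=> k1 k2 k12; have [Hm _] := HH m; apply: (dpull_on_patch0 Hm k12) => Efan.
  have [_ finj _] := fan_patches HS v.
  by case/eqP: ml; apply: finj; rewrite ?inE.
split; first exact: lpD.
rewrite dpullD // ZR // addr0 /dpull pull_on_patch_id.
by have [_ ->] := HH l.
Qed.

(** The vertex part is written as projections of Taylor polynomials, which keeps the interpolated
    jets in view. *)
Definition combination (cP : patch D -> patch_ix p r n -> R)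
    (cE : edge D -> edge_ix p r n -> R) (cV : vert D -> vert_ix -> R) : mfun D :=
  \sum_i \sum_j cP i j *: patch_fun p r n (i, ord0) (val j).1 (val j).2
  + \sum_e \sum_j cE e j *: edge_mfun e (val j).1 (val j).2
  + \sum_v vert_proj p r n v (taylor p n nrm v (cV v)).

Lemma vert_coef0 cP cE cV : glue (combination cP cE cV) = 0 -> forall v j, cV v j = 0.
Proof.
move=> G v; have l := Ordinal (valence_gt0 HS v).
apply: (taylor_jet_inj r_gt0 rp n_gt0 N5 HD HS Hn (l := l)) => m1 m2 m12.
have [Lv <-] := vert_own_corner l (cV v) m12.
pose rest := \sum_i \sum_j cP i j *: patch_fun p r n ((i, ord0) : frame D) (val j).1 (val j).2
  + \sum_e \sum_j cE e j *: edge_mfun e (val j).1 (val j).2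
  + \sum_(v' | v' != v) vert_proj p r n v' (taylor p n nrm v' (cV v')).
have [Lr Zr] : corner_flat (fan l) rest.
  apply: corner_flatD; first apply: corner_flatD.
  - by apply: corner_flat_sum => i _; apply: corner_flat_lin => j; exact: patch_corner_flat.
  - by apply: corner_flat_sum => e _; apply: corner_flat_lin => j; exact: edge_corner_flat.
  - by apply: corner_flat_sum => v' vv; exact: vert_corner_flat.
have E : combination cP cE cV = vert_proj p r n v (taylor p n nrm v (cV v)) + rest.
  by rewrite /combination (bigD1 v) //= /rest addrCA.
have L : lp delta (combination cP cE cV) by rewrite E; exact: lpD.
have := dpull_eq0 (fan l) m1 m2 L G.
by rewrite E dpullD // Zr // addr0.
Qed.

Lemma vert_part0 :
  \sum_v vert_proj p r n v (taylor p n nrm v (fun=> 0)) = 0 :> mfun D.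
Proof.
rewrite big1 // => v _; rewrite (vert_proj_taylor nrm r_gt0 rp n_gt0 N5 HD HS HA).
by rewrite big1 // => j _; rewrite scale0r.
Qed.

Definition side_flat a (y : R) u := exists q : {poly R}, forall x, x < delta ->
  pull u a (x, y) = x ^+ 2 * q.[x].

Lemma side_flat0 a y : side_flat a y 0.
Proof. by exists 0 => x _; rewrite horner0 mulr0. Qed.

Lemma side_flatD a y u w : side_flat a y u -> side_flat a y w -> side_flat a y (u + w).
Proof.
move=> [q Eq] [s Es]; exists (q + s) => x xd.
by rewrite hornerD mulrDr -Eq // -Es.
Qed.

Lemma side_flatZ a y c u : side_flat a y u -> side_flat a y (c *: u).
Proof.
move=> [q Eq]; exists (c *: q) => x xd.
by rewrite hornerZ mulrCA -Eq.
Qed.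

Lemma side_flat_sum a y (K : finType) (P : pred K) (u : K -> mfun D) :
  (forall k, P k -> side_flat a y (u k)) -> side_flat a y (\sum_(k | P k) u k).
Proof.
move=> H; apply: (big_ind (side_flat a y)) => //; first exact: side_flat0.
by move=> u1 u2; exact: side_flatD.
Qed.

Lemma patch_side_flat a y i (j : patch_ix p r n) :
  side_flat a y (patch_fun p r n ((i, ord0) : frame D) (val j).1 (val j).2).
Proof.
have [h -> Hh] := patch_fun_sep i j.
by apply: (pull_on_patch_side Hh) => _ a0 a1 b0 b1 /Kinner_rot[].
Qed.

Lemma edge_side_flat y e e' (j : edge_ix p r n) : e' != e ->
  side_flat (efr e) y (edge_mfun e' (val j).1 (val j).2).
Proof.
move=> ee; have [b [h [-> Hh Eb Hl _]]] := edge_forms e' j.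
have F b' h' : left_edge b' = left_edge (efr e') -> sepsum delta Kedge h' ->
    side_flat (efr e) y (on_patch b' h').
  move=> Eb' H; apply: (pull_on_patch_side H) => E1 a0 a1 b0 b1.
  apply: Kedge_side; apply: contra ee => /eqP /(frame_eq E1) E.
  by apply/eqP/efr_inj; rewrite -Eb' E.
by apply: side_flatD; exact: F.
Qed.

(** At a fixed height the pullback is a polynomial in the distance to the edge, whose two lowest
    coefficients involve functions of this edge only. The lowest one is a combination of the [b^+];
    once those coefficients vanish, the next one is a combination of the [b^-] times the nonzero
    factor [pn * al]. *)
Lemma edge_coef0 cP cE : glue (combination cP cE (fun _ _ => 0)) = 0 ->
  forall e j, cE e j = 0.
Proof.
move=> G e; set a := efr e.
pose fA (j : edge_ix p r n) := @eA R p r n (val j).1 (val j).2.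
pose fB (j : edge_ix p r n) := eB p r n (edge_be e) (edge_al e) (val j).1 (val j).2.
have key y : 0 < y < 1 -> \sum_j cE e j * fA j y = 0 /\ \sum_j cE e j * fB j y = 0.
  move=> y01.
  have [q Eq] : side_flat a y (\sum_i \sum_j cP i j *:
      patch_fun p r n ((i, ord0) : frame D) (val j).1 (val j).2
    + \sum_(e' | e' != e) \sum_j cE e' j *: edge_mfun e' (val j).1 (val j).2).
    apply: side_flatD.
      by do 2!(apply: side_flat_sum => ? _); apply: side_flatZ; exact: patch_side_flat.
    apply: side_flat_sum => e' ee; apply: side_flat_sum => j _.
    by apply: side_flatZ; exact: edge_side_flat.
  pose Q := (\sum_j cE e j * fA j y) *: C0pol p r n + (\sum_j cE e j * fB j y) *: C1pol p r n
    + 'X^2 * q.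
  have Q0 : Q = 0.
    apply: (poly_eq0_itv delta_gt0 (g := id)) => // x /andP[x0 xd]; apply/eqP.
    have Hz : open_sq (x, y).
      by split => //=; rewrite x0 (lt_le_trans xd).
    rewrite -[RHS](pull_eq0 a G Hz) /combination vert_part0 addr0.
    rewrite [X in _ = pull (_ + X) _ _](bigD1 e) //= addrCA.
    rewrite -[RHS]/(pull (\sum_j cE e j *: edge_mfun e (val j).1 (val j).2) a (x, y) +
      pull (_ + _) a (x, y)) Eq //.
    rewrite /Q hornerD hornerM hornerXn; congr (_ + _).
    rewrite hornerD 2!hornerZ -(c0_near r_gt0 rp n_gt0 N5 xd) -(c1_near r_gt0 rp n_gt0 N5 xd).
    rewrite /pull !fct_sumE !mulr_suml -big_split; apply: eq_bigr => j _ /=.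
    have [b [h [E _ _ _ Eb]]] := edge_forms e j.
    rewrite -[RHS]/(cE e j * pull (edge_mfun e (val j).1 (val j).2) a (x, y)) E.
    rewrite -[pull _ _ _]/(pull (on_patch a _) a (x, y) + pull (on_patch b h) a (x, y)).
    by rewrite Eb pull_on_patch_id addr0 /lf /= -/(fA j) -/(fB j); ring.
  have X2 k : (k < 2)%N -> ('X^2 * q)`_k = 0 by move=> k2; rewrite coefXnM k2.
  have H0 : Q`_0 = 0 by rewrite Q0 coef0.
  have H1 : Q`_1 = 0 by rewrite Q0 coef0.
  move: H0 H1; rewrite 2!coefD 2!coefZ X2 // (C0_0 r_gt0 rp n_gt0 N5) (C1_0 r_gt0 rp n_gt0 N5).
  rewrite mulr1 mulr0 !addr0 => ->.
  rewrite 2!coefD 2!coefZ X2 // (C0_1 r_gt0 rp n_gt0 N5) (C1_1 r_gt0 rp n_gt0 N5).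
  by rewrite mulr1 mulr0 add0r addr0.
have ixE (j k : edge_ix p r n) : (val k).1 = (val j).1 :> nat ->
    ((val k).2 == 0%N :> nat) = ((val j).2 == 0%N :> nat) -> k = j.
  move=> e1 e2; apply/val_inj; move: e1 e2; case: (val j) (val k) => x y [x' y'] /=.
  move=> /val_inj -> e2; congr (_, _); apply/val_inj.
  by move: y y' e2 => [[|[|//]] ?] [[|[|//]] ?].
have c0 (j : edge_ix p r n) : (val j).2 == 0%N :> nat -> cE e j = 0.
  move=> j0.
  have H := @Bs_indep_sum R p r.+1 n rp1 n_gt0 (edge_ix p r n)
    (fun j => (val j).2 == 0%N :> nat) (fun j => (val j).1) (cE e).
  rewrite -[RHS](H _ _ (val j).1).
  - by rewrite (big_pred1 j) // => k; apply/andP/eqP => [[k0 /eqP kj]|->];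
      [apply: ixE; rewrite ?k0 ?j0|].
  - by move=> k _; rewrite (@NB_plus R p r n r_gt0 rp n_gt0 N5); apply: leqW; exact: ltn_ord.
  - move=> y y01; have [H1 _] := key y y01; rewrite -[RHS]H1.
    rewrite [in RHS](bigID (fun j : edge_ix p r n => (val j).2 == 0%N :> nat)) /=.
    rewrite [X in _ = _ + X]big1 ?addr0; last first.
      by move=> k /negPf k0; rewrite /fA /eA k0 mulr0.
    by apply: eq_bigr => k k0; rewrite /fA /eA k0.
move=> j; case: (boolP ((val j).2 == 0%N :> nat)) => [|j0]; first exact: c0.
have H := @Bs_indep_sum R p.-1 r n rp2 n_gt0 (edge_ix p r n)
    (fun j => (val j).2 != 0%N :> nat) (fun j => (val j).1) (cE e).
rewrite -[RHS](H _ _ (val j).1).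
- by rewrite (big_pred1 j) // => k; apply/andP/eqP => [[/negPf k0 /eqP kj]|->];
    [apply: ixE; rewrite ?k0 ?(negPf j0)|].
- by move=> k _; exact: ltn_ord.
move=> y y01; have [_ H1] := key y y01.
have al0 := edge_al_neq0 e y01.
apply: (mulfI (mulf_neq0 pn_neq0 al0)); rewrite mulr0 -[RHS]H1 mulr_sumr.
rewrite [in RHS](bigID (fun j : edge_ix p r n => (val j).2 == 0%N :> nat)) /=.
rewrite [X in _ = X + _]big1 ?add0r; last first.
  by move=> k k0; rewrite c0 // mul0r.
apply: eq_bigr => k /negPf k0; rewrite /fB /eB k0 /Bminus -/pn; ring.
Qed.

(** Univariate independence is applied in each variable in turn, the other one being frozen at an
    interior value. *)
Lemma patch_coef0 cP : glue (combination cP (fun _ _ => 0) (fun _ _ => 0)) = 0 ->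
  forall i j, cP i j = 0.
Proof.
move=> G i.
have E0 : combination cP (fun _ _ => 0) (fun _ _ => 0) =
    \sum_i \sum_j cP i j *: patch_fun p r n ((i, ord0) : frame D) (val j).1 (val j).2.
  rewrite /combination vert_part0 addr0 [X in _ + X]big1 ?addr0 //.
  by move=> e _; rewrite big1 // => j _; rewrite scale0r.
have key x y : 0 < x < 1 -> 0 < y < 1 ->
    \sum_j cP i j * Bs p r n (val j).2 y * Bs p r n (val j).1 x = 0.
  move=> x01 y01; have Hz : open_sq (x, y) by split.
  have ev (K : finType) (u : K -> mfun D) : (\sum_k u k) i (x, y) = \sum_k u k i (x, y).
    by rewrite 2!fct_sumE.
  rewrite -[RHS](pull_eq0 (i, ord0) G Hz) E0 -[RHS]/((\sum_i' _) i (x, y)) ev.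
  rewrite [RHS](bigD1 i) //= [X in _ = _ + X]big1 ?addr0; last first.
    move=> i' ii; rewrite ev big1 // => j _.
    rewrite -[LHS]/(cP i' j * patch_fun p r n ((i', ord0) : frame D) _ _ i (x, y)).
    by rewrite /patch_fun /on_patch /= eq_sym (negPf ii) mulr0.
  rewrite ev; apply: eq_bigr => j _.
  rewrite -[RHS]/(cP i j * pull (patch_fun p r n ((i, ord0) : frame D) _ _) (i, ord0) (x, y)).
  by rewrite /patch_fun pull_on_patch_id /=; ring.
move=> j.
have H1 (y : R) : 0 < y < 1 -> \sum_(k : patch_ix p r n | (val k).1 == (val j).1 :> nat)
    cP i k * Bs p r n (val k).2 y = 0.
  move=> y01.
  have H := @Bs_indep_sum R p r n rp0 n_gt0 (patch_ix p r n) xpredT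
    (fun k => (val k).1) (fun k => cP i k * Bs p r n (val k).2 y).
  apply: H => [k _|x x01]; first exact: ltn_ord.
  exact: key.
have H := @Bs_indep_sum R p r n rp0 n_gt0 (patch_ix p r n)
  (fun k => (val k).1 == (val j).1 :> nat) (fun k => (val k).2) (cP i).
rewrite -[RHS](H _ H1 (val j).2) => [|k _]; last exact: ltn_ord.
rewrite (big_pred1 j) => [//|k]; apply/andP/eqP => [[/eqP k1 /eqP k2]|->//].
apply/val_inj; move: k1 k2; case: (val j) (val k) => x y [x' y'] /=.
by move=> /val_inj -> /val_inj ->.
Qed.

Lemma combination_inj cP cE cV : glue (combination cP cE cV) = 0 ->
  [/\ forall i j, cP i j = 0, forall e j, cE e j = 0 & forall v j, cV v j = 0].
Proof.
move=> G; have V0 := vert_coef0 G.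
have EV : cV = fun _ _ => 0 by apply/funext => v; apply/funext => j.
rewrite EV in G; have E0 := edge_coef0 G.
have EE : cE = fun _ _ => 0 by apply/funext => e; apply/funext => j.
by rewrite EE in G; split => //; exact: patch_coef0 G.
Qed.

Lemma glue_combination cP cE cV : glue (combination cP cE cV) =
  \sum_i \sum_j cP i j *: patch_basis i j + \sum_e \sum_j cE e j *: edge_basis e j
  + \sum_v \sum_j cV v j *: vert_basis p r n nrm v j.
Proof.
have gD u w : glue (u + w) = glue u + glue w.
  have := glue_lin (fun _ : bool => 1 : R) (fun k : bool => if k then u else w).
  by rewrite !big_bool /= !scale1r.
have gS (K : finType) (u : K -> mfun D) : glue (\sum_k u k) = \sum_k glue (u k).
  have := glue_lin (fun _ : K => 1 : R) u.
  by under eq_bigr do rewrite scale1r; under [in RHS]eq_bigr do rewrite scale1r.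
rewrite /combination !gD !gS; congr (_ + _ + _); apply: eq_bigr => k _.
- by rewrite glue_lin.
- by rewrite glue_lin; apply: eq_bigr => j _; case: k.
- by rewrite (vert_proj_taylor nrm r_gt0 rp n_gt0 N5 HD HS HA) glue_lin.
Qed.

End Independence.

(** * Spanning and directness of the sum *)

Section Basis.
Context {R : realType} (D : multipatch R) (p r n : nat) (nrm : 'M[R]_2 -> R).
Hypotheses (r_gt0 : (0 < r)%N) (rp : (r + 2 <= p)%N) (n_gt0 : (0 < n)%N)
  (N5 : (5 <= Nminus p r n)%N).
Hypotheses (HD : multipatch_domain D p r n) (HS : standard_forms D)
  (HA : analysis_suitable D) (Hn : is_norm nrm).

Local Notation basis := (@argyris_basis R D p r n nrm).
Local Notation summand := (@argyris_summand R D p r n).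

Lemma sum_argyris_basis (c : argyris_ix D p r n -> R) :
  \sum_k c k *: basis k = glue (combination nrm (fun i j => c (inl (inl (i, j))))
    (fun e j => c (inl (inr (e, j)))) (fun v j => c (inr (v, j)))).
Proof.
rewrite (glue_combination nrm r_gt0 rp n_gt0 N5 HD HS HA) 2!big_sumType /= !pair_big /=.
by congr (_ + _ + _); apply: eq_bigr => -[].
Qed.

(** Choosing coordinates in every summand at once turns an element of the sum into a single
    [combination]. *)
Lemma summand_coords (w : (patch D + edge D + vert D)%type -> R * R -> R) :
  (forall k, summand k (w k)) -> exists (cP : patch D -> patch_ix p r n -> R)
    (cE : edge D -> edge_ix p r n -> R) (cV : vert D -> vert_ix -> R),
  [/\ forall i, w (inl (inl i)) = \sum_j cP i j *: patch_basis i j,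
      forall e, w (inl (inr e)) = \sum_j cE e j *: edge_basis e j,
      forall v, w (inr v) = \sum_j cV v j *: vert_basis p r n nrm v j
    & \sum_k w k = glue (combination nrm cP cE cV)].
Proof.
move=> Hw.
have [cP EP] := choice (fun i => Hw (inl (inl i))).
have [cE EE] := choice (fun e => Hw (inl (inr e))).
have HV v : lspan (vert_basis p r n nrm v) (w (inr v)).
  by rewrite -(vert_space_lspan r_gt0 rp n_gt0 N5 HD HS HA Hn); exact: Hw (inr v).
have [cV EV] := choice HV.
exists cP, cE, cV; split => //.
rewrite (glue_combination nrm r_gt0 rp n_gt0 N5 HD HS HA) 2!big_sumType /=.
by congr (_ + _ + _); apply: eq_bigr.
Qed.

Lemma argyris_basis_indep : lin_indep basis.
Proof.
move=> c; rewrite sum_argyris_basis.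
move=> /(combination_inj r_gt0 rp n_gt0 N5 HD HS HA Hn)[cP0 cE0 cV0].
by move=> [[[i j]|[e j]]|[v j]].
Qed.

Lemma argyris_direct : direct_sum summand.
Proof.
move=> w Hw; have [cP [cE [cV [EP EE EV ->]]]] := summand_coords Hw.
move=> /(combination_inj r_gt0 rp n_gt0 N5 HD HS HA Hn)[cP0 cE0 cV0].
move=> [[i|e]|v]; rewrite ?EP ?EE ?EV big1 // => j _.
- by rewrite cP0 scale0r.
- by rewrite cE0 scale0r.
- by rewrite cV0 scale0r.
Qed.

Lemma argyris_lspan : lspan basis = argyris_space D p r n.
Proof.
apply/seteqP; split=> [_ [c ->]|_ [w Hw ->]].
  exists (fun k => match k with
    | inl (inl i) => \sum_j c (inl (inl (i, j))) *: patch_basis i j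
    | inl (inr e) => \sum_j c (inl (inr (e, j))) *: edge_basis e j
    | inr v => \sum_j c (inr (v, j)) *: vert_basis p r n nrm v j end).
    move=> [[i|e]|v] /=.
    - by exists (fun j => c (inl (inl (i, j)))).
    - by exists (fun j => c (inl (inr (e, j)))).
    - rewrite (vert_space_lspan r_gt0 rp n_gt0 N5 HD HS HA Hn).
      by exists (fun j => c (inr (v, j))).
  rewrite sum_argyris_basis (glue_combination nrm r_gt0 rp n_gt0 N5 HD HS HA).
  by rewrite [RHS]big_sumType [X in _ = X + _]big_sumType.
have [cP [cE [cV [_ _ _ ->]]]] := summand_coords Hw.
exists (fun k : argyris_ix D p r n => match k with
  | inl (inl (i, j)) => cP i j | inl (inr (e, j)) => cE e j | inr (v, j) => cV v j end).
by rewrite sum_argyris_basis.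
Qed.

End Basis.

(** For [n >= 1] one has [N^- = n (p - r - 1) + r + 1], so that the bound on [n] is just
    [N^- >= 5]. *)
Lemma Nminus_ge5 (R : realType) (p r n : nat) : (0 < r)%N -> (r + 2 <= p)%N ->
  (4 - r%:R) / (p%:R - r%:R - 1) <= n%:R :> R -> (5 <= Nminus p r n)%N.
Proof.
move=> r0 rp; have [m pE] : exists m, p = (r + 2 + m)%N by exists (p - (r + 2))%N; lia.
have -> : p%:R - r%:R - 1 = m.+1%:R :> R.
  by rewrite pE !natrD -[m.+1]addn1 natrD; ring.
rewrite ler_pdivrMr ?ltr0n // lerBlDr -natrM -natrD ler_nat.
rewrite /Nminus /NB pE => H.
have -> : ((r + 2 + m).-1 - r = m.+1)%N by lia.
case: n H => [|n] H; first lia.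
rewrite subn1 /= mulnC; move: H; rewrite mulSn; move: (n * m.+1)%N => ?; lia.
Qed.

Theorem mainTheorem2 (R : realType) (p r n : nat) (D : multipatch R)
  (nrm : 'M[R]_2 -> R) :
  (1 <= r <= p - 2)%N -> (1 <= n)%N ->
  (4 - r%:R) / (p%:R - r%:R - 1) <= n%:R :> R ->
  multipatch_domain D p r n -> standard_forms D -> analysis_suitable D ->
  is_norm nrm ->
  is_basis (@argyris_basis R D p r n nrm) (argyris_space D p r n) /\
  direct_sum (@argyris_summand R D p r n).
Proof.
move=> /andP[r0 rp] n0 Hn4 HD HS HA Hn.
have {}rp : (r + 2 <= p)%N by lia.
have N5 := Nminus_ge5 r0 rp Hn4.
split; first split.
- exact: (argyris_basis_indep r0 rp n0 N5 HD HS HA Hn).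
- exact: (argyris_lspan r0 rp n0 N5 HD HS HA Hn).
- exact: (argyris_direct r0 rp n0 N5 HD HS HA Hn).
Qed.
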